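(* Let $\mu$ be a positive measure on $\mathbb R$. Then $\mu$ is PW-sampling if and only if both of the following hold: (i) $\sup_{x\in\mathbb R}\mu((x,x+1))<\infty$; (ii) for every $t>0$ there exist $L>0$ and $\delta>0$ such that for every interval $I\subset\mathbb R$ with $|I|\ge L$ one has $C_\delta(I)\ge t|I|$.
   Context: For $a>0$, $\mathrm{PW}_a$ denotes the Paley–Wiener space: the entire functions of exponential type at most $a$ whose restrictions to $\mathbb R$ lie in $L^2(\mathbb R)$, with the $L^2(\mathbb R)$ norm. A positive measure $\mu$ on $\mathbb R$ is PW-sampling if for every $a>0$ there is $C>0$ such that $C^{-1}\|f\|_{L^2(\mathbb R)}\le \|f\|_{L^2(\mu)}\le C\|f\|_{L^2(\mathbb R)}$ for all $f\in\mathrm{PW}_a$. Given $\mu$ and $\delta>0$, an interval $l\subset\mathbb R$ is $\delta$-massive (with respect to $\mu$) if $\mu(l)\ge\delta$ and $|l|\ge\delta$ ($|l|$ = length). The $\delta$-capacity $C_\delta(I)$ of an interval $I$ is the maximal number of pairwise disjoint $\delta$-massive intervals intersecting $I$. *)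

(* Defs.v *)
From HB Require Import structures.
From mathcomp Require Import all_boot all_order all_algebra.
From mathcomp Require Import all_classical all_reals all_analysis.
From mathcomp Require Import complex.
Set Implicit Arguments. Unset Strict Implicit. Unset Printing Implicit Defensive.
Import Order.TTheory GRing.Theory Num.Theory.
Import numFieldNormedType.Exports.
Local Open Scope classical_set_scope.
Local Open Scope ring_scope.

Definition cabs {R : realType} (z : R[i]) : R := ComplexField.Normc.normc z.

Definition entire {R : realType} (f : R[i] -> R[i]) : Prop :=
  forall z : R[i], exists l : R[i], forall eps : R, 0 < eps ->
    exists d : R, 0 < d /\ forall h : R[i], 0 < cabs h -> cabs h < d ->
      cabs ((f (z + h) - f z) / h - l) < eps.

Definition exp_type_le {R : realType} (a : R) (f : R[i] -> R[i]) : Prop :=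
  forall eps : R, 0 < eps -> exists A : R, forall z : R[i],
    cabs (f z) <= A * expR ((a + eps) * cabs z).

Definition restr_abs {R : realType} (f : R[i] -> R[i]) : R -> \bar R :=
  fun x => (cabs (f (x%:C)%C))%:E.

Definition L2norm {R : realType} (mu : {measure set (measurableTypeR R) -> \bar R})
  (f : R[i] -> R[i]) : \bar R := Lnorm mu 2%:E (restr_abs f).

Definition PW {R : realType} (a : R) (f : R[i] -> R[i]) : Prop :=
  entire f /\ exp_type_le a f /\
  (L2norm (@lebesgue_measure R) f < +oo)%E.

Definition PW_sampling {R : realType} (mu : {measure set (measurableTypeR R) -> \bar R}) : Prop :=
  forall a : R, 0 < a -> exists C : R, 0 < C /\
    forall f, PW a f ->
      ((C^-1)%:E * L2norm (@lebesgue_measure R) f <= L2norm mu f)%E /\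
      (L2norm mu f <= C%:E * L2norm (@lebesgue_measure R) f)%E.

(* l is a bounded interval with endpoints a <= b (open, closed or half-open);
   its length is b - a *)
Definition interval_ab {R : realType} (l : set R) (a b : R) : Prop :=
  a <= b /\ `]a, b[ `<=` l /\ l `<=` `[a, b].

Definition massive {R : realType} (mu : {measure set (measurableTypeR R) -> \bar R}) (delta : R)
  (l : set R) : Prop :=
  exists a b, interval_ab l a b /\ (delta%:E <= mu l)%E /\ delta <= b - a.

Definition capacity {R : realType} (mu : {measure set (measurableTypeR R) -> \bar R}) (delta : R)
  (I : set R) : \bar R :=
  ereal_sup [set (n%:R)%:E | n in [set n : nat | exists l : nat -> set R,
      (forall i, (i < n)%N -> massive mu delta (l i) /\ l i `&` I !=set0) /\
      (forall i j, (i < j)%N -> (j < n)%N -> l i `&` l j = set0)]].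

(* Main.v *)
Require Import Defs.
From HB Require Import structures.
From mathcomp Require Import all_boot all_order all_algebra.
From mathcomp Require Import all_classical all_reals all_analysis.
From mathcomp Require Import complex.
From mathcomp Require Import measurable_realfun.
From mathcomp Require Import ring lra zify.
Import Order.TTheory GRing.Theory Num.Theory.
Import numFieldNormedType.Exports.
Local Open Scope classical_set_scope.
Local Open Scope ring_scope.
Set Implicit Arguments. Unset Strict Implicit. Unset Printing Implicit Defensive.

(** Sufficiency.  On the real line f in PW_a is u + i v, where u and v are smooth
    functions with |u^(k)(x)| <= A B^k exp(B|x|), B depending only on a: this comes from
    Cauchy's theorem on rectangles.  Bernstein's inequality ||u'|| <= K ||u|| in L2, with
    K = K(B), follows without Fourier analysis.  Put F = u (1 - x^2/m^2)^m on [-m, m]: its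
    derivatives of order below m vanish at the end points, so integration by parts makes
    k |-> ||F^(k)|| log-convex, and the growth bound on ||F^(m)|| controls the first ratio
    ||F'|| / ||F||; then m tends to infinity.

    If every long interval I contains N points taken in disjoint massive intervals, the
    Lagrange interpolation error on I is (const * |I|)^N / N! in terms of ||u^(N)||_{L2(I)};
    for N >= t|I| with t large it is absorbed after summing over a tiling of the line by
    such intervals, so that the massive intervals control ||u||.  Condition (i) gives the
    upper sampling inequality.

    Necessity.  Translates of sin x / x give (i).  If (ii) fails, some long interval I has
    few massive intervals compared with |I|; cut I into cells of a small fixed length.  A
    nonzero combination of translates of sin(kap x)/x * sin x/x with centers in the
    middle of I can be made to vanish at the left end of each massive cell, because there
    are more centers than massive cells.  On massive cells it is small by Poincare's
    inequality, on the other cells mu has little mass, and outside I it decays, so its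
    norm in L2(mu) contradicts the lower sampling inequality. *)

(** * Riemann integrals of continuous functions *)

Section ContinuousReal.
Variable R : realType.
Implicit Types (f g : R -> R).

(** The constants may not depend on the function, but the growth bound brings in an [A] that does,
    and it allows exponential growth along the real line. The (m+1)-th root taken through
    log-convexity removes [A]; exp(Bm) and the derivatives of the cutoff grow only geometrically in
    m, so their roots stay bounded. The interpolation error (const * L)^N / N! is small once N
    exceeds a multiple of L, with a multiple that depends on [a]; hence (ii) is used with a t
    depending on [a]. The two factors of the kernel in the necessity part have separate tasks. The
    zeros of sin(kap x)/x at the other centers turn coefficients into sampled values, which replaces
    orthogonality in the lower bound for the norm. The factor sin x / x has translates uniformly
    bounded in L2(mu). Outside I, with about |I| centers, Cauchy-Schwarz costs a factor |I| and the
    squared decay of the first factor gains |I|^2; the remaining 1/|I| is why I must be long. *)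

Lemma is_derive_continuous f g : (forall x : R, is_derive x 1 f (g x)) -> continuous f.
Proof.
move=> fg x; apply: differentiable_continuous; apply/derivable1_diffP.
by have [] := fg x.
Qed.

Lemma continuous_sqr f : continuous f -> continuous (fun x => f x ^+ 2).
Proof. by move=> cf x; apply: cvgM; exact: cf. Qed.

Lemma continuous_mul f g : continuous f -> continuous g -> continuous (fun x => f x * g x).
Proof. by move=> cf cg x; apply: cvgM; [exact: cf|exact: cg]. Qed.

Lemma continuous_add f g : continuous f -> continuous g -> continuous (fun x => f x + g x).
Proof. by move=> cf cg x; apply: cvgD; [exact: cf|exact: cg]. Qed.

Lemma continuous_sub f g : continuous f -> continuous g -> continuous (fun x => f x - g x).
Proof. by move=> cf cg x; apply: cvgB; [exact: cf|exact: cg]. Qed.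

Lemma continuous_opp f : continuous f -> continuous (fun x => - f x).
Proof. by move=> cf x; apply: cvgN; exact: cf. Qed.

Lemma continuous_cst (k : R) : continuous ((fun=> k) : R -> R).
Proof. exact: cst_continuous. Qed.

Lemma isd_eq f df df' (x : R) : is_derive x 1 f df -> df = df' -> is_derive x 1 f df'.
Proof. by move=> + <-. Qed.

Lemma isd_cst (k x : R) : is_derive x 1 ((fun=> k) : R -> R) 0.
Proof. exact: is_derive_cst. Qed.

Lemma isd_id (x : R) : is_derive x 1 ((fun y => y) : R -> R) 1.
Proof. exact: is_derive_id. Qed.

Lemma isdD f g df dg (x : R) : is_derive x 1 f df -> is_derive x 1 g dg ->
  is_derive x 1 (fun y => f y + g y) (df + dg).
Proof. exact: is_deriveD. Qed.

Lemma isdB f g df dg (x : R) : is_derive x 1 f df -> is_derive x 1 g dg ->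
  is_derive x 1 (fun y => f y - g y) (df - dg).
Proof. exact: is_deriveB. Qed.

Lemma isdM f g df dg (x : R) : is_derive x 1 f df -> is_derive x 1 g dg ->
  is_derive x 1 (fun y => f y * g y) (df * g x + f x * dg).
Proof.
move=> H K; apply: (isd_eq (is_deriveM H K)).
by rewrite addrC /GRing.scale /= (mulrC df).
Qed.

Lemma isdZ k f df (x : R) : is_derive x 1 f df -> is_derive x 1 (fun y => k * f y) (k * df).
Proof.
by move=> H; apply: (isd_eq (isdM (isd_cst k x) H)); rewrite mul0r add0r.
Qed.

Lemma isd_comp f g df dg (x : R) : is_derive x 1 f df -> is_derive (f x) 1 g dg ->
  is_derive x 1 (fun y => g (f y)) (dg * df).
Proof. by move=> H K; exact: (@is_derive1_comp _ g f x dg df). Qed.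

Lemma isdX n f df (x : R) : is_derive x 1 f df ->
  is_derive x 1 (fun y => f y ^+ n.+1) (n.+1%:R * f x ^+ n * df).
Proof.
move=> H; elim: n => [|n IH].
  by apply: (isd_eq H); rewrite expr0 !mul1r.
have -> : (fun y => f y ^+ n.+2) = (fun y => f y * f y ^+ n.+1) by apply/funext => y; rewrite exprS.
by apply: (isd_eq (isdM H IH)); rewrite -[n.+2]addn1 natrD !exprS; ring.
Qed.

End ContinuousReal.

Ltac cont := repeat (cbv beta; lazymatch goal with
  | |- continuous (fun x => @?f x - @?g x) => apply: (@continuous_sub _ f g)
  | |- continuous (fun x => @?f x + @?g x) => apply: (@continuous_add _ f g)
  | |- continuous (fun x => - @?f x) => apply: (@continuous_opp _ f)
  | |- continuous (fun x => @?f x ^+ 2) => apply: (@continuous_sqr _ f)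
  | |- continuous (fun x => @?f x * @?g x) => apply: (@continuous_mul _ f g)
  | |- continuous (fun x => ?k) => exact: (@continuous_cst _ k)
  | _ => assumption
  end).

Section RI.
Variable R : realType.
Implicit Types (a b c x y : R) (f g u v : R -> R).
Notation leb := (@lebesgue_measure R).

Definition RI a b g : R := (\int[leb]_(x in `[a, b]) g x)%R.

Lemma RI_integrable a b g : continuous g -> leb.-integrable `[a, b] (EFin \o g).
Proof.
move=> cg; apply: continuous_compact_integrable; first exact: segment_compact.
exact: continuous_subspaceT.
Qed.

Lemma RI_D a b f g : continuous f -> continuous g ->
  RI a b (fun x => f x + g x) = RI a b f + RI a b g.
Proof. by move=> cf cg; apply: RintegralD => //; exact: RI_integrable. Qed.

Lemma RI_B a b f g : continuous f -> continuous g ->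
  RI a b (fun x => f x - g x) = RI a b f - RI a b g.
Proof. by move=> cf cg; apply: RintegralB => //; exact: RI_integrable. Qed.

Lemma RI_Z a b k f : continuous f -> RI a b (fun x => k * f x) = k * RI a b f.
Proof. by move=> cf; apply: RintegralZl => //; exact: RI_integrable. Qed.

Lemma RI_le a b f g : continuous f -> continuous g ->
  (forall x, a <= x <= b -> f x <= g x) -> RI a b f <= RI a b g.
Proof.
move=> cf cg fg; apply: le_Rintegral => //; try exact: RI_integrable.
Qed.

Lemma RI_ge0 a b f : (forall x, a <= x <= b -> 0 <= f x) -> 0 <= RI a b f.
Proof. by move=> f0; apply: Rintegral_ge0 => x /=; rewrite in_itv; exact: f0. Qed.

Lemma RI_cst a b k : a <= b -> RI a b (fun=> k) = k * (b - a).
Proof.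
move=> ab; rewrite /RI Rintegral_cst//.
transitivity (k * fine (if (a%:E < b%:E)%E then (b%:E - a%:E)%E else 0%E)).
  by congr (_ * fine _); exact: (@lebesgue_measure_itv R `[a, b]).
rewrite lte_fin; case: (ltgtP a b) ab => //= -> _; by rewrite subrr.
Qed.

Lemma RI_eq a b f g : (forall x, a <= x <= b -> f x = g x) -> RI a b f = RI a b g.
Proof.
by move=> fg; apply: eq_Rintegral => x; rewrite inE /= in_itv; exact: fg.
Qed.

Lemma RI_split a b c f : continuous f -> a <= b -> b <= c ->
  RI a c f = RI a b f + RI b c f.
Proof.
move=> cf ab bc; have := @Rintegral_itvB R f (BLeft a) (BRight c) b.
rewrite !bnd_simp => /(_ (RI_integrable _ _ cf) ab bc).
rewrite Rintegral_itv_obnd_cbnd; last first.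
  apply: integrableS (RI_integrable b c cf) => //.
  by apply: subset_itvr; rewrite bnd_simp.
by rewrite /RI => <-; rewrite addrC subrK.
Qed.

Lemma RI_ftc a b f g : a <= b -> (forall x, is_derive x 1 f (g x)) -> continuous g ->
  RI a b g = f b - f a.
Proof.
move=> ab fg cg; case: (ltgtP a b) ab => // [ab _|-> _]; last first.
  by rewrite /RI set_itv1 Rintegral_set1 subrr.
have cf := is_derive_continuous fg.
rewrite /RI /Rintegral (@continuous_FTC2 _ g f)//.
- exact: continuous_subspaceT.
- split => [x _||]; first by have [] := fg x.
  + exact: cvg_at_right_filter (cf a).
  + exact: cvg_at_left_filter (cf b).
- by move=> x _; rewrite derive1E; have [] := fg x.
Qed.

(** The nonnegative quadratic t |-> integral of (f + t g)^2 has discriminant at most zero. *)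
Lemma RI_CS a b f g : continuous f -> continuous g ->
  RI a b (fun x => f x * g x) ^+ 2 <= RI a b (fun x => f x ^+ 2) * RI a b (fun x => g x ^+ 2).
Proof.
move=> cf cg.
set A := RI a b (fun x => f x ^+ 2); set B := RI a b (fun x => f x * g x).
set C := RI a b (fun x => g x ^+ 2).
have cf2 := continuous_sqr cf; have cg2 := continuous_sqr cg.
have cfg := continuous_mul cf cg.
have H t : 0 <= A + t * 2 * B + t ^+ 2 * C.
  rewrite (_ : _ + _ = RI a b (fun x => (f x + t * g x) ^+ 2)).
    by apply: RI_ge0 => x _; exact: sqr_ge0.
  rewrite -RI_Z; last by cont.
  rewrite -RI_Z; last by cont.
  rewrite -RI_D; [|by cont|by cont].
  rewrite -RI_D; [|by cont|by cont].
  by apply: RI_eq => x _; ring.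
have A0 : 0 <= A by apply: RI_ge0 => x _; exact: sqr_ge0.
have C0 : 0 <= C by apply: RI_ge0 => x _; exact: sqr_ge0.
have [C_0|Cn0] := eqVneq C 0.
  have [->|Bn0] := eqVneq B 0; first by rewrite expr0n /=; exact: mulr_ge0.
  (* For C = 0 the quadratic is affine in t, and this t gives it the value -1. *)
  have := H (- (A + 1) / (2 * B)); rewrite C_0 mulr0 addr0 -mulrA mulfVK ?mulf_neq0//; lra.
have Cp : 0 < C by rewrite lt_neqAle eq_sym Cn0.
have := H (- B / C).
rewrite (_ : _ + _ = (A * C - B ^+ 2) / C); last by field.
by rewrite pmulr_lge0 ?invr_gt0// subr_ge0.
Qed.

Lemma sqr_diff_le a b x y u v : a <= x -> x <= y -> y <= b ->
  (forall x, is_derive x 1 u (v x)) -> continuous v ->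
  (u y - u x) ^+ 2 <= (b - a) * RI a b (fun x => v x ^+ 2).
Proof.
move=> ax xy yb uv cv.
have cv2 := continuous_sqr cv.
have := @RI_CS x y (fun=> 1) v (@continuous_cst R _) cv.
rewrite (_ : (fun x => 1 * v x) = v); last by apply/funext => z; rewrite mul1r.
rewrite (RI_ftc xy uv cv) => /le_trans; apply.
rewrite (_ : RI x y _ = y - x); last first.
  rewrite (_ : (fun _ => _) = (fun=> 1)) ?RI_cst ?mul1r//.
  by apply/funext => z; rewrite expr1n.
have sq p q : 0 <= RI p q (fun x0 => v x0 ^+ 2).
  by apply: RI_ge0 => z _; exact: sqr_ge0.
apply: ler_pM; rewrite ?sq ?subr_ge0//; first lra.
rewrite (@RI_split a x b)//; last lra.
rewrite (@RI_split x y b)//.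
by have := sq a x; have := sq y b; lra.
Qed.

(** Average over y of u(x)^2 <= 2 u(y)^2 + 2 (u(x) - u(y))^2, the difference being bounded through
    the derivative. This is the main tool below for passing from point values to L2 norms. *)
Lemma sobolev_pt a b x u v : a < b -> a <= x <= b ->
  (forall x, is_derive x 1 u (v x)) -> continuous v ->
  u x ^+ 2 <= 2 / (b - a) * RI a b (fun x => u x ^+ 2)
           + 2 * (b - a) * RI a b (fun x => v x ^+ 2).
Proof.
move=> ab /andP[ax xb] uv cv.
have cu := is_derive_continuous uv.
have cu2 := continuous_sqr cu.
set V := RI a b (fun x => v x ^+ 2).
have H y : a <= y <= b -> u x ^+ 2 <= 2 * u y ^+ 2 + 2 * ((b - a) * V).
  move=> /andP[ay yb].
  have K : (u x - u y) ^+ 2 <= (b - a) * V.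
    have [xy|yx] := leP x y.
      by rewrite -sqrrN opprB; apply: sqr_diff_le.
    by apply: sqr_diff_le => //; exact: ltW.
  have := sqr_ge0 (u x - 2 * u y); nra.
have := @RI_le a b (fun=> u x ^+ 2) (fun y => 2 * u y ^+ 2 + 2 * ((b - a) * V))
  (@continuous_cst R _) ltac:(by cont) H.
rewrite RI_D; [|by cont|by cont].
rewrite RI_Z; last by cont.
rewrite !RI_cst ?(ltW ab)//.
set U := RI a b _ => K.
have p : 0 < b - a by rewrite subr_gt0.
rewrite -(ler_pM2r p); apply: le_trans K _.
by rewrite [leRHS](_ : _ = 2 * U + 2 * ((b - a) * V) * (b - a))//; field; lra.
Qed.

End RI.

(** * Complex differentiability in little-o form *)

Notation cRe := (@complex.Re _).
Notation cIm := (@complex.Im _).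

#[global] Arguments cabs : simpl never.

Section Cder.
Variable R : realType.
Implicit Types (z w h l m : R[i]) (f g : R[i] -> R[i]) (r s : R[i] -> R[i]) (x y : R).
Local Notation "x %:C" := (real_complex R x).

Lemma cabsE x y : cabs (x +i* y)%C = Num.sqrt (x ^+ 2 + y ^+ 2).
Proof. by []. Qed.

Lemma cabs_ge0 z : 0 <= cabs z.
Proof. by case: z => x y; exact: sqrtr_ge0. Qed.
Hint Resolve cabs_ge0 : core.

Lemma cabsM z w : cabs (z * w) = cabs z * cabs w.
Proof. exact: ComplexField.Normc.normcM. Qed.

Lemma cabsV z : cabs z^-1 = (cabs z)^-1.
Proof. exact: ComplexField.Normc.normcV. Qed.

Lemma cabsD z w : cabs (z + w) <= cabs z + cabs w.
Proof. exact: le_normcD. Qed.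

Lemma cabsN z : cabs (- z) = cabs z.
Proof. exact: normcN. Qed.

Lemma cabsB z w : cabs (z - w) <= cabs z + cabs w.
Proof. by rewrite -(cabsN w); exact: cabsD. Qed.

Lemma cabs0 : cabs (0 : R[i]) = 0.
Proof. exact: ComplexField.Normc.normc0. Qed.

Lemma cabs1 : cabs (1 : R[i]) = 1.
Proof. exact: ComplexField.Normc.normc1. Qed.

Lemma cabs_eq0 z : (cabs z == 0) = (z == 0).
Proof.
by apply/eqP/eqP => [/ComplexField.Normc.eq0_normc//|->]; exact: cabs0.
Qed.

Lemma cabs_gt0 z : (0 < cabs z) = (z != 0).
Proof. by rewrite lt_neqAle cabs_ge0 andbT eq_sym cabs_eq0. Qed.

Lemma cabsX z n : cabs (z ^+ n) = cabs z ^+ n.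
Proof. by elim: n => [|n IH]; rewrite ?expr0 ?cabs1// !exprS cabsM IH. Qed.

Lemma cabs_real x : cabs x%:C = `|x|.
Proof. by rewrite cabsE expr0n addr0 sqrtr_sqr. Qed.

Lemma cabs_i x : cabs ('i%C * x%:C) = `|x|.
Proof. by rewrite cabsM cabs_real cabsE expr0n add0r expr1n sqrtr1 mul1r. Qed.

Lemma cabs_sqr z : cabs z ^+ 2 = cRe z ^+ 2 + cIm z ^+ 2.
Proof. by case: z => x y; rewrite cabsE sqr_sqrtr// addr_ge0// sqr_ge0. Qed.

Lemma Re_le_cabs z : `|cRe z| <= cabs z.
Proof.
by rewrite -[leLHS]sqrtr_sqr; case: z => x y; rewrite cabsE ler_wsqrtr//= lerDl sqr_ge0.
Qed.

Lemma Im_le_cabs z : `|cIm z| <= cabs z.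
Proof.
by rewrite -[leLHS]sqrtr_sqr; case: z => x y; rewrite cabsE ler_wsqrtr//= lerDr sqr_ge0.
Qed.

Lemma cabs_le_ReIm z : cabs z <= `|cRe z| + `|cIm z|.
Proof.
have -> : cabs z = cabs ((cRe z)%:C + 'i%C * (cIm z)%:C) by congr cabs; exact: complexE.
by apply: le_trans (cabsD _ _) _; rewrite cabs_real cabs_i.
Qed.

Lemma cabs_rev z w : cabs z - cabs w <= cabs (z + w).
Proof. by rewrite lerBlDr; apply: le_trans (cabsB (z + w) w); rewrite addrK. Qed.

(** Landau form of the limit: there is no division, and h = 0 is included, which forces r(0) = 0.
    The chain rule becomes the substitution [little_comp]. *)
Definition little r := forall eps : R, 0 < eps -> exists2 d : R, 0 < d &
  forall h, cabs h < d -> cabs (r h) <= eps * cabs h.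

Definition bigO r := exists K : R, 0 < K /\ exists2 d : R, 0 < d &
  forall h, cabs h < d -> cabs (r h) <= K * cabs h.

Lemma little_ext r s : (forall h, r h = s h) -> little r -> little s.
Proof. by move=> /funext ->. Qed.

Lemma bigO_ext r s : (forall h, r h = s h) -> bigO r -> bigO s.
Proof. by move=> /funext ->. Qed.

Lemma little0 : little (fun=> 0).
Proof. by move=> e e0; exists 1 => // h _; rewrite cabs0 mulr_ge0// ltW. Qed.

Lemma littleD r s : little r -> little s -> little (fun h => r h + s h).
Proof.
move=> Hr Hs e e0; have e2 : 0 < e / 2 by rewrite divr_gt0.
have [d d0 H] := Hr _ e2; have [d' d'0 H'] := Hs _ e2.
exists (Num.min d d'); first by rewrite lt_min d0.
move=> h; rewrite lt_min => /andP[/H h1 /H' h2].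
by apply: le_trans (cabsD _ _) _; lra.
Qed.

Lemma bigO_little r : little r -> bigO r.
Proof. by move=> /(_ 1 ltr01) H; exists 1; split. Qed.

Lemma bigOD r s : bigO r -> bigO s -> bigO (fun h => r h + s h).
Proof.
move=> [K [K0 [d d0 H]]] [K' [K'0 [d' d'0 H']]]; exists (K + K').
split; [lra|exists (Num.min d d'); first by rewrite lt_min d0].
move=> h; rewrite lt_min => /andP[/H h1 /H' h2].
by apply: le_trans (cabsD _ _) _; lra.
Qed.

Lemma bigO_mul l : bigO (fun h => l * h).
Proof.
exists (cabs l + 1); split; first by have := cabs_ge0 l; lra.
by exists 1 => // h _; rewrite cabsM ler_wpM2r//; lra.
Qed.

Lemma littleZ l r : little r -> little (fun h => l * r h).
Proof.
move=> H e e0; have K0 : 0 < cabs l + 1 by have := cabs_ge0 l; lra.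
have [d d0 Hd] := H (e / (cabs l + 1)) (divr_gt0 e0 K0).
exists d => // h /Hd hh; rewrite cabsM.
have : cabs l * cabs (r h) <= (cabs l + 1) * (e / (cabs l + 1) * cabs h).
  apply: ler_pM => //; lra.
by rewrite mulrA (mulrC (_ + 1)) divfK// gt_eqF.
Qed.

Lemma little_OO r s : bigO r -> bigO s -> little (fun h => r h * s h).
Proof.
move=> [K [K0 [d d0 H]]] [K' [K'0 [d' d'0 H']]] e e0.
have KK : 0 < K * K' by exact: mulr_gt0.
exists (Num.min (Num.min d d') (e / (K * K'))).
  by rewrite !lt_min d0 d'0 divr_gt0.
move=> h; rewrite !lt_min => /andP[/andP[/H h1 /H' h2]]; rewrite ltr_pdivlMr// => h3.
rewrite cabsM; apply: le_trans (ler_pM _ _ h1 h2) _ => //.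
rewrite mulrACA mulrA; apply: ler_wpM2r => //; rewrite mulrC; exact: ltW.
Qed.

Lemma little_comp r k : little r -> bigO k -> little (fun h => r (k h)).
Proof.
move=> Hr [K [K0 [d d0 H]]] e e0.
have [d' d'0 H'] := Hr (e / K) (divr_gt0 e0 K0).
exists (Num.min d (d' / K)); first by rewrite lt_min d0 divr_gt0.
move=> h; rewrite lt_min => /andP[/H h1]; rewrite ltr_pdivlMr// => h2.
have := H' (k h); rewrite mulrC in h2 => /(_ (le_lt_trans h1 h2)) /le_trans; apply.
by rewrite -mulrA ler_pM2l// mulrC ler_pdivrMr// mulrC.
Qed.

Definition cder f z l := little (fun h => f (z + h) - f z - l * h).

Lemma cderP f z l : (forall eps : R, 0 < eps ->
    exists d : R, 0 < d /\ forall h : R[i], 0 < cabs h -> cabs h < d ->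
      cabs ((f (z + h) - f z) / h - l) < eps) <-> cder f z l.
Proof.
split=> H e e0.
  have [d [d0 Hd]] := H e e0; exists d => // h hd.
  have [->|h0] := eqVneq h 0; first by rewrite addr0 subrr mulr0 subrr cabs0 mulr0.
  have hp : 0 < cabs h by rewrite cabs_gt0.
  have := Hd h hp hd; rewrite -(ltr_pM2r hp) -cabsM mulrBl divfK// => /ltW.
  by [].
have e2 : 0 < e / 2 by rewrite divr_gt0.
have [d d0 Hd] := H _ e2; exists d; split => // h hp /Hd.
have h0 : h != 0 by rewrite -cabs_gt0.
rewrite -ler_pdivrMr// -cabsV -cabsM mulrBl mulfK// => /le_lt_trans; apply; lra.
Qed.

Lemma entireP f : entire f <-> forall z, exists l, cder f z l.
Proof. by split=> H z; have [l /cderP Hl] := H z; exists l. Qed.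

Lemma cder_bigO f z l : cder f z l -> bigO (fun h => f (z + h) - f z).
Proof.
move=> /bigO_little H; apply: bigO_ext (bigOD H (bigO_mul l)) => h.
by rewrite /= subrK.
Qed.

Lemma cder_cst l z : cder (fun=> l) z 0.
Proof. by apply: little_ext little0 => h; rewrite subrr mul0r subrr. Qed.

Lemma cder_id z : cder id z 1.
Proof. by apply: little_ext little0 => h /=; ring. Qed.

Lemma cderD f g z l m : cder f z l -> cder g z m -> cder (fun w => f w + g w) z (l + m).
Proof. by move=> fl gm; apply: little_ext (littleD fl gm) => h; ring. Qed.

Lemma cderM f g z l m : cder f z l -> cder g z m ->
  cder (fun w => f w * g w) z (l * g z + f z * m).
Proof.
move=> fl gm; have OO := little_OO (cder_bigO fl) (cder_bigO gm).
apply: little_ext (littleD (littleD (littleZ (g z) fl) (littleZ (f z) gm)) OO) => h.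
ring.
Qed.

Lemma cderZ f z l k : cder f z l -> cder (fun w => k * f w) z (k * l).
Proof. by move=> /(littleZ k); apply: little_ext => h; ring. Qed.

Lemma cder_comp f g z l m : cder f z l -> cder g (f z) m -> cder (fun w => g (f w)) z (m * l).
Proof.
move=> fl gm.
apply: little_ext (littleD (little_comp gm (cder_bigO fl)) (littleZ m fl)) => h.
have -> : f z + (f (z + h) - f z) = f (z + h) by ring.
by ring.
Qed.

Lemma cder_inv z : z != 0 -> cder (fun w => w^-1) z (- z ^- 2).
Proof.
move=> z0; have zp : 0 < cabs z by rewrite cabs_gt0.
move=> e e0; have z3 : 0 < cabs z ^+ 3 by exact: exprn_gt0.
exists (Num.min (cabs z / 2) (e * cabs z ^+ 3 / 2)).
  by rewrite lt_min !divr_gt0// mulr_gt0.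
move=> h; rewrite lt_min => /andP[h1 h2].
have zh : cabs z / 2 < cabs (z + h) by have := cabs_rev z h; lra.
have zhp : 0 < cabs (z + h) by apply: lt_trans zh; rewrite divr_gt0.
have zh0 : z + h != 0 by rewrite -cabs_gt0.
rewrite (_ : _ - _ = h * h / (z ^+ 2 * (z + h))); last by field; rewrite zh0.
rewrite !cabsM cabsV cabsM cabsX -mulrA mulrC; apply: ler_wpM2r => //.
have p2 : 0 < cabs z ^+ 2 by exact: exprn_gt0.
rewrite ler_pdivrMr ?mulr_gt0//; apply: le_trans (ltW h2) _.
rewrite -mulrA ler_pM2l// exprSr -mulrA ler_pM2l//; exact: ltW.
Qed.

Lemma cderV f z l : f z != 0 -> cder f z l -> cder (fun w => (f w)^-1) z (- (f z) ^- 2 * l).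
Proof. by move=> f0 fl; apply: (cder_comp fl); exact: cder_inv. Qed.

Lemma cder_sum n (F : nat -> R[i] -> R[i]) z (l : nat -> R[i]) :
  (forall k, (k < n)%N -> cder (F k) z (l k)) ->
  cder (fun w => \sum_(k < n) F k w) z (\sum_(k < n) l k).
Proof.
elim: n => [|n IH] H.
  by rewrite big_ord0; apply: little_ext (@cder_cst 0 z) => h; rewrite !big_ord0.
have K := IH (fun k kn => H k (ltnW kn)).
rewrite big_ord_recr; apply: little_ext (cderD K (H n (ltnSn n))) => h.
by rewrite !big_ord_recr.
Qed.

Lemma cder_near f g z l : (exists2 d : R, 0 < d & forall h, cabs h < d -> f (z + h) = g (z + h)) ->
  cder f z l -> cder g z l.
Proof.
move=> [d d0 fg] H e e0; have [d' d'0 Hd] := H e e0.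
exists (Num.min d d'); first by rewrite lt_min d0.
move=> h; rewrite lt_min => /andP[h1 /Hd]; rewrite fg//.
by have := fg 0; rewrite addr0 cabs0 => ->.
Qed.

Lemma cder_cont f z l : cder f z l -> forall e : R, 0 < e -> exists2 d : R, 0 < d &
  forall h, cabs h < d -> cabs (f (z + h) - f z) < e.
Proof.
move=> /cder_bigO [K [K0 [d d0 H]]] e e0.
exists (Num.min d (e / K)); first by rewrite lt_min d0 divr_gt0.
move=> h; rewrite lt_min => /andP[/H h1]; rewrite ltr_pdivlMr// mulrC.
exact: le_lt_trans.
Qed.

End Cder.
#[global] Hint Extern 0 (is_true (0 <= cabs _)%R) => solve [apply: cabs_ge0] : core.

(** * Goursat's theorem on rectangles *)

Section Goursat.
Variable R : realType.
Implicit Types (z w k l : R[i]) (f g : R[i] -> R[i]) (a b c d x y : R) (u v : R -> R[i]).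
Local Notation "x %:C" := (real_complex R x).

Definition ccont u := continuous (fun x => cRe (u x)) /\ continuous (fun x => cIm (u x)).

Definition contC f := forall z (e : R), 0 < e -> exists2 d : R, 0 < d &
  forall h, cabs h < d -> cabs (f (z + h) - f z) < e.

(** Componentwise, so that complex integrals reduce to [RI]; bounds obtained this way lose a factor
    2 ([CI_bound]), which only enters constants. *)
Definition CI a b u : R[i] := (RI a b (fun x => cRe (u x)) +i* RI a b (fun x => cIm (u x)))%C.

Lemma cReD z w : cRe (z + w) = cRe z + cRe w. Proof. by case: z; case: w. Qed.
Lemma cImD z w : cIm (z + w) = cIm z + cIm w. Proof. by case: z; case: w. Qed.
Lemma cReN z : cRe (- z) = - cRe z. Proof. by case: z. Qed.
Lemma cImN z : cIm (- z) = - cIm z. Proof. by case: z. Qed.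
Lemma cReM z w : cRe (z * w) = cRe z * cRe w - cIm z * cIm w. Proof. by case: z; case: w. Qed.
Lemma cImM z w : cIm (z * w) = cRe z * cIm w + cIm z * cRe w. Proof. by case: z; case: w. Qed.

Lemma complex_eqP z w : cRe z = cRe w -> cIm z = cIm w -> z = w.
Proof. by case: z => ? ?; case: w => ? ? /= -> ->. Qed.

Lemma continuous_eps (h : R -> R) : (forall x (e : R), 0 < e -> exists2 d : R, 0 < d &
  forall t, `|t| < d -> `|h (x + t) - h x| < e) -> continuous h.
Proof.
move=> H x; apply/cvgrPdist_lt => e e0; have [d d0 Hd] := H x e e0.
near=> t; rewrite distrC (_ : t = x + (t - x)); last by rewrite addrC subrK.
apply: Hd; rewrite distrC; near: t; apply: cvgr_dist_lt => //.
Unshelve. all: by end_near. Qed.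

Lemma ccontP u : (forall x (e : R), 0 < e -> exists2 d : R, 0 < d &
  forall t, `|t| < d -> cabs (u (x + t) - u x) < e) -> ccont u.
Proof.
move=> H; split; apply: continuous_eps => x e e0; have [d d0 Hd] := H x e e0;
  exists d => // t /Hd; apply: le_lt_trans.
  by rewrite -cReN -cReD; exact: Re_le_cabs.
by rewrite -cImN -cImD; exact: Im_le_cabs.
Qed.

Lemma contC_hor f c : contC f -> ccont (fun x => f (x +i* c)%C).
Proof.
move=> cf; apply: ccontP => x e e0; have [d d0 Hd] := cf (x +i* c)%C e e0.
exists d => // t td; have := Hd t%:C; rewrite cabs_real => /(_ td).
by rewrite (_ : (x +i* c)%C + t%:C = ((x + t) +i* c)%C)//; apply: complex_eqP => /=; rewrite ?addr0.
Qed.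

Lemma contC_ver f c : contC f -> ccont (fun y => f (c +i* y)%C).
Proof.
move=> cf; apply: ccontP => x e e0; have [d d0 Hd] := cf (c +i* x)%C e e0.
exists d => // t td; have := Hd ('i%C * t%:C); rewrite cabs_i => /(_ td).
rewrite (_ : (c +i* x)%C + _ = (c +i* (x + t))%C)//.
by apply: complex_eqP => /=; ring.
Qed.

Lemma CI_D a b u v : ccont u -> ccont v -> CI a b (fun x => u x + v x) = CI a b u + CI a b v.
Proof.
move=> [c1 c2] [c3 c4]; apply: complex_eqP => /=; rewrite -RI_D//; apply: RI_eq => x _.
  by rewrite cReD.
by rewrite cImD.
Qed.

Lemma CI_Z a b k u : ccont u -> CI a b (fun x => k * u x) = k * CI a b u.
Proof.
move=> [c1 c2]; apply: complex_eqP; rewrite ?cReM ?cImM /=.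
  rewrite -!RI_Z// -RI_B//; [|by cont|by cont].
  by apply: RI_eq => x _; rewrite cReM.
rewrite -!RI_Z// -RI_D//; [|by cont|by cont].
by apply: RI_eq => x _; rewrite cImM.
Qed.

Lemma ccont_cst k : ccont (fun=> k).
Proof. by split; exact: continuous_cst. Qed.

Lemma ccontM u v : ccont u -> ccont v -> ccont (fun x => u x * v x).
Proof.
move=> [c1 c2] [c3 c4]; split.
  rewrite (_ : (fun x => _) = (fun x => cRe (u x) * cRe (v x) - cIm (u x) * cIm (v x))); first by cont.
  by apply/funext => x; rewrite cReM.
rewrite (_ : (fun x => _) = (fun x => cRe (u x) * cIm (v x) + cIm (u x) * cRe (v x))); first by cont.
  by apply/funext => x; rewrite cImM.
Qed.

Lemma CI_split a b c u : ccont u -> a <= b -> b <= c -> CI a c u = CI a b u + CI b c u.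
Proof. by move=> [c1 c2] ab bc; apply: complex_eqP => /=; apply: RI_split. Qed.

Lemma RI_abs a b (h : R -> R) (M : R) : a <= b -> continuous h ->
  (forall x, a <= x <= b -> `|h x| <= M) -> `|RI a b h| <= M * (b - a).
Proof.
move=> ab ch H; rewrite ler_norml -mulNr -!(RI_cst _ ab); apply/andP; split; apply: RI_le => //.
- exact: continuous_cst.
- by move=> x /H; rewrite ler_norml => /andP[].
- exact: continuous_cst.
- by move=> x /H; rewrite ler_norml => /andP[].
Qed.

Lemma CI_bound a b u (M : R) : a <= b -> ccont u -> (forall x, a <= x <= b -> cabs (u x) <= M) ->
  cabs (CI a b u) <= 2 * M * (b - a).
Proof.
move=> ab [c1 c2] H; apply: le_trans (cabs_le_ReIm _) _ => /=.
rewrite -mulrA mulr_natl mulr2n; apply: lerD; apply: RI_abs => // x /H.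
  exact/le_trans/Re_le_cabs.
exact/le_trans/Im_le_cabs.
Qed.

Lemma CI_cst a b k : a <= b -> CI a b (fun=> k) = k * (b - a)%:C.
Proof.
by move=> ab; case: k => k1 k2; apply: complex_eqP => /=; rewrite RI_cst//; ring.
Qed.

Lemma RI_id a b : a <= b -> RI a b id = (b ^+ 2 - a ^+ 2) / 2.
Proof.
move=> ab; have D x : is_derive x 1 (fun x => x ^+ 2 / 2) x.
  apply: (isd_eq (isdM (isdX 1 (isd_id x)) (isd_cst 2^-1 x))).
  by rewrite expr1; field.
by rewrite (RI_ftc ab D) => [|x]; [field|exact: cvg_id].
Qed.

Lemma ccont_real : ccont (fun x => x%:C).
Proof. by split; [move=> x; exact: cvg_id|exact: continuous_cst]. Qed.

Lemma CI_real a b : a <= b -> CI a b (fun x => x%:C) = ((b ^+ 2 - a ^+ 2) / 2)%:C.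
Proof.
move=> ab; apply: complex_eqP => /=; first exact: RI_id.
by rewrite RI_cst// mul0r.
Qed.

(** The integral of f dz along the boundary of [a, b] x [c, d], counterclockwise; dz = i dy on the
    vertical sides. *)
Definition rect f a b c d : R[i] :=
  CI a b (fun x => f (x +i* c)%C) + 'i%C * CI c d (fun y => f (b +i* y)%C)
  - CI a b (fun x => f (x +i* d)%C) - 'i%C * CI c d (fun y => f (a +i* y)%C).

Arguments rect : simpl never.

Lemma contC_D f g : contC f -> contC g -> contC (fun w => f w + g w).
Proof.
move=> cf cg z e e0; have e2 : 0 < e / 2 by rewrite divr_gt0.
have [d d0 Hd] := cf z _ e2; have [d' d'0 Hd'] := cg z _ e2.
exists (Num.min d d'); first by rewrite lt_min d0.
move=> h; rewrite lt_min => /andP[/Hd h1 /Hd' h2].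
rewrite (_ : _ - _ = (f (z + h) - f z) + (g (z + h) - g z)); last by ring.
by apply: le_lt_trans (cabsD _ _) _; lra.
Qed.

Lemma cder_contC f : (forall z, exists l, cder f z l) -> contC f.
Proof. by move=> H z; have [l /cder_cont] := H z. Qed.

Lemma rect_D f g a b c d : contC f -> contC g ->
  rect (fun w => f w + g w) a b c d = rect f a b c d + rect g a b c d.
Proof.
move=> cf cg; rewrite /rect !CI_D; first by ring.
all: by [apply: contC_hor|apply: contC_ver].
Qed.

Lemma rect_affine k l a b c d : a <= b -> c <= d -> rect (fun w => k + l * w) a b c d = 0.
Proof.
move=> ab cd; have hor e : CI a b (fun x => k + l * (x +i* e)%C) =
    (k + l * ('i%C * e%:C)) * (b - a)%:C + l * ((b ^+ 2 - a ^+ 2) / 2)%:C.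
  rewrite -CI_cst// -CI_real// -CI_Z; last exact: ccont_real.
  rewrite -CI_D; last 2 first.
  - exact: ccont_cst.
  - by apply: ccontM; [exact: ccont_cst|exact: ccont_real].
  congr CI; apply/funext => x; rewrite (_ : (x +i* e)%C = x%:C + 'i%C * e%:C); last exact: complexE.
  by ring.
have ver e : CI c d (fun y => k + l * (e +i* y)%C) =
    (k + l * e%:C) * (d - c)%:C + l * 'i%C * ((d ^+ 2 - c ^+ 2) / 2)%:C.
  rewrite -CI_cst// -CI_real// -CI_Z; last exact: ccont_real.
  rewrite -CI_D; last 2 first.
  - exact: ccont_cst.
  - by apply: ccontM; [exact: ccont_cst|exact: ccont_real].
  congr CI; apply/funext => y; rewrite (_ : (e +i* y)%C = e%:C + 'i%C * y%:C); last exact: complexE.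
  by ring.
rewrite /rect !hor !ver !rmorphB /=; ring.
Qed.

Lemma rect_bound f a b c d (M : R) : a <= b -> c <= d -> contC f ->
  (forall x y, a <= x <= b -> c <= y <= d -> cabs (f (x +i* y)%C) <= M) ->
  cabs (rect f a b c d) <= 4 * M * ((b - a) + (d - c)).
Proof.
move=> ab cd cf H.
have B1 e : c <= e <= d -> cabs (CI a b (fun x => f (x +i* e)%C)) <= 2 * M * (b - a).
  by move=> ce; apply: CI_bound => //; [exact: contC_hor|move=> x xab; exact: H].
have B2 e : a <= e <= b -> cabs (CI c d (fun y => f (e +i* y)%C)) <= 2 * M * (d - c).
  by move=> ce; apply: CI_bound => //; [exact: contC_ver|move=> x xab; exact: H].
have ci z : cabs ('i%C * z) = cabs z.
  by have := cabs_i (1 : R); rewrite normr1 mulr1 cabsM => ->; rewrite mul1r.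
apply: le_trans (cabsB _ _) _; rewrite ci.
apply: le_trans (lerD (cabsB _ _) (lexx _)) _.
apply: le_trans (lerD (lerD (cabsD _ _) (lexx _)) (lexx _)) _; rewrite ci.
have := B1 c; have := B1 d; have := B2 a; have := B2 b; rewrite !lexx ab cd /=.
move=> /(_ isT) h1 /(_ isT) h2 /(_ isT) h3 /(_ isT) h4; lra.
Qed.

Lemma rect_hsplit f a m b c d : contC f -> a <= m -> m <= b ->
  rect f a b c d = rect f a m c d + rect f m b c d.
Proof.
move=> cf am mb; rewrite /rect (CI_split (contC_hor c cf) am mb).
by rewrite (CI_split (contC_hor d cf) am mb); ring.
Qed.

Lemma rect_vsplit f a b c m d : contC f -> c <= m -> m <= d ->
  rect f a b c d = rect f a b c m + rect f a b m d.
Proof.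
move=> cf am mb; rewrite /rect (CI_split (contC_ver a cf) am mb).
by rewrite (CI_split (contC_ver b cf) am mb); ring.
Qed.

(** The four quarter integrals add up to the whole one, so they cannot all be below E / 4. The
    bounds on [q] are those that [nested_halving] consumes. *)
Lemma rect_quarter f x y (W H E : R) : contC f -> 0 <= W -> 0 <= H ->
  E <= cabs (rect f x (x + W) y (y + H)) ->
  exists q : R * R, E / 4 <= cabs (rect f q.1 (q.1 + W / 2) q.2 (q.2 + H / 2)) /\
    x <= q.1 <= x + W / 2 /\ y <= q.2 <= y + H / 2.
Proof.
move=> cf W0 H0 HE.
have [bx bx'] : x <= x <= x + W / 2 /\ x <= x + W / 2 <= x + W / 2 by clear -W0; split; lra.
have [by_ by'] : y <= y <= y + H / 2 /\ y <= y + H / 2 <= y + H / 2 by clear -H0; split; lra.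
rewrite (@rect_hsplit f x (x + W / 2) (x + W)) in HE; [|by []|lra|lra].
rewrite (@rect_vsplit f _ _ y (y + H / 2) (y + H)) in HE; [|by []|lra|lra].
rewrite (@rect_vsplit f (x + W / 2) _ y (y + H / 2) (y + H)) in HE; [|by []|lra|lra].
apply: contrapT => /forallNP no.
have no' q : x <= q.1 <= x + W / 2 -> y <= q.2 <= y + H / 2 ->
    cabs (rect f q.1 (q.1 + W / 2) q.2 (q.2 + H / 2)) < E / 4.
  by move=> h1 h2; rewrite ltNge; apply/negP => h; apply: (no q).
have := no' (x, y) => /= /(_ bx by_) h1.
have := no' (x + W / 2, y) => /= /(_ bx' by_) h2.
have := no' (x, y + H / 2) => /= /(_ bx by') h3.
have := no' (x + W / 2, y + H / 2) => /= /(_ bx' by') h4.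
have eW : x + W / 2 + W / 2 = x + W by field.
have eH : y + H / 2 + H / 2 = y + H by field.
rewrite eW in h2 h4; rewrite eH in h3 h4.
move: HE h1 h2 h3 h4; clear.
move: (rect f x (x + W / 2) y (y + H / 2)) (rect f x (x + W / 2) (y + H / 2) (y + H)).
move: (rect f (x + W / 2) (x + W) y (y + H / 2)) (rect f (x + W / 2) (x + W) (y + H / 2) (y + H)).
move=> r1 r2 r3 r4 HE h1 h2 h3 h4.
have := cabsD (r3 + r4) (r1 + r2); have := cabsD r3 r4; have := cabsD r1 r2; lra.
Qed.

(** Left ends increase and right ends decrease, so the supremum of the left ends lies in every
    interval. *)
Lemma nested_halving (s : nat -> R) (W : R) : 0 <= W ->
  (forall n, s n <= s n.+1 <= s n + W / 2 ^+ n.+1) ->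
  exists X, forall n, s n <= X <= s n + W / 2 ^+ n.
Proof.
move=> W0 H.
have up n (k : nat) : s n <= s (n + k)%N.
  elim: k => [|k IH]; rewrite ?addn0// addnS.
  by apply: le_trans IH _; have /andP[] := H (n + k)%N.
have p2 n : 0 < (2 : R) ^+ n by rewrite exprn_gt0.
have dn n (k : nat) : s (n + k)%N + W / 2 ^+ (n + k) <= s n + W / 2 ^+ n.
  elim: k => [|k IH]; rewrite ?addn0// addnS; apply: le_trans IH.
  have /andP[_ h] := H (n + k)%N.
  suff -> : W / 2 ^+ (n + k) = W / 2 ^+ (n + k).+1 + W / 2 ^+ (n + k).+1 by lra.
  rewrite exprS; field; by rewrite gt_eqF.
have ub n m : s m <= s n + W / 2 ^+ n.
  have [mn|nm] := leqP m n.
    apply: le_trans (_ : s n <= _); first by rewrite -(subnKC mn); exact: up.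
    by rewrite lerDl divr_ge0// ltW.
  apply: le_trans (dn n (m - n)%N); rewrite subnKC; last exact: ltnW.
  by rewrite lerDl divr_ge0// ltW.
exists (sup (range s)) => n.
have hs : has_sup (range s).
  by split; [exists (s 0%N), 0%N|exists (s 0%N + W / 2 ^+ 0) => _ [m _ <-]].
apply/andP; split.
  by apply: sup_upper_bound => //; exists n.
by apply: ge_sup; [exists (s 0%N), 0%N|move=> _ [m _ <-]].
Qed.

(** Bisection as in Goursat's proof. Continuity is asked everywhere but differentiability only on
    the closed rectangle: this fits difference quotients, which are differentiable off one point. *)
Lemma goursat f a b c d : a <= b -> c <= d -> contC f ->
  (forall x y, a <= x <= b -> c <= y <= d -> exists l, cder f (x +i* y)%C l) ->
  rect f a b c d = 0.
Proof.
move=> ab cd cf df; apply/eqP; rewrite -cabs_eq0; apply/eqP.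
set E := cabs _; set W := b - a; set H := d - c.
have W0 : 0 <= W by rewrite subr_ge0.
have H0 : 0 <= H by rewrite subr_ge0.
pose Good n (p : R * R) :=
  E / 4 ^+ n <= cabs (rect f p.1 (p.1 + W / 2 ^+ n) p.2 (p.2 + H / 2 ^+ n)).
have p2 n : 0 < (2 : R) ^+ n by rewrite exprn_gt0.
have half (V : R) n : V / 2 ^+ n.+1 = V / 2 ^+ n / 2 by rewrite exprS; field; rewrite gt_eqF.
(* The implication makes the choice of a quarter total: for a rectangle that is not good, any value
   will do. *)
have step (np : nat * (R * R)) : exists q : R * R, Good np.1 np.2 ->
    Good np.1.+1 q /\ np.2.1 <= q.1 <= np.2.1 + W / 2 ^+ np.1.+1 /\
    np.2.2 <= q.2 <= np.2.2 + H / 2 ^+ np.1.+1.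
  case: np => n p /=; have [G|] := pselect (Good n p); last by exists p.
  have [|| q [G1 [G2 G3]]] := rect_quarter cf _ _ G.
  - by rewrite divr_ge0// ltW.
  - by rewrite divr_ge0// ltW.
  exists q => _; rewrite /Good !half; split => //.
  suff -> : E / 4 ^+ n.+1 = E / 4 ^+ n / 4 by [].
  by rewrite exprS; field; rewrite gt_eqF// exprn_gt0.
have [nxt Hn] := choice step.
pose s := fix s n := if n is n'.+1 then nxt (n', s n') else (a, c).
have Gs n : Good n (s n).
  elim: n => [|n IH]; last by have [] := Hn (n, s n) IH.
  rewrite /Good /= !expr0 !divr1.
  have -> : a + W = b by rewrite /W; ring.
  have -> : c + H = d by rewrite /H; ring.
  exact: lexx.
have [X HX] : exists X, forall n, (s n).1 <= X <= (s n).1 + W / 2 ^+ n.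
  by apply: nested_halving => // n; have [_ []] := Hn (n, s n) (Gs n).
have [Y HY] : exists Y, forall n, (s n).2 <= Y <= (s n).2 + H / 2 ^+ n.
  by apply: nested_halving => // n; have [_ []] := Hn (n, s n) (Gs n).
have [] := df X Y.
- by have := HX 0%N; rewrite /= expr0 divr1 /W; lra.
- by have := HY 0%N; rewrite /= expr0 divr1 /H; lra.
move=> l dl.
have small e : 0 < e -> E <= 4 * e * (W + H) ^+ 2.
  move=> e0; have [dd dd0 Hd] := dl e e0.
  have [n nd] : exists n, (W + H) / 2 ^+ n < dd.
    exists (Num.bound ((W + H) / dd)); rewrite ltr_pdivrMr// mulrC -ltr_pdivrMr//.
    have /archi_boundP/lt_trans : 0 <= (W + H) / dd.
      exact: divr_ge0 (addr_ge0 W0 H0) (ltW dd0).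
    apply; rewrite -natrX ltr_nat. exact: ltn_expl.
  set p := (X +i* Y)%C in dl Hd.
  pose D := (W + H) / 2 ^+ n.
  have D0 : 0 <= D by exact: divr_ge0 (addr_ge0 W0 H0) (ltW (p2 n)).
  have DE : W / 2 ^+ n + H / 2 ^+ n = D by rewrite -mulrDl.
  (* Subtracting the first-order Taylor polynomial at [p] does not change the integral and leaves an
     integrand of size at most e * D. *)
  pose aff w := (l * p - f p) + (- l) * w.
  have caff : contC aff.
    apply: cder_contC => z; exists (0 + (- l) * 1).
    by apply: cderD; [exact: cder_cst|apply: cderZ; exact: cder_id].
  have := Gs n; rewrite /Good.
  have w0 : 0 <= W / 2 ^+ n by rewrite divr_ge0// ltW.
  have h0 : 0 <= H / 2 ^+ n by rewrite divr_ge0// ltW.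
  have := HX n; have := HY n; move: w0 h0 DE; move: (s n) (W / 2 ^+ n) (H / 2 ^+ n).
  move=> [x y] /= w h w0 h0 DE hy hx.
  have -> : rect f x (x + w) y (y + h) = rect (fun z => f z + aff z) x (x + w) y (y + h).
    by rewrite rect_D// rect_affine ?addr0// lerDl.
  have B t r : x <= t <= x + w -> y <= r <= y + h ->
      cabs (f (t +i* r)%C + aff (t +i* r)%C) <= e * D.
    move=> ht hr; have tD : cabs ((t - X) +i* (r - Y))%C <= D.
      apply: le_trans (cabs_le_ReIm _) _ => /=; rewrite -DE.
      by apply: lerD; rewrite ler_norml; lra.
    have := Hd _ (le_lt_trans tD nd).
    rewrite (_ : p + _ = (t +i* r)%C); last first.
      by rewrite /p; apply: complex_eqP => /=; rewrite addrC subrK.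
    have -> : f (t +i* r)%C - f p - l * ((t - X) +i* (r - Y))%C =
       f (t +i* r)%C + aff (t +i* r)%C.
      rewrite /aff (_ : ((t - X) +i* (r - Y))%C = (t +i* r)%C - p)//; ring.
    by move=> /le_trans; apply; rewrite ler_pM2l.
  have xw : x <= x + w by rewrite lerDl.
  have yh : y <= y + h by rewrite lerDl.
  move=> /le_trans/(_ (rect_bound xw yh (contC_D cf caff) B)).
  rewrite !(addrC x) !(addrC y) !addrK DE.
  rewrite ler_pdivrMr ?exprn_gt0// => /le_trans; apply.
  suff : D * D * 4 ^+ n = (W + H) ^+ 2.
    by move=> <-; rewrite le_eqVlt; apply/orP; left; apply/eqP; ring.
  rewrite /D (_ : (4 : R) = 2 * 2); last by ring.
  by rewrite exprMn; field; rewrite gt_eqF.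
have E0 : 0 <= E by exact: cabs_ge0.
have [WH|WH] := eqVneq (W + H) 0.
  by have := small 1 ltr01; rewrite WH expr0n /= mulr0; lra.
have WHp : 0 < (W + H) ^+ 2.
  by apply: exprn_gt0; rewrite lt_neqAle eq_sym WH; exact: addr_ge0.
have [Ep|] := ltP 0 E; last by lra.
(* This e turns [small] into E <= E / 2. *)
have := small (E / (8 * (W + H) ^+ 2)); rewrite (divr_gt0 Ep (mulr_gt0 _ WHp))// => /(_ isT).
rewrite (_ : 4 * _ * _ = E / 2); first lra.
by field; rewrite WH.
Qed.

End Goursat.
#[global] Arguments rect : simpl never.

(** * The complex exponential *)

Section Cexp.
Variable R : realType.
Implicit Types (z w h : R[i]) (f g : R[i] -> R[i]) (x y s t r : R).
Local Notation "x %:C" := (real_complex R x).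

(** Mean value inequality on [-r, r]. Applied repeatedly it yields the Taylor remainders below, one
    factor r per derivative. *)
Lemma mvt_bound (u v : R -> R) r (M : R) : (forall x, is_derive x 1 u (v x)) -> u 0 = 0 ->
  (forall y, `|y| <= r -> `|v y| <= M) -> forall x, `|x| <= r -> `|u x| <= M * r.
Proof.
move=> uv u0 vM x xr.
have M0 : 0 <= M by have := vM 0; rewrite normr0 (le_trans _ xr)// => /(_ isT); exact: le_trans.
suff H a b : a <= b -> `|a| <= r -> `|b| <= r -> `|u b - u a| <= M * (b - a).
  have [x0|/ltW x0] := leP 0 x.
    have := H 0 x x0; rewrite normr0 u0 !subr0 => /(_ (le_trans (normr_ge0 _) xr) xr) /le_trans.
    by apply; apply: ler_wpM2l => //; rewrite -(ger0_norm x0).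
  have := H x 0 x0 xr; rewrite normr0 u0 !sub0r normrN => /(_ (le_trans (normr_ge0 _) xr)) /le_trans.
  by apply; apply: ler_wpM2l => //; rewrite -(ler0_norm x0).
move=> ab ar br.
have [|c cab ->] := @MVT_segment R u v a b ab (fun x _ => uv x).
  exact: continuous_subspaceT (is_derive_continuous uv).
rewrite normrM (ger0_norm (_ : 0 <= b - a)) ?subr_ge0//.
apply: ler_wpM2r; first by rewrite subr_ge0.
apply: vM; move: cab; rewrite in_itv /= => /andP[ac cb].
move: ar br; rewrite !ler_norml; lra.
Qed.

Lemma expR_taylor2 x : `|x| <= 1 -> `|expR x - 1 - x - x ^+ 2 / 2| <= expR 1 * `|x| ^+ 3.
Proof.
move=> x1.
have de y : is_derive y 1 expR (expR y) by exact: is_derive_expR.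
have B1 y : `|y| <= `|x| -> `|expR y - 1| <= expR 1 * `|x|.
  apply: (@mvt_bound (fun y => expR y - 1) expR); rewrite ?expR0 ?subrr//.
    by move=> z; apply: isd_eq (isdB (de z) (isd_cst 1 z)) _; rewrite subr0.
  move=> z zx; rewrite ger0_norm ?expR_ge0// ler_expR.
  by apply: le_trans (ler_norm _) (le_trans zx x1).
have B2 y : `|y| <= `|x| -> `|expR y - 1 - y| <= expR 1 * `|x| * `|x|.
  apply: (@mvt_bound (fun y => expR y - 1 - y) (fun y => expR y - 1)) => //.
    move=> z; apply: isd_eq (isdB (isdB (de z) (isd_cst 1 z)) (isd_id z)) _; by rewrite subr0.
  by rewrite expR0 subrr subr0.
have -> : expR 1 * `|x| ^+ 3 = expR 1 * `|x| * `|x| * `|x| by ring.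
apply: (@mvt_bound (fun y => expR y - 1 - y - y ^+ 2 / 2) (fun y => expR y - 1 - y)) => //.
  move=> z; apply: isd_eq
   (isdB (isdB (isdB (de z) (isd_cst 1 z)) (isd_id z)) (isdM (isdX 1 (isd_id z)) (isd_cst 2^-1 z))) _.
  by rewrite subr0 expr1; field.
by rewrite expR0; ring.
Qed.

Lemma sin_taylor2 x : `|sin x - x| <= `|x| ^+ 3.
Proof.
have B1 y : `|y| <= `|x| -> `|sin y| <= 1 * `|x|.
  apply: (@mvt_bound sin cos) => //; rewrite ?sin0// => z _; exact: cos_max.
have B2 y : `|y| <= `|x| -> `|cos y - 1| <= 1 * `|x| * `|x|.
  apply: (@mvt_bound (fun y => cos y - 1) (fun y => - sin y)).
  - by move=> z; apply: isd_eq (isdB (is_derive_cos z) (isd_cst 1 z)) _; rewrite subr0.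
  - by rewrite cos0 subrr.
  - by move=> z /B1; rewrite normrN.
have -> : `|x| ^+ 3 = 1 * `|x| * `|x| * `|x| by ring.
apply: (@mvt_bound (fun y => sin y - y) (fun y => cos y - 1)) => //.
by rewrite sin0 subrr.
Qed.

Lemma sin_le_norm x : `|sin x| <= `|x|.
Proof.
rewrite -[leRHS]mul1r; apply: (@mvt_bound sin cos) => //; rewrite ?sin0// => z _; exact: cos_max.
Qed.

Lemma cos_taylor2 x : `|x| <= 1 -> `|cos x - 1 + x ^+ 2 / 2| <= `|x| ^+ 3.
Proof.
move=> x1.
have B2 y : `|y| <= `|x| -> `|y - sin y| <= `|x| ^+ 3.
  move=> yx; rewrite distrC; apply: le_trans (sin_taylor2 y) _.
  by rewrite lerXn2r// nnegrE.
apply: (@le_trans _ _ (`|x| ^+ 3 * `|x|)).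
  apply: (@mvt_bound (fun y => cos y - 1 + y ^+ 2 / 2) (fun y => y - sin y)) => //.
    move=> z; apply: isd_eq
     (isdD (isdB (is_derive_cos z) (isd_cst 1 z)) (isdM (isdX 1 (isd_id z)) (isd_cst 2^-1 z))) _.
    by rewrite subr0 expr1; field.
  by rewrite cos0; ring.
by rewrite -[leRHS]mulr1 ler_wpM2l// exprn_ge0.
Qed.

Definition cexp z : R[i] := (expR (cRe z) * cos (cIm z) +i* (expR (cRe z) * sin (cIm z)))%C.

Arguments cexp : simpl never.

Lemma cexpD z w : cexp (z + w) = cexp z * cexp w.
Proof.
by apply: complex_eqP; rewrite /= cReD cImD expRD ?cosD ?sinD; ring.
Qed.

Lemma cexp0 : cexp 0 = 1.
Proof. by apply: complex_eqP; rewrite /= expR0 ?cos0 ?sin0 ?mulr0 ?mulr1. Qed.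

Lemma cabs_cexp z : cabs (cexp z) = expR (cRe z).
Proof.
rewrite cabsE !exprMn -mulrDr cos2Dsin2 mulr1 sqrtr_sqr ger0_norm//; exact: expR_ge0.
Qed.

Lemma cexp_neq0 z : cexp z != 0.
Proof. by rewrite -cabs_gt0 cabs_cexp expR_gt0. Qed.

Lemma cexpN z : cexp (- z) = (cexp z)^-1.
Proof.
apply: (mulfI (cexp_neq0 z)); rewrite -cexpD subrr cexp0 mulfV//; exact: cexp_neq0.
Qed.

(** A first-order expansion would already give the derivative; the cubic remainder serves
    [csin_taylor], and through it the differentiability of [sinc] at 0. *)
Lemma cexp_taylor2 : exists2 K : R, 0 < K & forall h, cabs h <= 1 ->
  cabs (cexp h - 1 - h - h ^+ 2 / 2) <= K * cabs h ^+ 3.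
Proof.
have E0 := expR_gt0 (1 : R).
exists (2 * (4 + expR 1)); first lra.
move=> h h1; have := Re_le_cabs h; have := Im_le_cabs h.
move: (cabs_ge0 h) h1; move: (cabs h) => r r0 r1.
case: h => s t /= tr sr; apply: le_trans (cabs_le_ReIm _) _.
have s1 := le_trans sr r1; have t1 := le_trans tr r1.
have s3 : `|s| ^+ 3 <= r ^+ 3 by rewrite lerXn2r// nnegrE.
have t3 : `|t| ^+ 3 <= r ^+ 3 by rewrite lerXn2r// nnegrE.
have := expR_taylor2 s1; have := sin_taylor2 t; have := cos_taylor2 t1.
set rho := _ - _ - s - _; set sg := cos t - 1 + _; set tau := sin t - t.
move=> Hs Ht Hr.
have hs := le_trans Hs t3; have ht := le_trans Ht t3.
have hr := le_trans Hr (ler_wpM2l (ltW E0) s3).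
have st2 : `|s * t ^+ 2| <= r ^+ 3.
  by rewrite normrM normrX (exprS r); apply: ler_pM => //; rewrite ?exprn_ge0// lerXn2r// nnegrE.
have s2t : `|s ^+ 2 * t| <= r ^+ 3.
  by rewrite mulrC normrM normrX (exprS r); apply: ler_pM => //; rewrite ?exprn_ge0// lerXn2r// nnegrE.
have s2 : `|1 + s + s ^+ 2 / 2| <= 5/2.
  by move: s1; rewrite !ler_norml => /andP[? ?]; apply/andP; split; nra.
have hE : (s +i* t)%C ^+ 2 / 2 = (((s ^+ 2 - t ^+ 2) / 2) +i* (s * t))%C.
  apply: (mulIf (_ : (2 : R[i]) != 0)); first by rewrite pnatr_eq0.
  rewrite divfK ?pnatr_eq0// (_ : (2 : R[i]) = (2 +i* 0)%C); last first.
    by apply: complex_eqP => /=; rewrite ?addr0.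
  by apply: complex_eqP => /=; field.
rewrite hE /=.
have -> : expR s * cos t + - 1 + - s + - ((s ^+ 2 - t ^+ 2) / 2) =
   rho * cos t + (1 + s + s ^+ 2 / 2) * sg - (s * t ^+ 2) * (1/2 + s / 4).
  by rewrite /rho /sg; field.
have -> : expR s * sin t + - 0 + - t + - (s * t) =
   rho * sin t + (1 + s + s ^+ 2 / 2) * tau + (s ^+ 2 * t) / 2.
  by rewrite /rho /tau; field.
have c1 := cos_max t; have d1 := sin_max t.
have p1 : `|rho * cos t| <= expR 1 * r ^+ 3.
  by rewrite normrM -[leRHS]mulr1; apply: ler_pM.
have p2 : `|rho * sin t| <= expR 1 * r ^+ 3.
  by rewrite normrM -[leRHS]mulr1; apply: ler_pM.
have p3 : `|(1 + s + s ^+ 2 / 2) * sg| <= 5 / 2 * r ^+ 3.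
  by rewrite normrM; apply: ler_pM.
have p4 : `|(1 + s + s ^+ 2 / 2) * tau| <= 5 / 2 * r ^+ 3.
  by rewrite normrM; apply: ler_pM.
have p5 : `|(s * t ^+ 2) * (1/2 + s / 4)| <= r ^+ 3 * 1.
  rewrite normrM; apply: ler_pM => //.
  by move: s1; rewrite !ler_norml; lra.
have p6 : `|(s ^+ 2 * t) / 2| <= r ^+ 3 / 2.
  by rewrite normrM (ger0_norm (_ : 0 <= 2^-1)) ?invr_ge0// ler_wpM2r// invr_ge0.
have r3 : 0 <= r ^+ 3 by rewrite exprn_ge0.
move: p1 p2 p3 p4 p5 p6 r3; clear.
move: (rho * cos t) (rho * sin t) ((1 + s + s ^+ 2 / 2) * sg) ((1 + s + s ^+ 2 / 2) * tau).
move: ((s * t ^+ 2) * (1/2 + s / 4)) ((s ^+ 2 * t) / 2) (r ^+ 3) => x1 x2 q x3 x4 x5 x6.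
move=> p1 p2 p3 p4 p5 p6 q0.
have := ler_normB (x3 + x5) x1; have := ler_normD x3 x5.
have := ler_normD (x4 + x6) x2; have := ler_normD x4 x6.
have -> : 2 * (4 + expR 1) * q = 8 * q + 2 * (expR 1 * q) by ring.
move: p1 p2; move: (expR 1 * q) => eq p1 p2; lra.
Qed.

Lemma cder_cexp z : cder cexp z (cexp z).
Proof.
have [K K0 HK] := cexp_taylor2.
suff : little (fun h => cexp h - 1 - h).
  move=> /(littleZ (cexp z)); apply: little_ext => h; rewrite cexpD; ring.
move=> e e0; have K1 : 0 < K + 1 by lra.
exists (Num.min 1 (e / (K + 1))); first by rewrite lt_min ltr01 divr_gt0.
move=> h; rewrite lt_min ltr_pdivlMr// => /andP[/ltW h1 h2].
have -> : cexp h - 1 - h = (cexp h - 1 - h - h ^+ 2 / 2) + h ^+ 2 / 2 by ring.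
apply: le_trans (cabsD _ _) _; apply: le_trans (lerD (HK h h1) (lexx _)) _.
rewrite cabsM cabsX cabsV.
have -> : cabs (2 : R[i]) = 2.
  rewrite (_ : (2 : R[i]) = (2 : R)%:C) ?cabs_real ?ger0_norm//.
  by apply: complex_eqP => /=; rewrite ?addr0.
move: (cabs h) (cabs_ge0 h) h1 h2 => r r0 r1 hr.
apply: (@le_trans _ _ ((K + 1) * r * r)); last first.
  by apply: ler_wpM2r => //; rewrite mulrC; exact: ltW.
have : 0 <= r * r * (1 - r) * K.
  by rewrite !mulr_ge0// ?subr_ge0// ltW.
rewrite !exprS expr0 !mulr1; nra.
Qed.

End Cexp.
#[global] Arguments cexp {R} z : simpl never.

(** * Taylor coefficients of entire functions of exponential type *)

Section Taylor.
Variable R : realType.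
Implicit Types (z w h k l : R[i]) (f g : R[i] -> R[i]) (a b c d x y s t r p q : R).
Local Notation "x %:C" := (real_complex R x).

Lemma contC_bounded g z : contC g -> exists M d : R, [/\ 0 < M, 0 < d &
  forall h, cabs h < d -> cabs (g (z + h)) <= M].
Proof.
move=> cg; have [d d0 Hd] := cg z 1 ltr01.
exists (cabs (g z) + 1), d; split=> //; first by have := cabs_ge0 (g z); lra.
move=> h /Hd hh; rewrite -(subrK (g z) (g (z + h))).
by apply: le_trans (cabsD _ _) _; lra.
Qed.

(** Cut out a square of side 2n around the exceptional point: the four surrounding rectangles fall
    under [goursat], and the square contributes O(n) because g is bounded near the point. *)
Lemma goursat_point g a b c d p q : a < p < b -> c < q < d -> contC g ->
  (forall x y, a <= x <= b -> c <= y <= d -> (x, y) <> (p, q) -> exists l, cder g (x +i* y)%C l) ->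
  rect g a b c d = 0.
Proof.
move=> /andP[ap pb] /andP[cq qd] cg dg; apply/eqP; rewrite -cabs_eq0; apply/eqP.
have [M [d0 [M0 d00 HM]]] := contC_bounded (p +i* q)%C cg.
suff small e : 0 < e -> cabs (rect g a b c d) <= 16 * M * e.
  have := cabs_ge0 (rect g a b c d); rewrite le_eqVlt => /predU1P[//|E0].
  have := small (cabs (rect g a b c d) / (32 * M)) (divr_gt0 E0 (mulr_gt0 _ M0)).
  rewrite (_ : 16 * M * _ = cabs (rect g a b c d) / 2); last by field; rewrite gt_eqF.
  by move=> /(_ ltac:(by [])); lra.
move=> e0; pose m := Num.min (Num.min (p - a) (b - p)) (Num.min (q - c) (d - q)).
pose n := Num.min e (Num.min m (d0 / 4)).
have [ne [npa [nbp [nqc [ndq nd0]]]]] : n <= e /\ n <= p - a /\ n <= b - p /\ n <= q - c /\ n <= d - q /\ n <= d0 / 4.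
  by rewrite /n /m; do !split; rewrite !ge_min lexx ?orbT.
have n0 : 0 < n.
  by rewrite /n /m !lt_min !subr_gt0 ap pb cq qd e0 divr_gt0.
have apn : a <= p - n by lra.
have pnb : p + n <= b by lra.
have cqn : c <= q - n by lra.
have qnd : q + n <= d by lra.
have pn : p - n <= p + n by lra.
have qn : q - n <= q + n by lra.
rewrite (rect_hsplit c d cg apn (le_trans pn pnb)) (rect_hsplit c d cg pn pnb).
rewrite (rect_vsplit (p - n) (p + n) cg cqn (le_trans qn qnd)) (rect_vsplit (p - n) (p + n) cg qn qnd).
have cd := le_trans cqn (le_trans qn qnd).
have ne1 x y x' y' : x' <> p \/ y' <> q -> (x', y') <> (p, q) by move=> + [] => -[].
rewrite (goursat apn cd cg); last first.
  move=> x y xx yy; apply: dg => //; first lra.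
  by apply: (ne1 x y); left; lra.
rewrite (goursat pnb cd cg); last first.
  move=> x y xx yy; apply: dg => //; first lra.
  by apply: (ne1 x y); left; lra.
rewrite (goursat pn cqn cg); last first.
  move=> x y xx yy; apply: dg; [lra|lra|].
  by apply: (ne1 x y); right; lra.
rewrite (goursat pn qnd cg); last first.
  move=> x y xx yy; apply: dg; [lra|lra|].
  by apply: (ne1 x y); right; lra.
rewrite add0r addr0 add0r addr0.
apply: le_trans (rect_bound pn qn cg _) _.
  move=> x y xx yy; rewrite (_ : (x +i* y)%C = (p +i* q)%C + ((x - p) +i* (y - q))%C); last first.
    by apply: complex_eqP => /=; ring.
  apply: HM; apply: le_lt_trans (cabs_le_ReIm _) _ => /=.
  apply: (@le_lt_trans _ _ (n + n)); last lra.
  by apply: lerD; rewrite ler_norml; lra.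
have : M * n <= M * e by rewrite ler_pM2l.
move: (M * e) => Me; nra.
Qed.

(** An arc of length 2 pi in which 0 and pi, the arguments of positive and negative reals, are both
    interior: [goursat_point] needs its exceptional point strictly inside the rectangle. *)
Definition arc_lo : R := - (pi / 2).
Definition arc_hi : R := 3 * (pi / 2).

Lemma ab0 : arc_lo <= arc_hi.
Proof. by rewrite /arc_lo /arc_hi; have := @pi_ge2 R; lra. Qed.

(** Circle integrals in logarithmic coordinates z = exp(s + i t): the circle of radius exp(s)
    becomes a vertical segment and dz / z becomes i dt, so rectangles suffice as contours. *)
Definition V g s := CI arc_lo arc_hi (fun t => g (s +i* t)%C).

Definition per g := forall s t, g (s +i* (t + pi *+ 2))%C = g (s +i* t)%C.

(** By periodicity the two horizontal sides cancel, so the rectangle integral is i times the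
    difference of the two vertical ones. *)
Lemma V_const g s1 s2 : per g -> rect g s1 s2 arc_lo arc_hi = 0 -> V g s1 = V g s2.
Proof.
move=> pg; rewrite /rect.
rewrite (_ : (fun x => g (x +i* arc_hi)%C) = (fun x => g (x +i* arc_lo)%C)); last first.
  apply/funext => x; rewrite -(pg x arc_lo); congr (g (_ +i* _)%C).
  by rewrite /arc_lo /arc_hi mulr2n; field.
rewrite -/(V g s1) -/(V g s2) => H.
have i0 : ('i%C : R[i]) != 0 by rewrite -cabs_gt0 -[X in cabs X]mulr1 (cabs_i (1 : R)) normr1.
apply: (mulfI i0); apply/eqP; rewrite eq_sym -subr_eq0; apply/eqP; rewrite -H; ring.
Qed.

Lemma V_const_cder g : per g -> (forall z, exists l, cder g z l) -> forall s1 s2, V g s1 = V g s2.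
Proof.
move=> pg dg; suff H s1 s2 : s1 <= s2 -> V g s1 = V g s2.
  by move=> s1 s2; have [/H//|/ltW/H] := leP s1 s2.
move=> s12; apply: V_const => //; apply: goursat => //; first exact: ab0.
exact: cder_contC.
Qed.

Lemma ccont_ver_cder g s : (forall t, exists l, cder g (s +i* t)%C l) -> ccont (fun t => g (s +i* t)%C).
Proof.
move=> dg; apply: ccontP => x e e0; have [l dl] := dg x.
have [d d00 Hd] := cder_cont dl e0.
exists d => // t td; have := Hd ('i%C * t%:C); rewrite cabs_i => /(_ td).
rewrite (_ : (s +i* x)%C + _ = (s +i* (x + t))%C)//.
by apply: complex_eqP => /=; ring.
Qed.

Lemma V_bound g s (M : R) : ccont (fun t => g (s +i* t)%C) -> (forall t, cabs (g (s +i* t)%C) <= M) ->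
  cabs (V g s) <= 4 * pi * M.
Proof.
move=> cg HM; apply: le_trans (CI_bound ab0 cg (fun t _ => HM t)) _.
by rewrite /arc_lo /arc_hi (_ : _ * _ = 4 * pi * M)//; field.
Qed.

Lemma per_cexp : per cexp.
Proof.
move=> s t; rewrite /cexp /= cosD2pi sinD2pi//.
Qed.

(** With z = exp(w) this is f(z) / z^n, the Cauchy integrand of the n-th Taylor coefficient. *)
Definition G f n w := f (cexp w) * cexp (- w) ^+ n.

Lemma per_G f n : per (G f n).
Proof. by move=> s t; rewrite /G !cexpN !per_cexp. Qed.

Lemma cderX g z l n : cder g z l -> exists m, cder (fun w => g w ^+ n) z m.
Proof.
move=> gl; elim: n => [|n [m IH]].
  exists 0; apply: little_ext (@cder_cst _ 1 z) => h; by rewrite !expr0.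
exists (l * g z ^+ n + g z * m); apply: little_ext (cderM gl IH) => h; by rewrite !exprS.
Qed.

Lemma cder_cexpN z : cder (fun w => cexp (- w)) z (- cexp (- z)).
Proof.
have H : cder (fun w => - w) z (-1).
  by apply: little_ext (@little0 R) => h; ring.
by have := cder_comp H (cder_cexp (- z)); rewrite mulrN1.
Qed.

Lemma cder_G f n : (forall z, exists l, cder f z l) -> forall z, exists l, cder (G f n) z l.
Proof.
move=> df z; have [l dl] := df (cexp z).
have [m dm] := cderX n (cder_cexpN z).
by exists (l * cexp z * cexp (- z) ^+ n + f (cexp z) * m); exact: (cderM (cder_comp (cder_cexp z) dl) dm).
Qed.

(** Cauchy's formula on the unit circle; for entire f every radius gives the same value, by
    [V_const_cder]. *)
Definition tcoef f n : R[i] := V (G f n) 0 / (pi *+ 2)%:C.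

Lemma pi2_neq0 : ((pi *+ 2 : R)%:C) != 0.
Proof. by rewrite -cabs_gt0 cabs_real normr_gt0 mulrn_eq0 /= gt_eqF// pi_gt0. Qed.

Lemma tcoefE f n : V (G f n) 0 = (pi *+ 2)%:C * tcoef f n.
Proof. by rewrite mulrC divfK// pi2_neq0. Qed.

Lemma cabs_tcoef f n r (M : R) : (forall z, exists l, cder f z l) -> 0 < r ->
  (forall z, cabs z = r -> cabs (f z) <= M) -> cabs (tcoef f n) <= 2 * M / r ^+ n.
Proof.
move=> df r0 HM; rewrite /tcoef (V_const_cder (per_G f n) (cder_G n df) 0 (ln r)).
rewrite cabsM cabsV cabs_real ger0_norm; last by rewrite mulrn_wge0// pi_ge0.
have p2 : 0 < pi *+ 2 :> R by rewrite mulr2n addr_gt0 ?pi_gt0.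
rewrite ler_pdivrMr//.
apply: le_trans (_ : 4 * pi * (M / r ^+ n) <= _); last first.
  by rewrite mulr2n le_eqVlt; apply/orP; left; apply/eqP; ring.
apply: V_bound; first by apply: ccont_ver_cder => t; exact: cder_G.
move=> t; rewrite /G cabsM cabsX cabs_cexp /= expRN lnK ?posrE//.
by rewrite exprVn ler_wpM2r ?invr_ge0 ?exprn_ge0 ?(ltW r0)// HM// cabs_cexp /= lnK ?posrE.
Qed.

Lemma tcoef1 n : tcoef (fun=> 1) n = (n == 0%N)%:R.
Proof.
have d1 z : exists l, cder (fun=> 1 : R[i]) z l by exists 0; exact: cder_cst.
case: n => [|n] /=.
  rewrite /tcoef /V /G; under eq_fun do rewrite expr0 mulr1.
  rewrite CI_cst ?ab0// mul1r (_ : arc_hi - arc_lo = pi *+ 2) ?mulfV ?pi2_neq0//.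
  by rewrite /arc_lo /arc_hi mulr2n; field.
apply/eqP; rewrite -cabs_eq0; apply/eqP; set e := cabs _.
have : 0 <= e by exact: cabs_ge0.
rewrite le_eqVlt => /predU1P[//|e0].
(* Chosen so that e * r = e + 4, against e * r <= 2. *)
pose r := 1 + 4 / e.
have r1 : 1 <= r by rewrite lerDl divr_ge0// ltW.
have r0 : 0 < r by lra.
have := @cabs_tcoef (fun=> 1) n.+1 r 1 d1 r0 (fun z _ => eq_ind_r (fun x => x <= 1) (lexx 1) (cabs1 R)).
rewrite -/e ler_pdivlMr ?exprn_gt0// mulr1 => H.
have : r <= r ^+ n.+1 by rewrite exprS ler_peMr ?(ltW r0)// exprn_ege1.
rewrite -(ler_pM2l e0) => H'; have := le_trans H' H.
by rewrite /r mulrDr mulr1 mulrC divfK ?gt_eqF//; lra.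
Qed.

(** Locates the pole of the Cauchy kernel in the logarithmic strip: the argument is 0 or pi
    according to the sign of x, and the sign of cos t tells the two halves of the arc apart. *)
Lemma cexp_real_pole x : x != 0 -> exists p q, arc_lo < q < arc_hi /\
  forall s t, arc_lo <= t <= arc_hi -> cexp (s +i* t)%C = x%:C -> s = p /\ t = q.
Proof.
move=> x0; have pi2 := @pi_ge2 R.
have inj t : - (pi / 2) <= t <= pi / 2 -> sin t = 0 -> t = 0.
  move=> ht st; apply: sin_inj; rewrite ?in_itv /= ?sin0//; lra.
have base s t : cexp (s +i* t)%C = x%:C -> [/\ expR s = `|x|, expR s * cos t = x & sin t = 0].
  move=> H; split.
  - by have := cabs_cexp (s +i* t)%C; rewrite H cabs_real.
  - by have := congr1 (@complex.Re _) H.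
  - have := congr1 (@complex.Im _) H => /= /eqP; rewrite mulf_eq0 expR_eq0 /= => /eqP//.
have cp s t : cexp (s +i* t)%C = x%:C -> s = ln `|x|.
  by case/base => <- _ _; rewrite expRK.
case: (ltgtP 0 x) x0 => // xs _.
  exists (ln `|x|), 0; split; first by rewrite /arc_lo /arc_hi; lra.
  move=> s t ht H; split; first exact: cp H.
  have [_ H1 H2] := base _ _ H.
  have ct : 0 < cos t by rewrite -(pmulr_rgt0 _ (expR_gt0 s)) H1.
  have [tp|pt] := leP t (pi / 2); first by apply: inj => //; rewrite /arc_lo in ht; lra.
  have : 0 <= cos (t - pi) by apply: cos_ge0_pihalf; rewrite /arc_hi in ht; lra.
  by rewrite -(subrK pi t) cosDpi in ct; lra.
exists (ln `|x|), pi; split; first by rewrite /arc_lo /arc_hi; lra.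
move=> s t ht H; split; first exact: cp H.
have [_ H1 H2] := base _ _ H.
have ct : cos t < 0 by rewrite -(pmulr_rlt0 _ (expR_gt0 s)) H1.
have [tp|pt] := leP t (pi / 2).
  by have : 0 <= cos t; [apply: cos_ge0_pihalf; rewrite /arc_lo in ht; lra|lra].
apply/eqP; rewrite -subr_eq0; apply/eqP; apply: inj; first by rewrite /arc_hi in ht; lra.
by move: H2; rewrite -{1}(subrK pi t) sinDpi => /eqP; rewrite oppr_eq0 => /eqP.
Qed.

(** With z = exp(w) this is f(z) (x/z)^n z/(z - x), the Cauchy kernel after n terms of the geometric
    series in x/z have been removed. *)
Definition Jf f x n w :=
  f (cexp w) * (x%:C * cexp (- w)) ^+ n * (cexp w / (cexp w - x%:C)).

Lemma cexp_sub_ge x s t : expR s - `|x| <= cabs (cexp (s +i* t)%C - x%:C).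
Proof. by rewrite -(cabs_real x) -(cabs_cexp (s +i* t)%C) -(cabsN x%:C); exact: cabs_rev. Qed.

Lemma cexp_sub_neq0 x s t : `|x| < expR s -> cexp (s +i* t)%C - x%:C != 0.
Proof.
by move=> xs; rewrite -cabs_gt0; apply: lt_le_trans (cexp_sub_ge x s t); rewrite subr_gt0.
Qed.

Lemma cder_Jf f x n s t : (forall z, exists l, cder f z l) -> `|x| < expR s ->
  exists l, cder (Jf f x n) (s +i* t)%C l.
Proof.
move=> df xs; set w := (s +i* t)%C; have [l dl] := df (cexp w).
have [m dm] := cderX n (cderZ x%:C (cder_cexpN w)).
have d1 : cder (fun w => cexp w - x%:C) w (cexp w + 0) by exact: (cderD (cder_cexp w) (@cder_cst _ (- x%:C) w)).
have d2 := cderM (cder_cexp w) (cderV (f := fun w => cexp w - x%:C) (cexp_sub_neq0 t xs) d1).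
by eexists; exact: (cderM (cderM (cder_comp (cder_cexp w) dl) dm) d2).
Qed.

(** One step of the geometric series: z/(z - x) = 1 + (x/z) z/(z - x). *)
Lemma V_Jf_step f x n s : (forall z, exists l, cder f z l) -> `|x| < expR s ->
  V (Jf f x n) s = x%:C ^+ n * V (G f n) 0 + V (Jf f x n.+1) s.
Proof.
move=> df xs; rewrite (V_const_cder (per_G f n) (cder_G n df) 0 s) /V.
have cG : ccont (fun t => G f n (s +i* t)%C) by apply: ccont_ver_cder => t; exact: cder_G.
rewrite -CI_Z// -CI_D; last 2 first.
- by apply: ccontM => //; exact: ccont_cst.
- by apply: ccont_ver_cder => t; exact: cder_Jf.
congr CI; apply/funext => t; set w := (s +i* t)%C.
have w0 := cexp_sub_neq0 t xs; have e0 := cexp_neq0 w.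
rewrite /Jf /G cexpN exprMn exprS !exprMn; field; by rewrite e0 w0.
Qed.

Lemma V_Jf_sum f x s N : (forall z, exists l, cder f z l) -> `|x| < expR s ->
  V (Jf f x 0) s = (pi *+ 2)%:C * (\sum_(n < N) tcoef f n * x%:C ^+ n) + V (Jf f x N) s.
Proof.
move=> df xs; elim: N => [|N IH]; first by rewrite big_ord0 mulr0 add0r.
by rewrite IH big_ord_recr V_Jf_step// tcoefE /=; ring.
Qed.

(** On |z| = exp(s) >= 2|x| one has |x/z| <= 1/2 and |z/(z - x)| <= 2. *)
Lemma V_Jf_bound f x s N (M : R) : (forall z, exists l, cder f z l) -> 2 * `|x| <= expR s ->
  0 <= M -> (forall z, cabs z = expR s -> cabs (f z) <= M) ->
  cabs (V (Jf f x N) s) <= 4 * pi * (2 * M / 2 ^+ N).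
Proof.
move=> df xs M0 HM; have e0 := expR_gt0 s.
have x0 : 0 <= `|x| by [].
have xs' : `|x| < expR s by lra.
apply: V_bound; first by apply: ccont_ver_cder => t; exact: cder_Jf.
move=> t; set w := (s +i* t)%C; rewrite /Jf !cabsM cabsX cabsM cabsV !cabs_cexp /= cabs_real expRN.
have h1 : cabs (f (cexp w)) <= M by apply: HM; rewrite cabs_cexp.
have q0 : 0 <= `|x| / expR s by rewrite divr_ge0// ltW.
have q1 : `|x| / expR s <= 2^-1 by rewrite ler_pdivrMr//; lra.
have h2 : (`|x| / expR s) ^+ N <= 2^-1 ^+ N.
  by apply: lerXn2r => //; rewrite nnegrE// invr_ge0.
have h3 : expR s / cabs (cexp w - x%:C) <= 2.
  have := cexp_sub_ge x s t; rewrite -/w => h.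
  have p : 0 < cabs (cexp w - x%:C) by apply: lt_le_trans h; lra.
  by rewrite ler_pdivrMr//; lra.
have -> : 2 * M / 2 ^+ N = M * 2^-1 ^+ N * 2 by rewrite exprVn; ring.
have p1 : 0 <= cabs (f (cexp w)) * (`|x| / expR s) ^+ N by exact: mulr_ge0 (cabs_ge0 _) (exprn_ge0 _ q0).
have p2 : 0 <= expR s / cabs (cexp w - x%:C) by exact: divr_ge0 (ltW e0) (cabs_ge0 _).
exact: (ler_pM p1 p2 (ler_pM (cabs_ge0 _) (exprn_ge0 _ q0) h1 h2) h3).
Qed.

Lemma le0_geometric (a K : R) : (forall N, a <= K / 2 ^+ N) -> a <= 0.
Proof.
move=> H; rewrite leNgt; apply/negP => a0.
have /archi_boundP : 0 <= `|K| / a by rewrite divr_ge0// ltW.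
set N := Num.bound _ => HN.
have := H N; rewrite ler_pdivlMr ?exprn_gt0// => H1.
have : (N%:R : R) <= 2 ^+ N by rewrite -natrX ler_nat ltnW// ltn_expl.
rewrite ltr_pdivrMr// in HN; have := ler_norm K; nra.
Qed.

(** The residue of the kernel itself: for f = 1 all coefficients but the first vanish and the
    remainders tend to 0, so the series settles it without a new contour. *)
Lemma V_Jf1 x s : 2 * `|x| <= expR s -> V (Jf (fun=> 1) x 0) s = (pi *+ 2)%:C.
Proof.
move=> xs; have d1 z : exists l, cder (fun=> 1 : R[i]) z l by exists 0; exact: cder_cst.
have x0 : 0 <= `|x| by []. have e0 := expR_gt0 s.
have xs' : `|x| < expR s by lra.
apply/eqP; rewrite -subr_eq0 -cabs_eq0 eq_le cabs_ge0 andbT.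
apply: (@le0_geometric _ (4 * pi * 2)) => N.
(* For N = 0 the partial sum is empty, so that case is settled with the remainder after one term. *)
have [N0|N0] := posnP N.
  rewrite N0 expr0 divr1.
  have E : V (Jf (fun=> 1) x 0) s - (pi *+ 2)%:C = V (Jf (fun=> 1) x 1) s.
    by rewrite (V_Jf_sum 1 d1 xs') big_ord_recl big_ord0 tcoef1 expr0 /= mulr1 addr0 mulr1 addrC addKr.
  rewrite E; apply: le_trans (V_Jf_bound 1 d1 xs ler01 _) _.
    by move=> z _; rewrite cabs1.
  rewrite expr1 mulr1 divff ?pnatr_eq0// mulr1.
  by have := pi_ge0 R; lra.
have E : V (Jf (fun=> 1) x 0) s - (pi *+ 2)%:C = V (Jf (fun=> 1) x N) s.
  rewrite (V_Jf_sum N d1 xs'); case: N N0 => // N _.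
  rewrite big_ord_recl tcoef1 expr0 /= mulr1 big1 ?addr0 ?mulr1 1?addrC ?addKr//.
  by move=> i _; rewrite tcoef1 /= mul0r.
rewrite E; apply: le_trans (V_Jf_bound N d1 xs ler01 _) _.
  by move=> z _; rewrite cabs1.
by rewrite mulr1 mulrA.
Qed.

(** The difference quotient at x, with l meant to be the derivative there: then it is continuous
    everywhere and, for entire f, differentiable off x. *)
Definition dquot f x l z := if z == x%:C then l else (f z - f x%:C) / (z - x%:C).

Arguments dquot : simpl never.

Lemma cder_dquot f x l z : (forall z, exists l, cder f z l) -> z != x%:C ->
  exists m, cder (dquot f x l) z m.
Proof.
move=> df zx; have [m dm] := df z.
have zx0 : z - x%:C != 0 by rewrite subr_eq0.
have d1 := cderV (f := fun z => z - x%:C) zx0 (cderD (cder_id z) (@cder_cst _ (- x%:C) z)).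
have d2 := cderM (cderD dm (@cder_cst _ (- f x%:C) z)) d1.
eexists; apply: cder_near d2.
exists (cabs (z - x%:C)); first by rewrite cabs_gt0.
move=> h hz; rewrite /dquot ifN//; apply: contraTN hz => /eqP hx.
by rewrite -leNgt -hx opprD addrA subrr sub0r cabsN.
Qed.

Lemma contC_dquot f x l : (forall z, exists l, cder f z l) -> cder f x%:C l -> contC (dquot f x l).
Proof.
move=> df dl z e e0; have [->|zx] := eqVneq z x%:C; last first.
  by have [m /cder_cont H] := cder_dquot l df zx; exact: H.
have e2 : 0 < e / 2 by rewrite divr_gt0.
have [d d0 Hd] := dl _ e2; exists d => // h hd.
rewrite /dquot eqxx; case: eqVneq => [_|hx]; first by rewrite subrr cabs0.
have h0 : h != 0 by apply: contraNneq hx => ->; rewrite addr0.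
have hp : 0 < cabs h by rewrite cabs_gt0.
have -> : (f (x%:C + h) - f x%:C) / (x%:C + h - x%:C) - l =
   (f (x%:C + h) - f x%:C - l * h) / h.
  have -> : x%:C + h - x%:C = h by ring.
  by field.
rewrite cabsM cabsV ltr_pdivrMr//; apply: le_lt_trans (Hd h hd) _.
by rewrite ltr_pM2r//; lra.
Qed.

Lemma contC_M f g : contC f -> contC g -> contC (fun w => f w * g w).
Proof.
move=> cf cg z e e0.
have [M [dM [M0 dM0 HM]]] := contC_bounded z cf.
have K0 : 0 < cabs (g z) + 1 by have := cabs_ge0 (g z); lra.
have two : 0 < 2 :> R by [].
have [d1 d10 H1] := cf z (e / (2 * (cabs (g z) + 1))) (divr_gt0 e0 (mulr_gt0 two K0)).
have [d2 d20 H2] := cg z (e / (2 * M)) (divr_gt0 e0 (mulr_gt0 two M0)).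
exists (Num.min dM (Num.min d1 d2)); first by rewrite !lt_min dM0 d10.
move=> h; rewrite !lt_min => /and3P[/HM hM /H1 h1 /H2 h2].
have -> : f (z + h) * g (z + h) - f z * g z =
  f (z + h) * (g (z + h) - g z) + (f (z + h) - f z) * g z by ring.
apply: le_lt_trans (cabsD _ _) _; rewrite !cabsM.
have a1 : cabs (f (z + h)) * cabs (g (z + h) - g z) <= M * (e / (2 * M)).
  exact: (ler_pM (cabs_ge0 _) (cabs_ge0 _) hM (ltW h2)).
have a2 : cabs (f (z + h) - f z) * (cabs (g z) + 1) < e / (2 * (cabs (g z) + 1)) * (cabs (g z) + 1).
  by rewrite ltr_pM2r.
have := cabs_ge0 (f (z + h) - f z).
have e1 : M * (e / (2 * M)) = e / 2 by field; rewrite gt_eqF.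
have e3 : e / (2 * (cabs (g z) + 1)) * (cabs (g z) + 1) = e / 2 by field; rewrite gt_eqF.
rewrite e1 in a1; rewrite e3 mulrDr mulr1 in a2; lra.
Qed.

Lemma contC_comp f g : contC f -> contC g -> contC (fun w => g (f w)).
Proof.
move=> cf cg z e e0; have [d d0 Hd] := cg (f z) e e0.
have [d' d'0 Hd'] := cf z d d0; exists d' => // h /Hd' /Hd.
by rewrite (addrC (f z)) subrK.
Qed.

(** The radius is shrunk to 0: moving s down crosses only the removable point x, and the factor
    exp(w) makes the integral small. For x = 0 the point is never met in logarithmic coordinates. *)
Lemma V_dquot f x l s : (forall z, exists l, cder f z l) -> cder f x%:C l -> `|x| < expR s ->
  V (fun w => cexp w * dquot f x l (cexp w)) s = 0.
Proof.
move=> df dl xs; set Q := fun w => _.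
have ccexp : contC (@cexp R) by apply: cder_contC => z; exists (cexp z); exact: cder_cexp.
have cQ : contC Q by apply: contC_M => //; apply: contC_comp => //; exact: contC_dquot.
have dQ z : cexp z != x%:C -> exists m, cder Q z m.
  move=> zx; have [m dm] := cder_dquot l df zx.
  by eexists; exact: (cderM (cder_cexp z) (cder_comp (cder_cexp z) dm)).
have pQ : per Q by move=> a t; rewrite /Q !per_cexp.
have QV s1 : s1 <= s -> (x = 0 \/ expR s1 < `|x|) -> V Q s1 = V Q s.
  move=> s1s hx; apply: V_const => //.
  have [x0|x0] := eqVneq x 0.
    apply: goursat => //; first exact: ab0.
    by move=> a b _ _; apply: dQ; rewrite x0; exact: cexp_neq0.
  have [p [q [hq Hpq]]] := cexp_real_pole x0.
  have s1x : expR s1 < `|x| by case: hx => // x0'; rewrite x0' eqxx in x0.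
  have [|no] := pselect (exists s' t, s1 <= s' <= s /\ arc_lo <= t <= arc_hi /\ cexp (s' +i* t)%C = x%:C).
    move=> [s' [t [hs' [ht H]]]]; have [sp tq] := Hpq _ _ ht H.
    have xp : expR p = `|x| by rewrite -sp -(cabs_cexp (s' +i* t)%C) H cabs_real.
    apply: (goursat_point (p := p) (q := q)) => //.
      by rewrite -(ltr_expR s1) -(ltr_expR p) xp s1x xs.
    move=> a b _ hb hne; apply: dQ; apply/eqP => /(Hpq _ _ hb)[ap bq].
    by apply: hne; rewrite ap bq.
  apply: goursat => //; first exact: ab0.
  by move=> a b ha hb; apply: dQ; apply/eqP => H; apply: no; exists a, b.
have [M [d [M0 d0 HM]]] := contC_bounded 0 (contC_dquot df dl).
apply/eqP; rewrite -cabs_eq0 eq_le cabs_ge0 andbT.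
suff small e : 0 < e -> e <= 1 -> cabs (V Q s) <= 4 * pi * M * e.
  rewrite leNgt; apply/negP => V0.
  have P : 0 < 4 * pi * M by rewrite !mulr_gt0// pi_gt0.
  pose e := Num.min 1 (cabs (V Q s) / (4 * pi * M) / 2).
  have e0 : 0 < e by rewrite lt_min ltr01 !divr_gt0.
  have := small e e0; rewrite ge_min lexx => /(_ isT).
  have : e <= cabs (V Q s) / (4 * pi * M) / 2 by rewrite ge_min lexx orbT.
  rewrite -(ler_pM2l P) => h1 h2; have := le_trans h2 h1.
  rewrite (_ : _ * (_ / _ / _) = cabs (V Q s) / 2); first lra.
  have M1 : M != 0 by rewrite gt_eqF.
  have p1 : pi != 0 :> R by rewrite gt_eqF// pi_gt0.
  by move: (pi : R) p1 => pp p1; field; rewrite M1 p1.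
move=> e0 e1.
(* The new radius m meets the target accuracy, stays where [dquot] is bounded near 0, and for
   nonzero x puts |x| strictly between the two radii. *)
pose m := Num.min (Num.min e (d / 2)) (Num.min (expR s) (if x == 0 then 1 else `|x| / 2)).
have m0 : 0 < m.
  rewrite !lt_min e0 divr_gt0// expR_gt0 /=; case: eqVneq => // x0.
  by rewrite divr_gt0// normr_gt0.
have [me md ms] : [/\ m <= e, m <= d / 2 & m <= expR s].
  by rewrite /m; split; rewrite !ge_min lexx ?orbT.
rewrite -(QV (ln m)); last 2 first.
- by rewrite -ler_expR lnK.
- rewrite lnK//; have [->|x0] := eqVneq x 0; [by left|right].
  have : m <= `|x| / 2 by rewrite /m (negbTE x0) !ge_min lexx !orbT.
  by have : 0 < `|x|; [rewrite normr_gt0|lra].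
have -> : 4 * pi * M * e = 4 * pi * (e * M) by ring.
apply: V_bound; first exact: contC_ver.
move=> t; rewrite /Q cabsM cabs_cexp /= lnK//.
apply: ler_pM => //; first exact: ltW.
by rewrite -[cexp _]add0r; apply: HM; rewrite cabs_cexp /= lnK//; lra.
Qed.

(** Split f(z) = f(x) + (f(z) - f(x)): the second part vanishes by [V_dquot], the first is f(x)
    times the residue of [V_Jf1]. *)
Lemma V_Jf_pole f x s : (forall z, exists l, cder f z l) -> 2 * `|x| <= expR s ->
  V (Jf f x 0) s = (pi *+ 2)%:C * f x%:C.
Proof.
move=> df xs; have x0 : 0 <= `|x| by []. have e0 := expR_gt0 s.
have xs' : `|x| < expR s by lra.
have d1 z : exists l, cder (fun=> 1 : R[i]) z l by exists 0; exact: cder_cst.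
have [l dl] := df x%:C.
have c1 : ccont (fun t => Jf f x 0 (s +i* t)%C) by apply: ccont_ver_cder => t; exact: cder_Jf.
have c2 : ccont (fun t => Jf (fun=> 1) x 0 (s +i* t)%C) by apply: ccont_ver_cder => t; exact: cder_Jf.
have : V (fun w => cexp w * dquot f x l (cexp w)) s =
    V (Jf f x 0) s + (- f x%:C) * V (Jf (fun=> 1) x 0) s.
  rewrite /V -CI_Z// -CI_D//; last by apply: ccontM => //; exact: ccont_cst.
  congr CI; apply/funext => t; have nz := cexp_sub_neq0 t xs'.
  rewrite /dquot /Jf ifN; last by rewrite -subr_eq0.
  rewrite !expr0; move: nz; move: (cexp _) => k; move: (f k) (f _) => fk fx nz.
  by field.
rewrite (V_dquot df dl xs') V_Jf1// => /esym/eqP; rewrite mulNr subr_eq0 => /eqP ->.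
exact: mulrC.
Qed.

Lemma taylor_real f x s N (M : R) : (forall z, exists l, cder f z l) -> 2 * `|x| <= expR s ->
  0 <= M -> (forall z, cabs z = expR s -> cabs (f z) <= M) ->
  cabs (f x%:C - \sum_(n < N) tcoef f n * x%:C ^+ n) <= 4 * M / 2 ^+ N.
Proof.
move=> df xs M0 HM.
have x0 : 0 <= `|x| by []. have e0 := expR_gt0 s.
have xs' : `|x| < expR s by lra.
have := V_Jf_bound N df xs M0 HM.
have -> : V (Jf f x N) s = (pi *+ 2)%:C * (f x%:C - \sum_(n < N) tcoef f n * x%:C ^+ n).
  by rewrite mulrBr -(V_Jf_pole df xs) (V_Jf_sum N df xs') addrC addKr.
have p2 : 0 < pi *+ 2 :> R by rewrite mulr2n addr_gt0 ?pi_gt0.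
rewrite cabsM cabs_real gtr0_norm// => H.
rewrite -(ler_pM2l p2); apply: le_trans H _.
rewrite mulr2n le_eqVlt; apply/orP; left; apply/eqP.
by move: (pi : R) => pp; field; rewrite gt_eqF ?exprn_gt0.
Qed.

End Taylor.

(** * Real functions carried with all their derivatives *)

Section Chain.
Variable R : realType.
Implicit Types (x y b C B A : R) (u v : nat -> R -> R).
Local Notation "x %:C" := (real_complex R x).

(** A function [u 0] together with its derivatives [u k]; carrying the sequence avoids an iterated
    derivative operator and its side conditions. *)
Definition chain u := forall k x, is_derive x 1 (u k) (u k.+1 x).

Definition expchain B A u := chain u /\ forall k x, `|u k x| <= A * B ^+ k * expR (B * `|x|).

Section PowerSeries.
Variables (C B : R).
Hypotheses (C0 : 0 <= C) (B0 : 0 < B).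

Let dominated (D : R) (c : nat -> R) := forall n, `|c n| <= D * B ^+ n / n`!%:R.

Let pseries_dom (D : R) c x : 0 <= D -> dominated D c ->
  forall n, `|c n * x ^+ n| <= (D *: exp_coeff (B * `|x|)) n.
Proof.
move=> D0 Dc n; rewrite normrM normrX -[leRHS]/(D * ((B * `|x|) ^+ n / n`!%:R)).
apply: le_trans (ler_wpM2r (exprn_ge0 _ (normr_ge0 _)) (Dc n)) _.
by rewrite exprMn le_eqVlt; apply/orP; left; apply/eqP; ring.
Qed.

Let cvg_dom (D : R) x : cvgn (series (D *: exp_coeff (B * `|x|))).
Proof. by apply: is_cvg_seriesZ; exact: is_cvg_series_exp_coeff. Qed.

Let pseries_normed (D : R) c x : 0 <= D -> dominated D c ->
  cvgn [normed series (fun n => c n * x ^+ n)].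
Proof.
move=> D0 Dc; apply: (@series_le_cvg _ _ (D *: exp_coeff (B * `|x|))) => //.
- by move=> n; exact: normr_ge0.
- by move=> n; exact: le_trans (normr_ge0 _) (pseries_dom x D0 Dc n).
- by move=> n; exact: pseries_dom.
Qed.

Let pseries_cvg (D : R) c x : 0 <= D -> dominated D c -> cvgn (pseries c x).
Proof. by move=> D0 Dc; apply: (@normed_cvg _ R^o); exact: pseries_normed D0 Dc. Qed.

Let pseries_bound (D : R) c x : 0 <= D -> dominated D c -> `|limn (pseries c x)| <= D * expR (B * `|x|).
Proof.
move=> D0 Dc; have cn := @pseries_normed D c x D0 Dc.
apply: le_trans (@lim_series_norm _ R^o _ cn) _.
apply: le_trans (@lim_series_le _ (fun n => `|c n * x ^+ n|) (D *: exp_coeff (B * `|x|)) cn (@cvg_dom D x) (pseries_dom x D0 Dc)) _.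
by rewrite lim_seriesZ//; exact: is_cvg_series_exp_coeff.
Qed.

Let dominated_diffs (D : R) c : dominated D c -> dominated (D * B) (pseries_diffs c).
Proof.
move=> Dc n; rewrite /pseries_diffs normrM ger0_norm ?ler0n//.
apply: le_trans (ler_wpM2l _ (Dc n.+1)) _; first by rewrite ler0n.
have f0 : (n`!%:R : R) != 0 by rewrite pnatr_eq0 -lt0n fact_gt0.
have n0 : (n.+1%:R : R) != 0 by rewrite pnatr_eq0.
rewrite factS natrM exprS le_eqVlt; apply/orP; left; apply/eqP.
by move: (n.+1%:R : R) (n`!%:R : R) n0 f0 => p q p0 q0; field; rewrite p0 q0.
Qed.

(** Differentiating the series multiplies its majorant D exp(B|x|) by B, which gives the bound for
    every k. The geometric rate in the second hypothesis identifies the sum of the series with f. *)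
Lemma pseries_chain (c : nat -> R) (f : R -> R) : dominated C c ->
  (forall x, exists K : R, forall N, `|f x - \sum_(n < N) c n * x ^+ n| <= K / 2 ^+ N) ->
  exists u, u 0%N = f /\ expchain B C u.
Proof.
move=> Cc fc.
pose d k := iter k (@pseries_diffs R) c.
have dd k : dominated (C * B ^+ k) (d k).
  elim: k => [|k IH]; first by rewrite expr0 mulr1.
  by rewrite exprSr mulrA; exact: dominated_diffs.
have d0 k : 0 <= C * B ^+ k by rewrite mulr_ge0// exprn_ge0// ltW.
exists (fun k x => limn (pseries (d k) x)); split.
  apply/funext => x; apply: cvg_lim => //.
  have [K HK] := fc x.
  apply/cvgrPdist_lt => e e0.
  have p0 : 0 <= `|K| / e by rewrite divr_ge0// ltW.
  exists (Num.bound (`|K| / e)) => // N /= hN.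
  rewrite /pseries /series /= big_mkord; apply: le_lt_trans (HK N) _.
  rewrite ltr_pdivrMr ?exprn_gt0//; apply: le_lt_trans (ler_norm _) _.
  rewrite mulrC -ltr_pdivrMr//; apply: lt_le_trans (archi_boundP p0) _.
  by rewrite -natrX ler_nat; apply: leq_trans hN _; rewrite ltnW// ltn_expl.
split=> [k x|k x]; last exact: pseries_bound.
(* Term-by-term differentiation is available strictly inside a point of convergence; |x| + 1 serves
   as that point. *)
have c0 : cvgn (pseries (d k) (`|x| + 1)) by exact: pseries_cvg (d0 k) (dd k).
have c1 : cvgn (pseries (pseries_diffs (d k)) (`|x| + 1)).
  exact: pseries_cvg (d0 k.+1) (dd k.+1).
have c2 : cvgn (pseries (pseries_diffs (pseries_diffs (d k))) (`|x| + 1)).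
  exact: pseries_cvg (d0 k.+2) (dd k.+2).
have lx : `|x| < `|(`|x| + 1)| by rewrite [ltRHS]ger0_norm ?addr_ge0// ltrDl.
exact: pseries_snd_diffs c0 c1 c2 lx.
Qed.

End PowerSeries.

Lemma fact_le_expn n : (n`! <= n ^ n)%N.
Proof.
suff H m : (m <= n)%N -> (m`! <= n ^ m)%N by exact: H.
elim: m => [|m IH] mn; first by rewrite expn0.
by rewrite factS expnS leq_mul// IH// ltnW.
Qed.

Definition growth b A (f : R[i] -> R[i]) := forall z, cabs (f z) <= A * expR (b * cabs z).

(** Cauchy's estimate at the radius n / b, which minimizes exp(b r) / r^n, followed by n! <= n^n.
    For n = 0 the radius 1 is used, whence the factor exp(b). *)
Lemma tcoef_growth f b A n : 0 < b -> 0 <= A -> (forall z, exists l, cder f z l) ->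
  growth b A f -> cabs (tcoef f n) <= 2 * A * expR b * (b * expR 1) ^+ n / n`!%:R.
Proof.
move=> b0 A0 df gf; have eb : 1 <= expR b by rewrite -expR0 ler_expR ltW.
case: n => [|n].
  have H := @cabs_tcoef _ f 0 1 (A * expR b) df ltr01 _.
  apply: le_trans (H _) _; first by move=> z z1; have := gf z; rewrite z1 mulr1.
  by rewrite !expr0 !divr1 mulr1 mulrA.
have r0 : 0 < n.+1%:R / b by rewrite divr_gt0.
have H := @cabs_tcoef _ f n.+1 _ (A * expR n.+1%:R) df r0 _.
apply: le_trans (H _) _.
  by move=> z z1; have := gf z; rewrite z1 [b * _]mulrC divfK// gt_eqF.
have nf : (n.+1`!%:R : R) <= n.+1%:R ^+ n.+1 by rewrite -natrX ler_nat fact_le_expn.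
have f0 : 0 < (n.+1`!%:R : R) by rewrite ltr0n fact_gt0.
have -> : 2 * (A * expR n.+1%:R) / (n.+1%:R / b) ^+ n.+1 =
    2 * A * (b * expR 1) ^+ n.+1 * (n.+1%:R ^+ n.+1)^-1.
  rewrite [X in expR X](_ : _ = n.+1%:R * 1); last by rewrite mulr1.
  rewrite expRM_natl !exprMn exprVn.
  rewrite invfM invrK; ring.
have X0 : 0 <= 2 * A * (b * expR 1) ^+ n.+1.
  by rewrite !mulr_ge0// exprn_ge0// mulr_ge0 ?expR_ge0// ltW.
apply: ler_pM => //.
- rewrite -!mulrA; do 2![apply: ler_wpM2l => //].
  by rewrite ler_peMl// exprn_ge0// mulr_ge0 ?expR_ge0// ltW.
- by rewrite lef_pV2 ?posrE// exprn_gt0.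
Qed.

(** The factor e on top of the exponent b is the price of n! <= n^n in place of Stirling's formula;
    what matters is the dependence on b alone. *)
Definition chainB b : R := b * expR 1.

Lemma entire_chains f b A : 0 < b -> 0 <= A -> entire f -> growth b A f ->
  exists u v, [/\ forall x, f x%:C = (u 0%N x +i* v 0%N x)%C,
    expchain (chainB b) (2 * A * expR b) u & expchain (chainB b) (2 * A * expR b) v].
Proof.
move=> b0 A0 /entireP df gf.
have C0 : 0 <= 2 * A * expR b by rewrite !mulr_ge0// expR_ge0.
have B0 : 0 < chainB b by rewrite mulr_gt0// expR_gt0.
have fc x : exists K : R, forall N,
    cabs (f x%:C - \sum_(n < N) tcoef f n * x%:C ^+ n) <= K / 2 ^+ N.
  have s0 : 0 < 2 * `|x| + 1 by rewrite ltr_wpDl// mulr_ge0.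
  have H N := @taylor_real _ f x (ln (2 * `|x| + 1)) N (A * expR (b * (2 * `|x| + 1))) df.
  exists (4 * (A * expR (b * (2 * `|x| + 1)))) => N; apply: H.
  - by rewrite lnK// lerDl.
  - by rewrite mulr_ge0// expR_ge0.
  - by move=> z; rewrite lnK// => <-; exact: gf.
have xn x n : x%:C ^+ n = (x ^+ n)%:C by rewrite rmorphXn.
have Resum N (F : nat -> R[i]) : cRe (\sum_(n < N) F n) = \sum_(n < N) cRe (F n).
  by elim: N => [|N IH]; rewrite ?big_ord0// !big_ord_recr /= cReD IH.
have Imsum N (F : nat -> R[i]) : cIm (\sum_(n < N) F n) = \sum_(n < N) cIm (F n).
  by elim: N => [|N IH]; rewrite ?big_ord0// !big_ord_recr /= cImD IH.
have [||u [u0 eu]] := pseries_chain C0 B0 (c := fun n => cRe (tcoef f n)) (f := fun x => cRe (f x%:C)).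
- by move=> n; apply: le_trans (Re_le_cabs _) (tcoef_growth n b0 A0 df gf).
- move=> x; have [K HK] := fc x; exists K => N; have := le_trans (Re_le_cabs _) (HK N); rewrite cReD cReN (Resum N (fun n => tcoef f n * x%:C ^+ n)).
  rewrite (eq_bigr (fun n : 'I_N => cRe (tcoef f n) * x ^+ n))// => n _.
  by rewrite xn cReM /= mulr0 subr0.
have [||v [v0 ev]] := pseries_chain C0 B0 (c := fun n => cIm (tcoef f n)) (f := fun x => cIm (f x%:C)).
- by move=> n; apply: le_trans (Im_le_cabs _) (tcoef_growth n b0 A0 df gf).
- move=> x; have [K HK] := fc x; exists K => N; have := le_trans (Im_le_cabs _) (HK N); rewrite cImD cImN (Imsum N (fun n => tcoef f n * x%:C ^+ n)).
  rewrite (eq_bigr (fun n : 'I_N => cIm (tcoef f n) * x ^+ n))// => n _.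
  by rewrite xn cImM /= mulr0 add0r.
exists u, v; split=> // x; rewrite u0 v0; by case: (f _).
Qed.

End Chain.

(** * Bernstein's inequality *)

Section Bernstein.
Variable R : realType.
Implicit Types (x y a b A B C P Q S r : R) (u v w : nat -> R -> R) (f g : R -> R).

(** Squared L2 norm at most S, stated through finite intervals so that only [RI] is involved. *)
Definition L2bound f S := forall a b, a <= b -> RI a b (fun x => f x ^+ 2) <= S.

Lemma chain_cont u k : chain u -> continuous (u k).
Proof. by move=> cu; apply: is_derive_continuous (cu k). Qed.

Lemma L2bound_ge0 f S : L2bound f S -> 0 <= S.
Proof. by move=> /(_ 0 0 (lexx 0)); apply: le_trans; apply: RI_ge0 => x _; exact: sqr_ge0. Qed.

(* [Wmul u v k i j] is the [k]-th derivative of [u i * v j]. *)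
Fixpoint Wmul u v k i j : R -> R :=
  if k is k'.+1 then fun x => Wmul u v k' i.+1 j x + Wmul u v k' i j.+1 x
  else fun x => u i x * v j x.

Lemma Wmul_chain u v i j : chain u -> chain v -> chain (fun k => Wmul u v k i j).
Proof.
move=> cu cv k; elim: k i j => [|k IH] i j x; first exact: isdM.
exact: isdD.
Qed.

Lemma Wmul_bound u v P Q a b x : 0 <= P -> 0 <= Q -> 0 <= a -> 0 <= b ->
  (forall k, `|u k x| <= P * a ^+ k) -> (forall k, `|v k x| <= Q * b ^+ k) ->
  forall k i j, `|Wmul u v k i j x| <= P * Q * a ^+ i * b ^+ j * (a + b) ^+ k.
Proof.
move=> P0 Q0 a0 b0 ua vb; elim=> [|k IH] i j /=.
  rewrite normrM expr0 mulr1 (_ : P * Q * _ * _ = (P * a ^+ i) * (Q * b ^+ j)); last ring.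
  exact: ler_pM.
apply: le_trans (ler_normD _ _) _; apply: le_trans (lerD (IH _ _) (IH _ _)) _.
by rewrite !exprS le_eqVlt; apply/orP; left; apply/eqP; ring.
Qed.

Lemma Wmul_vanish_r u v x k i j : (forall l, (l <= j + k)%N -> v l x = 0) -> Wmul u v k i j x = 0.
Proof.
elim: k i j => [|k IH] i j H /=; first by rewrite H ?mulr0// addn0.
by rewrite !IH ?addr0// => l lk; apply: H; rewrite ?addnS -?addSn// leqW.
Qed.

Lemma Wmul_vanish_l u v x k i j : (forall l, (l <= i + k)%N -> u l x = 0) -> Wmul u v k i j x = 0.
Proof.
elim: k i j => [|k IH] i j H /=; first by rewrite H ?mul0r// addn0.
by rewrite !IH ?addr0// => l lk; apply: H; rewrite ?addnS -?addSn// leqW.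
Qed.

(** The k-th derivative of (x + c)^n, with [n ^_ k] the falling factorial. For k > n the coefficient
    is 0, so the truncated exponent does no harm. *)
Definition pw (n : nat) (c : R) (k : nat) : R -> R := fun x => (n ^_ k)%:R * (x + c) ^+ (n - k).

Lemma pw_chain n c : chain (pw n c).
Proof.
move=> k x; have d1 : is_derive x 1 (fun y => y + c) 1.
  by apply: isd_eq (isdD (isd_id x) (isd_cst c x)) _; rewrite addr0.
rewrite /pw ffactnSr natrM.
have [nk|kn] := leqP n k.
  have -> : (n - k)%N = 0%N by apply/eqP; rewrite subn_eq0.
  rewrite mulr0 mul0r; under eq_fun do rewrite expr0 mulr1; exact: isd_cst.
have [m nkm] : exists m, (n - k)%N = m.+1 by exists (n - k).-1; rewrite prednK// subn_gt0.
have -> : (n - k.+1)%N = m by rewrite subnS nkm.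
rewrite nkm; apply: isd_eq (isdZ (n ^_ k)%:R (isdX m d1)) _.
by rewrite mulr1 mulrA.
Qed.

(** One constant C dominates both |x + c| and the factors of the falling factorial, so trading a
    power of x + c for such a factor never exceeds C^n. *)
Lemma pw_bound n c k x C : `|x + c| <= C -> n%:R <= C -> `|pw n c k x| <= C ^+ n * 1 ^+ k.
Proof.
move=> xC nC; rewrite expr1n mulr1 /pw normrM normrX.
have C0 : 0 <= C := le_trans (normr_ge0 _) xC.
have [kn|nk] := leqP k n; last by rewrite ffact_small// normr0 mul0r exprn_ge0.
have -> : C ^+ n = C ^+ k * C ^+ (n - k) by rewrite -exprD subnKC.
rewrite ger0_norm ?ler0n//; apply: ler_pM.
- by [].
- by rewrite exprn_ge0.
- apply: (@le_trans _ _ (n%:R ^+ k)); last by apply: lerXn2r; rewrite ?nnegrE ?ler0n.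
  rewrite -natrX ler_nat; elim: (k) => [|l IH]; first by rewrite ffactn0 expn0.
  by rewrite ffactnSr expnSr leq_mul// leq_subr.
- by apply: lerXn2r; rewrite ?nnegrE.
Qed.

Lemma pw_vanish n c l : (l < n)%N -> pw n c l (- c) = 0.
Proof. by move=> ln; rewrite /pw addNr expr0n subn_eq0 leqNgt ln mulr0. Qed.

(** The k-th derivative of ((x^2 - m^2) / m^2)^m, which is (1 - x^2/m^2)^m up to sign; hence the
    absolute values in the lemmas about it. *)
Definition cutoff (m : nat) (k : nat) : R -> R :=
  fun x => (m%:R ^+ (2 * m))^-1 * Wmul (pw m (- m%:R)) (pw m m%:R) k 0 0 x.

Lemma cutoff_chain m : chain (cutoff m).
Proof. by move=> k x; apply: isdZ; apply: Wmul_chain; exact: pw_chain. Qed.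

(** Both factors have all their derivatives at most (2m)^m on [-m, m]; dividing the product by
    m^(2m) leaves 4^m, and the product rule contributes 2^k. *)
Lemma cutoff_bound m k x : (0 < m)%N -> `|x| <= m%:R -> `|cutoff m k x| <= 4 ^+ m * 2 ^+ k.
Proof.
move=> m0 xm; have mp : 0 < (m%:R : R) by rewrite ltr0n.
have mm : 0 < (m%:R : R) ^+ (2 * m) by rewrite exprn_gt0.
rewrite /cutoff normrM gtr0_norm ?invr_gt0// mulrC ler_pdivrMr//.
have H c : `|c| <= m%:R -> forall k, `|pw m c k x| <= (2 * m%:R) ^+ m * 1 ^+ k.
  move=> cm l; apply: pw_bound; last by lra.
  by apply: le_trans (ler_normD _ _) _; lra.
have X0 : 0 <= (2 * m%:R : R) ^+ m by rewrite exprn_ge0// mulr_ge0// ltW.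
apply: le_trans (Wmul_bound X0 X0 ler01 ler01 (H _ _) (H _ _) k 0 0) _.
- by rewrite normrN ger0_norm// ltW.
- by rewrite ger0_norm// ltW.
rewrite !expr0 !mulr1 (_ : 1 + 1 = 2 :> R); last ring.
rewrite mul2n -addnn exprD !exprMn (_ : (4 : R) = 2 * 2) ?exprMn; last ring.
by rewrite le_eqVlt; apply/orP; left; apply/eqP; ring.
Qed.

Lemma cutoff_vanish m k : (k < m)%N -> cutoff m k m%:R = 0 /\ cutoff m k (- m%:R) = 0.
Proof.
move=> km; rewrite /cutoff; split.
  rewrite Wmul_vanish_l ?mulr0// => l; rewrite add0n => lk.
  by rewrite -[X in pw _ _ _ X]opprK pw_vanish// (leq_ltn_trans lk).
rewrite Wmul_vanish_r ?mulr0// => l; rewrite add0n => lk.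
by rewrite pw_vanish// (leq_ltn_trans lk).
Qed.

Lemma bernoulli_ineq y m : 0 <= y <= 1 -> 1 - m%:R * y <= (1 - y) ^+ m.
Proof.
move=> /andP[y0 y1]; elim: m => [|m IH]; first by rewrite mul0r subr0 expr0.
rewrite exprS -natr1; have y1' : 0 <= 1 - y by lra.
apply: le_trans (ler_wpM2l y1' IH); have : 0 <= (m%:R : R) by []; nra.
Qed.

Lemma cutoff0E m x : (0 < m)%N -> `|cutoff m 0 x| = `|1 - x ^+ 2 / m%:R ^+ 2| ^+ m.
Proof.
move=> m0; have mp : (m%:R : R) != 0 by rewrite pnatr_eq0 -lt0n.
rewrite /cutoff /= /pw !ffactn0 !subn0 !mul1r -exprMn exprM -exprVn -exprMn normrX.
congr (_ ^+ _); rewrite -normrN; congr `|_|; by field.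
Qed.

Lemma cutoff0_le1 m x : (0 < m)%N -> `|x| <= m%:R -> `|cutoff m 0 x| <= 1.
Proof.
move=> m0 xm; have mp : 0 < (m%:R : R) by rewrite ltr0n.
rewrite cutoff0E//; apply: exprn_ile1 => //.
have h1 : x ^+ 2 / m%:R ^+ 2 <= 1.
  by rewrite ler_pdivrMr ?exprn_gt0// mul1r -real_normK ?num_real// lerXn2r ?nnegrE// ltW.
have h2 : 0 <= x ^+ 2 / m%:R ^+ 2 by rewrite divr_ge0 ?sqr_ge0.
by rewrite ler_norml; lra.
Qed.

(** Bernoulli: (1 - x^2/m^2)^m >= 1 - x^2/m >= 1/2. *)
Lemma cutoff0_ge m x r : (0 < m)%N -> `|x| <= r -> 2 * r ^+ 2 <= m%:R -> r <= m%:R ->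
  2^-1 <= `|cutoff m 0 x|.
Proof.
move=> m0 xr rm rm'; have mp : 0 < (m%:R : R) by rewrite ltr0n.
have r0 : 0 <= r := le_trans (normr_ge0 _) xr.
rewrite cutoff0E//.
have xr2 : x ^+ 2 <= r ^+ 2 by rewrite -(real_normK (num_real x)) lerXn2r ?nnegrE.
have h2 : 0 <= x ^+ 2 / m%:R ^+ 2 by rewrite divr_ge0 ?sqr_ge0.
have h1 : x ^+ 2 / m%:R ^+ 2 <= 1.
  rewrite ler_pdivrMr ?exprn_gt0// mul1r; apply: le_trans xr2 _.
  by rewrite lerXn2r ?nnegrE// ltW.
have h3 : m%:R * (x ^+ 2 / m%:R ^+ 2) <= 2^-1.
  rewrite (_ : m%:R * _ = x ^+ 2 / m%:R); last by field; rewrite gt_eqF.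
  by rewrite ler_pdivrMr//; lra.
rewrite ger0_norm; last by lra.
by apply: le_trans (bernoulli_ineq m _); lra.
Qed.

Lemma cutoff1_le m x : (0 < m)%N -> `|x| <= m%:R -> 2 * `|x| <= m%:R -> `|cutoff m 1 x| <= 1.
Proof.
case: m => // m _ xm xm'; set M := m.+1%:R : R.
have mp : 0 < M by rewrite ltr0n.
have Mn : M != 0 by rewrite gt_eqF.
have -> : cutoff m.+1 1 x = (x ^+ 2 / M ^+ 2 - 1) ^+ m * (2 * x / M).
  rewrite /cutoff /= /pw !ffactn1 !ffactn0 !subn0 subn1 /= -/M mul1r mul1r.
  have -> : (M ^+ (2 * m.+1))^-1 = (M ^+ 2)^-1 ^+ m * (M ^+ 2)^-1.
    by rewrite exprM -exprVn -exprSr.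
  have -> : (x ^+ 2 / M ^+ 2 - 1) = (x - M) * (x + M) * (M ^+ 2)^-1 by field.
  by rewrite !exprMn !(exprS _ m); field.
rewrite normrM normrX -[leRHS](mulr1 1); apply: ler_pM => //.
  apply: exprn_ile1 => //.
  have h1 : x ^+ 2 / M ^+ 2 <= 1.
    by rewrite ler_pdivrMr ?exprn_gt0// mul1r -real_normK ?num_real// lerXn2r ?nnegrE// ltW.
  have h2 : 0 <= x ^+ 2 / M ^+ 2 by rewrite divr_ge0 ?sqr_ge0.
  by rewrite ler_norml; move: h1 h2; move: (x ^+ 2 / M ^+ 2) => t h1 h2; lra.
rewrite normrM normfV (gtr0_norm mp) ler_pdivrMr// mul1r normrM ger0_norm//.
Qed.

(** Log-convexity makes the ratios N(k+1)/N(k) nondecreasing, so the (n+1)-th power of the first is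
    at most their product N(n+1)/N(0). The form without division allows vanishing terms. *)
Lemma logconvex_bound (N : nat -> R) n : (forall k, 0 <= N k) ->
  (forall k, (k < n)%N -> N k.+1 ^+ 2 <= N k * N k.+2) -> N 1%N ^+ n.+1 <= N 0%N ^+ n * N n.+1.
Proof.
move=> N0 lc.
have mono k : (k <= n)%N -> N 1%N * N k <= N 0%N * N k.+1.
  elim: k => [|k IH] kn; first by rewrite mulrC.
  have [->|Nk1] := eqVneq (N k.+1) 0; first by rewrite mulr0 mulr_ge0.
  have H := lc k kn; have H' := IH (ltnW kn).
  have p1 : 0 < N k.+1 by rewrite lt_neqAle eq_sym Nk1 N0.
  have pk : 0 < N k.
    rewrite lt_neqAle eq_sym N0 andbT; apply: contraTneq H => ->.
    by rewrite mul0r -ltNge exprn_gt0.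
  rewrite -(ler_pM2r pk); apply: (@le_trans _ _ (N 0%N * N k.+1 ^+ 2)).
    rewrite (_ : _ * N k = N 1%N * N k * N k.+1); last ring.
    by rewrite expr2 mulrA ler_wpM2r.
  by rewrite -mulrA (mulrC (N k.+2)); apply: ler_wpM2l.
suff H k : (k <= n)%N -> N 1%N ^+ k.+1 <= N 0%N ^+ k * N k.+1 by exact: H.
elim: k => [|k IH] kn; first by rewrite expr0 expr1 mul1r.
rewrite exprS; apply: le_trans (ler_wpM2l (N0 1%N) (IH (ltnW kn))) _.
rewrite (_ : N 1%N * _ = N 0%N ^+ k * (N 1%N * N k.+1)); last ring.
by rewrite exprSr -mulrA ler_wpM2l ?exprn_ge0// mono.
Qed.

(** From u'^2 <= 8 F'^2 + 8 u^2 and ||F'||^2 <= 2 q^2 S, where q = 4 exp(B) (B + 2) collects the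
    geometric rates of the cutoff, the growth bound and the product rule. *)
Definition bernC B : R := 16 * (4 * expR B * (B + 2)) ^+ 2 + 8.

Lemma pow2_ge n : ((n * n)%N%:R : R) <= 4 * 2 ^+ n.
Proof.
rewrite -natrX -natrM ler_nat; case: n => // -[//|] -[//|] n.
suff H : (n.+3 * n.+3 <= 2 * 2 ^ n.+3)%N by apply: leq_trans H _; rewrite leq_mul2r orbT.
elim: n => // n IH; rewrite expnS.
have : (n.+4 * n.+4 <= 2 * (n.+3 * n.+3))%N by nia.
by move=> /leq_trans; apply; rewrite leq_mul2l IH.
Qed.

(** The squared norm of the m-th derivative is at most A^2 q^(2m) times 2m. After log-convexity the
    slack factor 2 in 2 q^2, raised to the power m, beats A^2 m; so [A] only affects how large m
    must be. *)
Lemma cut_estimate u A B S : 0 <= A -> 0 <= B -> 0 < S -> expchain B A u -> L2bound (u 0%N) S ->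
  exists m0, forall m, (m0 <= m)%N ->
   RI (- m%:R) m%:R (fun x => Wmul u (cutoff m) 1 0 0 x ^+ 2) <=
     2 * (4 * expR B * (B + 2)) ^+ 2 * S.
Proof.
move=> A0 B0 S0 [cu bu] uS; set q := 4 * expR B * (B + 2).
have q0 : 0 < q by rewrite !mulr_gt0 ?expR_gt0//; lra.
(* This gives m S > 8 A^2, whereas a failure of the estimate, compared with 2^m >= m^2 / 4, would
   give m S <= 8 A^2. *)
exists (Num.bound (8 * A ^+ 2 / S)).+1 => -[//|m] hm.
set M := m.+1%:R : R; set F := fun k => Wmul u (cutoff m.+1) k 0 0.
have mp : 0 < M by rewrite ltr0n.
have NM : - M <= M by lra.
have cF : chain F by apply: Wmul_chain => //; exact: cutoff_chain.
have ccF k := chain_cont (k := k) cF.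
pose N k := RI (- M) M (fun x => F k x ^+ 2).
have N0 k : 0 <= N k by apply: RI_ge0 => x _; exact: sqr_ge0.
have van k : (k < m.+1)%N -> F k M = 0 /\ F k (- M) = 0.
  move=> km; split; apply: Wmul_vanish_r => l; rewrite add0n => lk;
  by have [] := @cutoff_vanish m.+1 l (leq_ltn_trans lk km).
have lc k : (k < m)%N -> N k.+1 ^+ 2 <= N k * N k.+2.
  move=> km; have [v1 v2] := van k (leqW km).
  have d x : is_derive x 1 (fun y => F k y * F k.+1 y) (F k.+1 x ^+ 2 + F k x * F k.+2 x).
    by apply: isd_eq (isdM (cF k x) (cF k.+1 x)) _; rewrite expr2.
  have cc : continuous (fun x => F k.+1 x ^+ 2 + F k x * F k.+2 x).
    have c1 := ccF k; have c2 := ccF k.+1; have c3 := ccF k.+2; by cont.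
  have := RI_ftc NM d cc; rewrite v1 v2 !mul0r subrr RI_D; last 2 first.
  - by have c2 := ccF k.+1; cont.
  - by have c2 := ccF k.+2; have c1 := ccF k; cont.
  move=> /eqP; rewrite addr_eq0 => /eqP E; rewrite {1}/N E sqrrN.
  exact: RI_CS.
have H1 := logconvex_bound N0 lc.
have HN0 : N 0%N <= S.
  apply: le_trans (uS _ _ NM); apply: RI_le.
  - by have c1 := ccF 0%N; cont.
  - by have c1 := chain_cont (k := 0) cu; cont.
  - move=> x hx; rewrite /F /= exprMn -[leRHS]mulr1 ler_wpM2l ?sqr_ge0//.
    rewrite -(real_normK (num_real (cutoff _ _ _))); apply: exprn_ile1 => //.
    by apply: cutoff0_le1 => //; rewrite ler_norml.
have HNm : N m.+1 <= A ^+ 2 * (q ^+ 2) ^+ m.+1 * (2 * M).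
  have K x : - M <= x <= M -> `|F m.+1 x| <= A * q ^+ m.+1.
    move=> hx; have xM : `|x| <= M by rewrite ler_norml.
    have h1 k : `|u k x| <= A * expR (B * M) * B ^+ k.
      apply: le_trans (bu k x) _; rewrite mulrAC ler_wpM2r ?exprn_ge0//.
      by rewrite ler_wpM2l// ler_expR ler_wpM2l.
    have := Wmul_bound _ _ B0 _ h1 (fun k => @cutoff_bound m.+1 k x isT xM) m.+1 0 0.
    rewrite !expr0 !mulr1 => /(_ _ _ _)/le_trans; apply.
    - by rewrite mulr_ge0// expR_ge0.
    - by rewrite exprn_ge0.
    - by [].
    - rewrite /M expRM_natr /q !exprMn le_eqVlt; apply/orP; left; apply/eqP; ring.
  apply: (@le_trans _ _ (RI (- M) M (fun=> A ^+ 2 * (q ^+ 2) ^+ m.+1))).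
    apply: RI_le.
    - by have c1 := ccF m.+1; cont.
    - exact: continuous_cst.
    - move=> x /K Kx; rewrite -(real_normK (num_real (F m.+1 x))) exprAC -exprMn.
      by rewrite lerXn2r ?nnegrE// (le_trans _ Kx).
  by rewrite RI_cst// (_ : M - - M = 2 * M)//; ring.
rewrite -/(N 1%N) leNgt; apply/negP => lt.
have q20 : 0 < q ^+ 2 := exprn_gt0 2 q0.
have p2 : 0 < 2 * q ^+ 2 * S by apply: mulr_gt0 => //; exact: mulr_gt0.
have : (2 * q ^+ 2 * S) ^+ m.+1 <= S ^+ m * (A ^+ 2 * (q ^+ 2) ^+ m.+1 * (2 * M)).
  apply: (@le_trans _ _ (N 1%N ^+ m.+1)).
    by apply: lerXn2r; rewrite ?nnegrE// ltW.
  apply: le_trans H1 _; apply: ler_pM => //; first exact: exprn_ge0.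
  by apply: lerXn2r; rewrite ?nnegrE// ltW.
have gen (Q : R) : (2 * Q * S) ^+ m.+1 = 2 ^+ m.+1 * Q ^+ m.+1 * (S * S ^+ m).
  by rewrite exprMn exprMn (exprS S).
rewrite gen.
set X := S ^+ m; set Y := (q ^+ 2) ^+ m.+1.
have X0 : 0 < X by rewrite exprn_gt0.
have Y0 : 0 < Y by rewrite !exprn_gt0.
rewrite (_ : 2 ^+ m.+1 * Y * (S * X) = (X * Y) * (2 ^+ m.+1 * S)); last ring.
rewrite (_ : X * (_ * Y * _) = (X * Y) * (A ^+ 2 * (2 * M))); last ring.
rewrite ler_pM2l ?mulr_gt0// => K1.
have K2 := pow2_ge m.+1; rewrite natrM -/M in K2.
have K3 : 8 * A ^+ 2 / S < M.
  apply: lt_le_trans (archi_boundP _) _; first by rewrite divr_ge0 ?mulr_ge0 ?sqr_ge0// ltW.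
  by rewrite ler_nat ltnW.
rewrite ltr_pdivrMr// in K3.
have : M * M * S <= 4 * (A ^+ 2 * (2 * M)).
  by apply: le_trans (ler_wpM2r (ltW S0) K2) _; rewrite -mulrA ler_pM2l.
rewrite (_ : 4 * _ = M * (8 * A ^+ 2)); last ring.
by rewrite -mulrA ler_pM2l// leNgt K3.
Qed.

Theorem bernstein u A B S : 0 <= A -> 0 <= B -> expchain B A u -> L2bound (u 0%N) S ->
  L2bound (u 1%N) (bernC B * S).
Proof.
move=> A0 B0 eu uS; have S0 := L2bound_ge0 uS; have [cu bu] := eu.
have C0 : 0 < bernC B by rewrite /bernC ltr_wpDl// mulr_ge0// sqr_ge0.
have c0 := chain_cont (k := 0) cu; have c1 := chain_cont (k := 1) cu.
move=> a b ab; apply/ler_addgt0Pr => e e0.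
(* [cut_estimate] needs a positive bound on the energy, so S is enlarged at the expense of the
   tolerance e. *)
pose S' := S + e / bernC B.
have S'0 : 0 < S' by rewrite ltr_wpDl// divr_gt0.
have uS' : L2bound (u 0%N) S'.
  by move=> c d cd; apply: le_trans (uS c d cd) _; rewrite lerDl divr_ge0// ltW.
have -> : bernC B * S + e = bernC B * S' by rewrite /S'; field; rewrite gt_eqF.
have [m0 Hm] := cut_estimate A0 B0 S'0 eu uS'.
pose r := Num.max `|a| `|b|.
have [ra rb] : `|a| <= r /\ `|b| <= r by rewrite /r !le_max !lexx orbT.
have r0 : 0 <= r := le_trans (normr_ge0 _) ra.
(* Large enough for [cut_estimate], and on [-r, r] for |cutoff| >= 1/2 and |cutoff'| <= 1. *)
pose m := (m0 + Num.bound (2 * r ^+ 2) + Num.bound (2 * r)).+1.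
set M := m%:R : R.
have mr1 : 2 * r ^+ 2 <= M.
  have /archi_boundP/ltW/le_trans : 0 <= 2 * r ^+ 2 by rewrite mulr_ge0 ?sqr_ge0.
  by apply; rewrite ler_nat; apply: leqW; exact: leq_trans (leq_addl _ _) (leq_addr _ _).
have mr2 : 2 * r <= M.
  have /archi_boundP/ltW/le_trans : 0 <= 2 * r by rewrite mulr_ge0.
  by apply; rewrite ler_nat; apply: leqW; exact: leq_addl.
have m0m : (m0 <= m)%N by apply: leqW; rewrite -addnA; exact: leq_addr.
have HM := Hm m m0m; rewrite -/M in HM.
have cF : chain (fun k => Wmul u (cutoff m) k 0 0) by apply: Wmul_chain => //; exact: cutoff_chain.
have cF1 := chain_cont (k := 1) cF.
set F := Wmul u (cutoff m) 1 0 0 in HM cF1.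
have aM : - M <= a by move: ra; rewrite ler_norml; lra.
have bM : b <= M by move: rb; rewrite ler_norml; lra.
have pt x : a <= x <= b -> u 1%N x ^+ 2 <= 8 * F x ^+ 2 + 8 * u 0%N x ^+ 2.
  move=> hx; have xr : `|x| <= r by move: ra rb; rewrite !ler_norml; lra.
  have k0 := @cutoff0_ge m x r isT xr mr1 ltac:(lra).
  have k1 := @cutoff1_le m x isT ltac:(rewrite -/M; lra) ltac:(rewrite -/M; lra).
  have FE : u 1%N x * cutoff m 0 x = F x - u 0%N x * cutoff m 1 x by rewrite /F /=; ring.
  have h1 : (u 1%N x * cutoff m 0 x) ^+ 2 <= 2 * F x ^+ 2 + 2 * u 0%N x ^+ 2.
    rewrite FE; have : (u 0%N x * cutoff m 1 x) ^+ 2 <= u 0%N x ^+ 2.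
      rewrite exprMn -[leRHS]mulr1 ler_wpM2l ?sqr_ge0//.
      by rewrite -(real_normK (num_real (cutoff _ _ _))); exact: exprn_ile1.
    move: (u 0%N x * cutoff m 1 x) (F x) => p q hp.
    have := sqr_ge0 (p + q); nra.
  have h2 : 1/4 <= cutoff m 0 x ^+ 2.
    rewrite -(real_normK (num_real (cutoff _ _ _))); move: k0; move: `|cutoff m 0 x| => t; nra.
  rewrite exprMn in h1; have := sqr_ge0 (u 1%N x); nra.
apply: le_trans (RI_le _ _ pt) _; [by cont|by cont|].
rewrite RI_D; [|by cont|by cont].
rewrite !RI_Z; [|by cont|by cont].
have H0 := uS' a b ab.
have H1 : RI a b (fun x => F x ^+ 2) <= 2 * (4 * expR B * (B + 2)) ^+ 2 * S'.
  apply: le_trans HM; have cF2 := continuous_sqr cF1.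
  have sq c d : 0 <= RI c d (fun x => F x ^+ 2) by apply: RI_ge0 => z _; exact: sqr_ge0.
  rewrite [leRHS](@RI_split _ (- M) a M)//; last lra.
  rewrite (@RI_split _ a b M)//.
  by have := sq (- M) a; have := sq b M; lra.
rewrite /bernC; move: (_ ^+ 2) H1 => Q2; nra.
Qed.

(** Passing to the derivative changes A but not B, and [bernC] depends on B alone: the inequality
    can be iterated with one constant. *)
Lemma expchain_shift u A B : expchain B A u -> expchain B (A * B) (fun k => u k.+1).
Proof.
by move=> [cu bu]; split=> [k x|k x]; [exact: cu|rewrite -(mulrA A) -exprS; exact: bu].
Qed.

Theorem bernstein_iter u A B S k : 0 <= A -> 0 <= B -> expchain B A u -> L2bound (u 0%N) S ->
  L2bound (u k) (bernC B ^+ k * S).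
Proof.
move=> A0 B0; elim: k u A S A0 => [|k IH] u A S A0 eu uS; first by rewrite expr0 mul1r.
rewrite exprSr -mulrA.
exact: (IH (fun k => u k.+1) (A * B) _ (mulr_ge0 A0 B0) (expchain_shift eu) (bernstein A0 B0 eu uS)).
Qed.

End Bernstein.

(** * Local estimates by Lagrange interpolation *)

Section Interpolation.
Variable R : realType.
Implicit Types (x y a b c d L M : R) (u v g : nat -> R -> R) (f : R -> R).

(** Between consecutive zeros of [g 0] lies a zero of [g 1]; the induction then passes to the
    shifted chain. *)
Lemma rolle_chain g n (z : nat -> R) : chain g ->
  (forall i, (i < n)%N -> z i < z i.+1) -> (forall i, (i <= n)%N -> g 0%N (z i) = 0) ->
  exists2 xi, z 0%N <= xi <= z n & g n xi = 0.
Proof.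
elim: n g z => [|n IH] g z cg zi gz; first by exists (z 0%N); rewrite ?lexx// gz.
have mid i : exists y, (i <= n)%N -> z i < y < z i.+1 /\ g 1%N y = 0.
  have [i_n|ni] := leqP i n; last by exists 0.
  have [|y] := @MVT R (g 0%N) (g 1%N) (z i) (z i.+1) (zi i i_n) (fun x _ => cg 0%N x).
    by apply: continuous_subspaceT; exact: is_derive_continuous (cg 0%N).
  rewrite in_itv /= => yz; rewrite !gz ?subrr//; last exact: leqW.
  move=> /esym/eqP; rewrite mulf_eq0 subr_eq0 (gt_eqF (zi i i_n)) orbF => /eqP gy.
  by exists y.
have [y Hy] := choice mid.
have [||xi xiy gxi] := IH (fun k => g k.+1) y (fun k => cg k.+1).
- move=> i i_n; have [/andP[_ h1] _] := Hy i (ltnW i_n).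
  by have [/andP[h2 _] _] := Hy i.+1 i_n; exact: lt_trans h1 h2.
- by move=> i i_n; have [] := Hy i i_n.
exists xi => //; have [/andP[h1 _] _] := Hy 0%N isT; have [/andP[_ h2] _] := Hy n (leqnn n).
by move: xiy => /andP[h3 h4]; apply/andP; split; lra.
Qed.

Lemma horner_chain (p : {poly R}) : chain (fun k x => (p^`(k)).[x]).
Proof.
move=> k x; have H := @derivable_horner R p^`(k) x.
have -> : (p^`(k.+1)).[x] = 'D_1 (horner p^`(k)) x by rewrite -derive1E -derivE derivnS.
exact/derivableP.
Qed.

Section Nodes.
Variables (n : nat) (z : 'I_n -> R).
Hypothesis zinj : injective z.

Definition nodal : {poly R} := \prod_(i < n) ('X - (z i)%:P).

Definition nodal_off (i : 'I_n) : {poly R} := \prod_(j < n | j != i) ('X - (z j)%:P).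

Definition lagrange_interp (val : 'I_n -> R) : {poly R} :=
  \sum_(i < n) (val i / (nodal_off i).[z i]) *: nodal_off i.

Lemma size_nodal : size nodal = n.+1.
Proof. by rewrite /nodal size_prod_XsubC /index_enum -enumT size_enum_ord. Qed.

Lemma nodal_horner x : nodal.[x] = \prod_(i < n) (x - z i).
Proof. by rewrite horner_prod; apply: eq_bigr => i _; rewrite hornerXsubC. Qed.

Lemma nodal_off_horner i x : (nodal_off i).[x] = \prod_(j < n | j != i) (x - z j).
Proof. by rewrite horner_prod; apply: eq_bigr => j _; rewrite hornerXsubC. Qed.

Lemma size_nodal_off i : size (nodal_off i) = n.
Proof.
have := size_nodal; rewrite /nodal (bigD1 i) //= -/(nodal_off i).
rewrite size_monicM ?monicXsubC ?monic_neq0 ?monic_prod_XsubC// size_XsubC /=.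
by case.
Qed.

Lemma nodal_off_neq0 i : (nodal_off i).[z i] != 0.
Proof.
rewrite nodal_off_horner; apply/prodf_neq0 => j ji.
by rewrite subr_eq0; apply: contra ji => /eqP/zinj ->.
Qed.

Lemma nodal_off_eq0 i j : j != i -> (nodal_off i).[z j] = 0.
Proof. by move=> ji; rewrite nodal_off_horner (bigD1 j) //= subrr mul0r. Qed.

Lemma size_lagrange_interp val : (size (lagrange_interp val) <= n)%N.
Proof.
apply: leq_trans (size_sum _ _ _) _; apply/bigmax_leqP => i _.
by apply: leq_trans (size_scale_leq _ _) _; rewrite size_nodal_off.
Qed.

Lemma lagrange_interpE val j : (lagrange_interp val).[z j] = val j.
Proof.
rewrite horner_sum (bigD1 j) //= big1 ?addr0.
  by rewrite hornerZ divfK// nodal_off_neq0.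
by move=> i ij; rewrite eq_sym in ij; rewrite hornerZ (nodal_off_eq0 ij) mulr0.
Qed.

(** Each factor of a basis polynomial is at most L / d; the missing factor is replaced by L / d >= 1
    so that the exponent is n. *)
Lemma lagrange_interp_bound val x L d : 0 < d -> d <= L ->
  (forall i, `|x - z i| <= L) -> (forall i j, i != j -> d <= `|z i - z j|) ->
  `|(lagrange_interp val).[x]| <= (L / d) ^+ n * \sum_(i < n) `|val i|.
Proof.
move=> d0 dL xL sep; rewrite horner_sum; apply: le_trans (ler_norm_sum _ _ _) _.
rewrite mulr_sumr; apply: ler_sum => i _; rewrite hornerZ !normrM normfV.
have q1 : 1 <= L / d by rewrite ler_pdivlMr// mul1r.
have q0 : 0 <= L / d := le_trans ler01 q1.
suff B : `|(nodal_off i).[x]| / `|(nodal_off i).[z i]| <= (L / d) ^+ n.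
  by rewrite -mulrA mulrC (mulrC _^-1) ler_wpM2r.
rewrite !nodal_off_horner !normr_prod -prodf_div.
have -> : (L / d) ^+ n = \prod_(j < n) (L / d) by rewrite prodr_const card_ord.
rewrite [leRHS](bigD1 i) //= -[leLHS]mul1r; apply: ler_pM => //.
  by apply: prodr_ge0 => j _; rewrite divr_ge0.
apply: ler_prod => j ji; rewrite divr_ge0//=.
have dz : d <= `|z i - z j| by apply: sep; rewrite eq_sym.
have z0 : 0 < `|z i - z j| := lt_le_trans d0 dz.
by apply: ler_pM => //; rewrite lef_pV2 ?posrE.
Qed.

(** Subtract the multiple c of the nodal polynomial that makes the error vanish at x too: n + 1
    zeros yield a zero of the n-th derivative, which is [u n] minus c n!. *)
Lemma interp_error u x a b M : chain u -> a <= x <= b -> (forall i, a <= z i <= b) ->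
  (forall y, a <= y <= b -> `|u n y| <= M) ->
  `|u 0%N x - (lagrange_interp (fun i => u 0%N (z i))).[x]| <= M * (b - a) ^+ n / n`!%:R.
Proof.
move=> cu xab zab uM; set P := lagrange_interp _.
have ab : a <= b by move: xab => /andP[]; exact: le_trans.
have M0 : 0 <= M := le_trans (normr_ge0 _) (uM x xab).
have f0 : 0 < (n`!%:R : R) by rewrite ltr0n fact_gt0.
have [[i xi]|xz] := pselect (exists i, x = z i).
  by rewrite xi lagrange_interpE subrr normr0 divr_ge0 ?mulr_ge0 ?exprn_ge0// ?subr_ge0// ltW.
have Wx : nodal.[x] != 0.
  rewrite nodal_horner; apply/prodf_neq0 => i _; rewrite subr_eq0.
  by apply/eqP => xi; apply: xz; exists i.
pose c := (u 0%N x - P.[x]) / nodal.[x].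
pose g k y := u k y - (P^`(k)).[y] - c * (nodal^`(k)).[y].
have cg : chain g.
  move=> k y.
  exact: (isdB (isdB (cu k y) (@horner_chain P k y)) (isdZ c (@horner_chain nodal k y))).
pose s := sort <=%O (x :: [seq z i | i <- enum 'I_n]).
have us : uniq (x :: [seq z i | i <- enum 'I_n]).
  rewrite /= map_inj_uniq// enum_uniq andbT; apply/mapP => -[i _ xi].
  by apply: xz; exists i.
have ss : size s = n.+1 by rewrite size_sort /= size_map size_enum_ord.
have lts : sorted <%O s by rewrite sort_lt_sorted.
have zs y : y \in s -> y = x \/ exists i, y = z i.
  rewrite mem_sort inE => /orP[/eqP ->|/mapP[i _ ->]]; [by left|by right; exists i].
have sab y : y \in s -> a <= y <= b by move=> /zs [->|[i ->]].
have sg y : y \in s -> g 0%N y = 0.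
  move=> /zs [->|[i ->]]; rewrite /g !derivn0.
    by rewrite /c divfK// subrr.
  rewrite /P lagrange_interpE subrr sub0r nodal_horner (bigD1 i) //= subrr mul0r mulr0 oppr0//.
have [||xi xi_s gxi] := @rolle_chain g n (nth 0 s) cg.
- move=> i i_n; apply: (sorted_ltn_nth lt_trans 0 lts) => //.
    by rewrite inE ss ltnS ltnW.
  by rewrite inE ss ltnS.
- by move=> i i_n; apply: sg; rewrite mem_nth// ss ltnS.
have xiab : a <= xi <= b.
  have /andP[h1 _] : a <= nth 0 s 0 <= b by apply: sab; rewrite mem_nth// ss.
  have /andP[_ h2] : a <= nth 0 s n <= b by apply: sab; rewrite mem_nth// ss.
  by move: xi_s => /andP[h3 h4]; rewrite (le_trans h1 h3) (le_trans h4 h2).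
have Wn : (nodal^`(n)).[xi] = n`!%:R.
  have sW : (size nodal^`(n) <= 1)%N.
    apply/leq_sizeP => j j1; rewrite coef_derivn nth_default ?mul0rn//.
    by rewrite size_nodal -addn1 leq_add2l.
  rewrite (size1_polyC sW) hornerC coef_derivn addn0 ffactnn.
  have : lead_coef nodal = 1 by exact/eqP/monic_prod_XsubC.
  by rewrite /lead_coef size_nodal /= => ->.
have E : u n xi = c * n`!%:R.
  move: gxi; rewrite /g Wn (derivn_poly0 (size_lagrange_interp _)) horner0 subr0.
  by move=> /eqP; rewrite subr_eq0 => /eqP.
have -> : u 0%N x - P.[x] = c * nodal.[x] by rewrite /c divfK.
have cM : `|c| <= M / n`!%:R.
  rewrite ler_pdivlMr// -[X in _ * X](gtr0_norm f0) -normrM -E; exact: uM.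
rewrite normrM mulrAC; apply: ler_pM => //.
rewrite nodal_horner normr_prod -[X in _ ^+ X](card_ord n) -prodr_const; apply: ler_prod => i _.
rewrite normr_ge0 /= ler_norml; have := zab i; lra.
Qed.

End Nodes.

Lemma sqr_sum_le n (F : 'I_n -> R) : (\sum_(i < n) F i) ^+ 2 <= n%:R * \sum_(i < n) F i ^+ 2.
Proof.
elim: n F => [|n IH] F; first by rewrite !big_ord0 mulr0 expr0n.
rewrite !big_ord_recr /=; have := IH (fun i => F (widen_ord (leqnSn n) i)).
have Q0 : 0 <= \sum_(i < n) F (widen_ord (leqnSn n) i) ^+ 2 by apply: sumr_ge0 => i _; exact: sqr_ge0.
move: (\sum_(i < n) _) (\sum_(i < n) _) Q0 (F ord_max) => Q S Q0 t.
rewrite -natr1; have n0 : 0 <= (n%:R : R) by [].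
have [->|nn] := eqVneq (n%:R : R) 0.
  rewrite mul0r => S0; have -> : Q = 0 by apply/eqP; have := sqr_ge0 Q; nra.
  by nra.
have np : 0 < (n%:R : R) by rewrite lt_neqAle eq_sym nn.
move: (n%:R : R) np => N N0 H; have := sqr_ge0 (Q - N * t); nra.
Qed.

(** Write u = P + (u - P), square and integrate. The supremum of [u n] in the interpolation error is
    turned into L2 norms by [sobolev_pt], which is why [u n.+1] appears. *)
Lemma local_estimate u n (z : 'I_n -> R) a b d : chain u -> a < b -> 0 < d -> d <= b - a ->
  (forall i, a <= z i <= b) -> (forall i j, i != j -> d <= `|z i - z j|) ->
  RI a b (fun x => u 0%N x ^+ 2) <=
    2 * (b - a) * ((b - a) / d) ^+ n ^+ 2 * n%:R * (\sum_(i < n) u 0%N (z i) ^+ 2) +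
    4 * ((b - a) ^+ n / n`!%:R) ^+ 2 *
      (RI a b (fun x => u n x ^+ 2) + (b - a) ^+ 2 * RI a b (fun x => u n.+1 x ^+ 2)).
Proof.
move=> cu ab d0 dab zab sep; set L := b - a.
have L0 : 0 < L by rewrite subr_gt0.
have zinj : injective z.
  move=> i j zij; apply/eqP/negPn/negP => ij.
  by have := sep i j ij; rewrite zij subrr normr0 leNgt d0.
set U := RI a b (fun x => u n x ^+ 2); set U' := RI a b (fun x => u n.+1 x ^+ 2).
have U0 : 0 <= U by apply: RI_ge0 => x _; exact: sqr_ge0.
have U'0 : 0 <= U' by apply: RI_ge0 => x _; exact: sqr_ge0.
set M2 := 2 / L * U + 2 * L * U'.
have M20 : 0 <= M2 by rewrite addr_ge0// mulr_ge0// ?divr_ge0// ?mulr_ge0// ltW.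
have uM y : a <= y <= b -> `|u n y| <= Num.sqrt M2.
  move=> yab; rewrite -sqrtr_sqr ler_wsqrtr//.
  by apply: sobolev_pt => //; exact: chain_cont.
set s1 := \sum_(i < n) `|u 0%N (z i)|; set s2 := \sum_(i < n) u 0%N (z i) ^+ 2.
set q := (L / d) ^+ n; set r := L ^+ n / n`!%:R.
have pt x : a <= x <= b -> u 0%N x ^+ 2 <= 2 * q ^+ 2 * (n%:R * s2) + 2 * r ^+ 2 * M2.
  move=> xab; have e1 := interp_error zinj cu xab zab uM.
  have e2 := @lagrange_interp_bound n z (fun i => u 0%N (z i)) x L d d0 dab _ sep.
  have {}e2 := e2 ltac:(move=> i; have := zab i; rewrite ler_norml /L; lra).
  rewrite -/L -mulrA -/r in e1; rewrite -/q -/s1 in e2.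
  have e3 : s1 ^+ 2 <= n%:R * s2.
    apply: le_trans (sqr_sum_le _) _; rewrite le_eqVlt; apply/orP; left; apply/eqP.
    by congr (_ * _); apply: eq_bigr => i _; rewrite real_normK ?num_real.
  set p := (lagrange_interp _ _).[x] in e1 e2.
  have h1 : (u 0%N x - p) ^+ 2 <= M2 * r ^+ 2.
    rewrite -(real_normK (num_real (u 0%N x - p))) -(sqr_sqrtr M20) -exprMn.
    by rewrite lerXn2r ?nnegrE// (le_trans _ e1).
  have h2 : p ^+ 2 <= q ^+ 2 * (n%:R * s2).
    rewrite -(real_normK (num_real p)); apply: (@le_trans _ _ ((q * s1) ^+ 2)).
      by rewrite lerXn2r ?nnegrE// (le_trans _ e2).
    by rewrite exprMn ler_wpM2l// sqr_ge0.
  have := sqr_ge0 (u 0%N x - p - p); move: (u 0%N x) h1 => t; nra.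
have cu0 := chain_cont (k := 0) cu.
apply: le_trans (RI_le _ (@continuous_cst R _) pt) _; first by cont.
rewrite RI_cst ?(ltW ab)// -/L /M2 le_eqVlt; apply/orP; left; apply/eqP.
by field; rewrite gt_eqF.
Qed.

(** From n^n / n! <= e^n and n >= 4 e L K one gets (4 K L)^n / n! <= 1; the surplus 4^n, squared,
    absorbs the polynomial factors. The bound 1/4 leaves S / 2 in [lower_sampling]. *)
Lemma error_small K L n : 1 <= K -> 0 < L -> (2 <= n)%N -> 4 * expR 1 * L * K <= n%:R ->
  4 * (L ^+ n / n`!%:R) ^+ 2 * (K ^+ n + L ^+ 2 * K ^+ n.+1) <= 4^-1.
Proof.
move=> K1 L0 n2 LK; have K0 : 0 < K by lra.
have n0 : 0 < (n%:R : R) by rewrite ltr0n ltnW.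
have f0 : 0 < (n`!%:R : R) by rewrite ltr0n fact_gt0.
have E0 := expR_gt0 (1 : R); have E1 : 1 <= expR 1 :> R by rewrite -expR0 ler_expR.
have nf : (n%:R : R) ^+ n / n`!%:R <= expR 1 ^+ n.
  rewrite -expRM_natl mulr1; case: n n2 {LK n0 f0} => // n _.
  by apply: le_trans (expR_ge1Dxn n (ler0n R n.+1)); rewrite lerDr.
have h1 : (4 * K * L) ^+ n / n`!%:R <= 1.
  have h : (expR 1 * (4 * K * L)) ^+ n <= n%:R ^+ n.
    apply: lerXn2r; rewrite ?nnegrE ?mulr_ge0 ?(ltW n0) ?(ltW E0) ?(ltW K0) ?(ltW L0)//.
    by apply: le_trans LK; rewrite le_eqVlt; apply/orP; left; apply/eqP; ring.
  rewrite exprMn in h; have En : 0 < expR 1 ^+ n :> R by rewrite exprn_gt0.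
  rewrite -(ler_pM2l En) mulr1 mulrA; apply: le_trans nf.
  by rewrite ler_wpM2r// invr_ge0 ltW.
set r := L ^+ n / n`!%:R.
have r0 : 0 < r by rewrite divr_gt0// exprn_gt0.
have h2 : (4 * K) ^+ n * r <= 1 by rewrite /r mulrA -exprMn.
have Ln : L <= n%:R.
  apply: le_trans LK; rewrite (_ : 4 * _ * L * K = L * (4 * expR 1 * K)); last ring.
  rewrite ler_peMr// ?(ltW L0)//.
  have : 1 <= expR 1 * K by rewrite -[X in X <= _]mulr1 ler_pM//.
  lra.
have Kn : 1 <= K ^+ n by exact: exprn_ege1.
have Kn1 : K ^+ n.+1 <= K ^+ n * K ^+ n.
  by rewrite exprSr ler_wpM2l ?exprn_ge0 ?(ltW K0)// -[leLHS]expr1 ler_weXn2l// ltnW.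
have L2 : L ^+ 2 <= n%:R ^+ 2.
  by apply: lerXn2r => //; rewrite nnegrE ltW.
have four : 16 * (1 + n%:R ^+ 2) <= (4 : R) ^+ n * 4 ^+ n.
  rewrite -exprMn (_ : 4 * 4 = 16 :> R); last ring.
  rewrite -natrX -[1 + _]/(1%:R + _) -natrD -natrM -natrX ler_nat.
  clear -n2; elim: n n2 => // -[//|[//|n]] IH _; have := IH isT; rewrite [(16 ^ n.+3)%N]expnS.
  move: (16 ^ n.+2)%N => X; lia.
rewrite exprMn in h2.
have a0 : 0 < 4 ^+ n :> R by rewrite exprn_gt0.
set a := 4 ^+ n in h2 four a0 *; set k := K ^+ n in h2 Kn Kn1 *.
have k0 : 0 < k by lra.
have h3 : (a * k * r) ^+ 2 <= 1.
  by apply: exprn_ile1 => //; exact: mulr_ge0 (mulr_ge0 (ltW a0) (ltW k0)) (ltW r0).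
apply: (@le_trans _ _ (4 * r ^+ 2 * (k * k * (1 + n%:R ^+ 2)))).
  apply: ler_wpM2l; first by rewrite mulr_ge0// sqr_ge0.
  have : L ^+ 2 * K ^+ n.+1 <= n%:R ^+ 2 * (k * k).
    by apply: ler_pM => //; rewrite ?sqr_ge0// exprn_ge0// ltW.
  have : k <= k * k by rewrite ler_peMl// ltW.
  move: (n%:R ^+ 2) => N2; nra.
have N20 : 0 <= (n%:R : R) ^+ 2 by rewrite sqr_ge0.
have kr0 : 0 <= (k * r) ^+ 2 by rewrite sqr_ge0.
have : 16 * (1 + n%:R ^+ 2) * (k * r) ^+ 2 <= 1.
  apply: le_trans h3; rewrite (_ : (a * k * r) ^+ 2 = a * a * (k * r) ^+ 2); last ring.
  by rewrite ler_wpM2r.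
rewrite (_ : 4 * r ^+ 2 * _ = 16 * (1 + n%:R ^+ 2) * (k * r) ^+ 2 / 4); first lra.
by field.
Qed.

End Interpolation.

(** * Squared norms as integrals, and integrals over tilings *)

Section MeasureBridge.
Variable R : realType.
Local Notation RT := (measurableTypeR R).
Implicit Types (mu : {measure set RT -> \bar R}) (f : R[i] -> R[i]) (g : R -> R) (a b c L : R).
Local Notation "x %:C" := (real_complex R x).

Lemma L2norm_sqr mu f : (L2norm mu f `^ 2 = \int[mu]_x (cabs (f x%:C) ^+ 2)%:E)%E.
Proof.
rewrite /L2norm poweR_Lnorm//; apply: eq_integral => x _.
by rewrite /restr_abs /= ger0_norm// powR_mulrn.
Qed.

Lemma L2norm_ge0 mu f : (0 <= L2norm mu f)%E.
Proof. exact: Lnorm_ge0. Qed.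

Lemma poweR_sqrtK (x : \bar R) : (0 <= x)%E -> ((x `^ 2) `^ (2^-1) = x)%E.
Proof. by move=> x0; rewrite -poweRrM divff ?poweRe1// pnatr_eq0. Qed.

Lemma le_sqr_ereal (x y : \bar R) : (0 <= x)%E -> (0 <= y)%E -> (x `^ 2 <= y `^ 2)%E = (x <= y)%E.
Proof.
move=> x0 y0; have I (z : \bar R) : (0 <= z)%E -> z \in `[0%E, +oo%E].
  by move=> z0; rewrite in_itv /= z0 leey.
apply/idP/idP => h; last by apply: gt0_ler_poweR => //; exact: I.
by rewrite -(poweR_sqrtK x0) -(poweR_sqrtK y0); apply: gt0_ler_poweR => //; apply: I; exact: poweR_ge0.
Qed.

Lemma le_L2norm mu (nu : {measure set RT -> \bar R}) f (g : R[i] -> R[i]) (C : R) : 0 <= C ->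
  (C%:E * L2norm mu f <= L2norm nu g)%E =
  ((C ^+ 2)%:E * \int[mu]_x (cabs (f x%:C) ^+ 2)%:E <= \int[nu]_x (cabs (g x%:C) ^+ 2)%:E)%E.
Proof.
move=> C0; rewrite -le_sqr_ereal ?mule_ge0 ?L2norm_ge0 ?lee_fin//.
by rewrite poweRM ?L2norm_ge0 ?lee_fin// !L2norm_sqr /= powR_mulrn.
Qed.

Lemma le_L2normr mu (nu : {measure set RT -> \bar R}) f (g : R[i] -> R[i]) (C : R) : 0 <= C ->
  (L2norm mu f <= C%:E * L2norm nu g)%E =
  (\int[mu]_x (cabs (f x%:C) ^+ 2)%:E <= (C ^+ 2)%:E * \int[nu]_x (cabs (g x%:C) ^+ 2)%:E)%E.
Proof.
move=> C0; rewrite -le_sqr_ereal ?mule_ge0 ?L2norm_ge0 ?lee_fin//.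
by rewrite poweRM ?L2norm_ge0 ?lee_fin// !L2norm_sqr /= powR_mulrn.
Qed.

Lemma L2norm_lty mu f : (L2norm mu f < +oo)%E = (\int[mu]_x (cabs (f x%:C) ^+ 2)%:E < +oo)%E.
Proof.
rewrite -L2norm_sqr; have := L2norm_ge0 mu f; case: (L2norm mu f) => [r|//|//] r0.
  by rewrite poweR_EFin !ltry.
  by rewrite poweRyr ?ltxx ?pnatr_eq0.
Qed.

Lemma continuous_mfun (A : set RT) g : continuous g -> measurable_fun A (EFin \o g).
Proof.
move=> cg; apply/measurable_EFinP; apply: (@measurable_funTS _ _ _ _ A g).
exact: continuous_measurable_fun.
Qed.

Local Notation leb := (@lebesgue_measure R).

Lemma int_ge0 mu (A : set RT) g : (forall x, 0 <= g x) -> (0 <= \int[mu]_(x in A) (g x)%:E)%E.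
Proof. by move=> g0; apply: integral_ge0 => x _; rewrite lee_fin. Qed.

Lemma int_subset mu (A B : set RT) g : measurable A -> measurable B -> continuous g ->
  (forall x, 0 <= g x) -> A `<=` B ->
  (\int[mu]_(x in A) (g x)%:E <= \int[mu]_(x in B) (g x)%:E)%E.
Proof.
move=> mA mB cg g0 AB; apply: ge0_subset_integral => //; first exact: continuous_mfun.
by move=> x _; rewrite lee_fin.
Qed.

Lemma int_bound mu (A : set RT) g c : measurable A -> continuous g ->
  (forall x, 0 <= g x) -> (forall x, A x -> g x <= c) ->
  (\int[mu]_(x in A) (g x)%:E <= c%:E * mu A)%E.
Proof.
move=> mA cg g0 gc; rewrite -integral_cst//; apply: ge0_le_integral => //.
- by move=> x _; rewrite lee_fin.
- exact: continuous_mfun.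
Qed.

Lemma int_lower mu (A : set RT) g c : measurable A -> continuous g -> 0 <= c ->
  (forall x, 0 <= g x) -> (forall x, A x -> c <= g x) ->
  (c%:E * mu A <= \int[mu]_(x in A) (g x)%:E)%E.
Proof.
move=> mA cg c0 g0 gc; rewrite -integral_cst//; apply: ge0_le_integral => //.
- exact: continuous_mfun.
Qed.

(** Monotone convergence along symmetric intervals; the parameter L makes them unions of cells of a
    tiling. *)
Lemma int_exhaust mu g L X : 0 < L -> continuous g -> (forall x, 0 <= g x) ->
  (forall n : nat, (\int[mu]_(x in `[(- (n%:R * L))%R, (n%:R * L)%R[) (g x)%:E <= X)%E) ->
  (\int[mu]_x (g x)%:E <= X)%E.
Proof.
move=> L0 cg g0 H; pose F (n : nat) : set RT := `[(- (n%:R * L))%R, (n%:R * L)%R[%classic.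
have FT : \bigcup_i F i = setT.
  apply/seteqP; split=> // x _.
  have h : 0 <= `|x| / L by rewrite divr_ge0// ltW.
  exists (Num.bound (`|x| / L)) => //; rewrite /F /= in_itv /=.
  have := archi_boundP h; rewrite ltr_pdivrMr// ltr_norml => /andP[h1 h2].
  by rewrite ltW.
have cv : (\int[mu]_(x in F i) (g x)%:E)%E @[i --> \oo] --> (\int[mu]_(x in \bigcup_i F i) (g x)%:E)%E.
  apply: ge0_nondecreasing_set_cvg_integral.
  - move=> m n mn; apply/subsetPset => x; rewrite /F /= !in_itv /= => /andP[h1 h2].
    have mnL : m%:R * L <= n%:R * L by rewrite ler_pM2r// ler_nat.
    by apply/andP; split; [apply: le_trans h1; rewrite lerN2|apply: lt_le_trans mnL].
  - by move=> i; exact: measurable_itv.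
  - by move=> i; exact: continuous_mfun.
  - by move=> i x _; rewrite lee_fin.
rewrite FT in cv; rewrite -(cvg_lim _ cv)//; apply: lime_le; first by apply/cvg_ex; eexists; exact: cv.
exact: nearW.
Qed.

Lemma int_partition mu g a L n : 0 < L -> continuous g -> (forall x, 0 <= g x) ->
  (\int[mu]_(x in `[a, (a + n%:R * L)%R[) (g x)%:E =
   \sum_(j < n) \int[mu]_(x in `[(a + j%:R * L)%R, (a + j.+1%:R * L)%R[) (g x)%:E)%E.
Proof.
move=> L0 cg g0; elim: n => [|n IH].
  by rewrite big_ord0 mul0r addr0 set_itvco0 integral_set0.
have aL : a <= a + n%:R * L by rewrite lerDl mulr_ge0// ltW.
have nL : a + n%:R * L <= a + n.+1%:R * L by rewrite lerD2l ler_pM2r// ler_nat.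
rewrite big_ord_recr /= -IH -ge0_integral_setU //=.
- congr (integral _ _ _); apply/seteqP; split=> x /=; rewrite !in_itv /=.
    by move=> /andP[-> ->]; rewrite andbT /= (ltNge x); case: (leP (a + n%:R * L) x) => _; [right|left].
  move=> [/andP[h1 h2]|/andP[h1 h2]]; first by rewrite h1 (lt_le_trans h2 nL).
  by rewrite h2 (le_trans aL h1).
- exact: continuous_mfun.
- by move=> x _; rewrite lee_fin.
- rewrite disj_set2E; apply/eqP; rewrite -subset0 => x /= [].
  by rewrite !in_itv /= => /andP[_ h1] /andP[h2 _]; move: (lt_le_trans h1 h2); rewrite ltxx.
Qed.

Lemma RI_partition g a L n : 0 < L -> continuous g ->
  RI a (a + n%:R * L) g = \sum_(j < n) RI (a + j%:R * L) (a + j.+1%:R * L) g.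
Proof.
move=> L0 cg; elim: n => [|n IH].
  by rewrite big_ord0 mul0r addr0 /RI set_itv1 Rintegral_set1.
rewrite big_ord_recr /= -IH -RI_split// ?lerDl ?mulr_ge0 ?(ltW L0)//.
by rewrite lerD2l ler_pM2r// ler_nat.
Qed.

Lemma leb_RI a b g : continuous g -> (\int[leb]_(x in `[a, b]) (g x)%:E = (RI a b g)%:E)%E.
Proof.
move=> cg; rewrite /RI /Rintegral fineK//; apply: integrable_fin_num => //.
exact: RI_integrable.
Qed.

Lemma RI_le_int g a b (S : R) : continuous g -> (forall x, 0 <= g x) ->
  (\int[leb]_x (g x)%:E <= S%:E)%E -> RI a b g <= S.
Proof.
move=> cg g0 gS; rewrite -lee_fin -leb_RI//; apply: le_trans gS.
exact: (@int_subset leb).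
Qed.

Lemma int_le_RI g (S : R) : continuous g -> (forall x, 0 <= g x) ->
  (forall a b, a <= b -> RI a b g <= S) -> (\int[leb]_x (g x)%:E <= S%:E)%E.
Proof.
move=> cg g0 gS; apply: (@int_exhaust leb g 1) => // n; rewrite mulr1.
apply: (@le_trans _ _ (\int[leb]_(x in `[(- n%:R)%R, n%:R%R]) (g x)%:E)%E).
  by apply: (@int_subset leb) => //; exact: subset_itv_co_cc.
rewrite leb_RI// lee_fin; apply: gS; have : 0 <= (n%:R : R) by []; lra.
Qed.

End MeasureBridge.

(** * Massive intervals and sufficiency *)

Section Nodes.
Variable R : realType.
Local Notation RT := (measurableTypeR R).
Implicit Types (mu : {measure set RT -> \bar R}) (l I : set R) (a b c L delta t : R).

(** Such a set is an open interval plus at most two end points. *)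
Lemma interval_measurable l a b : interval_ab l a b -> measurable (l : set RT).
Proof.
move=> [ab [h1 h2]].
have sing (x : R) : measurable (l `&` [set x] : set RT).
  have [lx|lx] := pselect (l x).
    by rewrite (_ : _ `&` _ = [set x]) //; apply/seteqP; split=> y /= => [[]|->].
  rewrite (_ : _ `&` _ = set0) //; apply/seteqP; split=> y //= [ly yx].
  by apply: lx; rewrite -yx.
have -> : l = (`]a, b[ `|` (l `&` [set a])) `|` (l `&` [set b]).
  apply/seteqP; split=> x.
    move=> lx; have := h2 x lx; rewrite /= in_itv /= => /andP[ax xb].
    have [xa|xa] := eqVneq x a; first by left; right.
    have [xb'|xb'] := eqVneq x b; first by right.
    by left; left; rewrite /= in_itv /= !lt_neqAle eq_sym xa ax xb' xb.
  by move=> [[/h1//|[]//]|[]//].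
apply: measurableU; [apply: measurableU|] => //; exact: sing.
Qed.

Lemma disjoint_ordered l l' a b a' b' : interval_ab l a b -> interval_ab l' a' b' ->
  a < b -> a' < b' -> l `&` l' = set0 -> b <= a' \/ b' <= a.
Proof.
move=> [_ [h1 _]] [_ [h2 _]] ab ab' ll.
have [|ba] := leP b a'; first by left.
have [|b'a] := leP b' a; first by right.
exfalso; pose p := Num.max a a'; pose q := Num.min b b'.
have pq : p < q by rewrite /p /q lt_min !gt_max ab ba b'a ab'.
have [pa pa'] : a <= p /\ a' <= p by rewrite /p !le_max !lexx orbT.
have [qb qb'] : q <= b /\ q <= b' by rewrite /q !ge_min !lexx orbT.
suff : (l `&` l') ((p + q) / 2) by rewrite ll.
by split; [apply: h1|apply: h2]; rewrite /= in_itv /=; lra.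
Qed.

Lemma sort_intervals m (a b : nat -> R) delta : 0 < delta ->
  (forall i, (i < m)%N -> delta <= b i - a i) ->
  (forall i j, (i < m)%N -> (j < m)%N -> i != j -> b i <= a j \/ b j <= a i) ->
  exists s : nat -> nat, (forall k, (k < m)%N -> (s k < m)%N) /\
    (forall k k', (k < k')%N -> (k' < m)%N -> b (s k) <= a (s k')).
Proof.
move=> d0 ab sep; pose e : rel nat := fun i j => a i <= a j.
pose s := sort e (iota 0 m).
have sz : size s = m by rewrite size_sort size_iota.
have sm k : (k < m)%N -> (nth 0 s k < m)%N.
  by move=> km; have := mem_nth 0%N (_ : (k < size s)%N); rewrite sz mem_sort mem_iota add0n; apply.
exists (nth 0%N s); split=> // k; elim=> [//|k' IH] kk' k'm.
have st : sorted e s by apply: sort_sorted => x y; exact: le_total.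
have e1 : e (nth 0%N s k') (nth 0%N s k'.+1) by apply: (sortedP 0%N st); rewrite sz.
have ne : nth 0%N s k' != nth 0%N s k'.+1.
  by rewrite nth_uniq ?sz ?sort_uniq ?iota_uniq//; [rewrite neq_ltn ltnSn|exact: ltnW].
have a1 := ab _ (sm _ (ltnW k'm)); have a2 := ab _ (sm _ k'm).
have step : b (nth 0%N s k') <= a (nth 0%N s k'.+1).
  by case: (sep _ _ (sm _ (ltnW k'm)) (sm _ k'm) ne) => // h; rewrite /e in e1; lra.
move: kk'; rewrite ltnS leq_eqVlt => /predU1P[->//|kk'].
by have := IH kk' (ltnW k'm); lra.
Qed.

(** Capacity is a supremum, possibly infinite, so an actual family is extracted at the cost of 1. *)
Lemma capacity_family mu delta I t : 0 < t -> (t%:E <= capacity mu delta I)%E ->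
  exists m (l : nat -> set R), [/\ t - 1 < m%:R,
    (forall i, (i < m)%N -> massive mu delta (l i) /\ l i `&` I !=set0) &
    (forall i j, (i < j)%N -> (j < m)%N -> l i `&` l j = set0)].
Proof.
move=> t0 tc; have : ((t - 1)%:E < capacity mu delta I)%E.
  by apply: lt_le_trans tc; rewrite lte_fin ltrBlDr ltrDl.
move=> /ereal_sup_gt [_ [m [l [h1 h2]] <-]]; rewrite lte_fin => tm.
by exists m, l.
Qed.

(* Among the massive intervals met by [c, c + L], sorted from left to right, every
   other one is kept, so that points chosen in the kept ones are [delta]-separated. *)
Lemma interval_nodes mu delta c L N (w : R -> R) : 0 < delta -> 0 < L -> continuous w ->
  (forall x, 0 <= w x) ->
  ((2 * N%:R + 3)%:E <= capacity mu delta `[c, (c + L)%R])%E ->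
  exists z : 'I_N -> R, [/\ (forall i, c <= z i <= c + L),
    (forall i j, i != j -> delta <= `|z i - z j|) &
    (forall i, ((delta * w (z i))%:E <= \int[mu]_(x in `[c, (c + L)%R[) (w x)%:E)%E)].
Proof.
move=> d0 L0 cw w0 /capacity_family[|m [l [mN ml dl]]].
  by rewrite ltr_wpDl// mulr_ge0.
have {}mN : (2 * N + 2 < m)%N by rewrite -(ltr_nat R) natrD natrM; lra.
have dat i : exists ab : R * R, (i < m)%N ->
    [/\ interval_ab (l i) ab.1 ab.2, (delta%:E <= mu (l i))%E & delta <= ab.2 - ab.1].
  have [im|im] := ltnP i m; last by exists (0, 0).
  by have [[a [b [h1 [h2 h3]]]] _] := ml i im; exists (a, b).
have [ab Hab] := choice dat.
pose a i := (ab i).1; pose b i := (ab i).2.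
have Hd i : (i < m)%N -> delta <= b i - a i by move=> /Hab[].
have dl' i j : (i < m)%N -> (j < m)%N -> i != j -> l i `&` l j = set0.
  move=> im jm; rewrite neq_ltn => /orP[ij|ji]; first exact: dl.
  by rewrite setIC; exact: dl.
have [|s [sm so]] := sort_intervals d0 Hd.
  move=> i j im jm ij; have [h1 _ _] := Hab i im; have [h2 _ _] := Hab j jm.
  have e1 := Hd i im; have e2 := Hd j jm.
  by apply: disjoint_ordered h1 h2 _ _ (dl' i j im jm ij); rewrite -/(a _) -/(b _); lra.
have meet i : (i < m)%N -> a i <= c + L /\ c <= b i.
  move=> im; have [_ [x [lx xI]]] := ml i im; have [[_ [_ h]] _ _] := Hab i im.
  by have := h x lx; move: xI; rewrite /= !in_itv /= -/(a i) -/(b i); lra.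
(* The node of an interval is a minimum point of w on its closure, so that delta * w there is at
   most the integral of w over the interval. *)
have minw i : exists x, (i < m)%N -> a i <= x <= b i /\ forall y, a i <= y <= b i -> w x <= w y.
  have [im|im] := ltnP i m; last by exists 0.
  have abi : a i <= b i by have := Hd i im; lra.
  have [x xab Hx] := EVT_min abi (continuous_subspaceT cw).
  by exists x => _; rewrite in_itv /= in xab; split=> // y yab; apply: Hx; rewrite in_itv.
have [x Hx] := choice minw.
(* Odd positions: the interval at position 0 may stick out on the left, and two more intervals to
   the right of a kept one force it to end before c + L. *)
pose k (i : 'I_N) := (2 * i + 1)%N.
have km (i : 'I_N) : (k i + 2 < m)%N by have := ltn_ord i; rewrite /k; lia.
have km' (i : 'I_N) : (k i < m)%N by apply: leq_trans (km i); rewrite ltnS leq_addr.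
have km1 (i : 'I_N) : ((k i).+1 < m)%N by apply: leq_trans (km i); rewrite addn2.
have inI (i : 'I_N) : c <= a (s (k i)) /\ b (s (k i)) < c + L.
  split.
    have [_ h] := meet _ (sm 0%N (leq_ltn_trans (leq0n _) (km' i))).
    by apply: le_trans h _; apply: so => //; rewrite /k addn1.
  have [h _] := meet _ (sm _ (km i)).
  have h1 := so (k i) (k i).+1 (ltnSn _) (km1 i).
  have h2 := so (k i).+1 (k i + 2)%N ltac:(by rewrite addn2) (km i).
  have h3 := Hd _ (sm _ (km1 i)); lra.
exists (fun i => x (s (k i))); split.
- by move=> i; have [h1 h2] := inI i; have [h3 _] := Hx _ (sm _ (km' i)); lra.
- have S (i j : 'I_N) : (i < j)%N -> delta <= x (s (k j)) - x (s (k i)).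
    move=> ij; have [h1 _] := Hx _ (sm _ (km' i)); have [h2 _] := Hx _ (sm _ (km' j)).
    have h3 := so (k i) (k i).+1 (ltnSn _) (km1 i).
    have h4 := so (k i).+1 (k j) ltac:(rewrite /k; lia) (km' j).
    have h5 := Hd _ (sm _ (km1 i)); lra.
  move=> i j; rewrite neq_ltn => /orP[ij|ji].
    by rewrite distrC; apply: le_trans (S _ _ ij) (ler_norm _).
  by apply: le_trans (S _ _ ji) (ler_norm _).
- move=> i; have [h1 h2] := inI i; have [h3 h4] := Hx _ (sm _ (km' i)).
  have [li dm _] := Hab _ (sm _ (km' i)).
  have [_ [_ lab]] := li.
  have sub : l (s (k i)) `<=` `[c, c + L[.
    by move=> y /lab; rewrite /= !in_itv /= -/(a _) -/(b _) => /andP[h5 h6]; apply/andP; split; lra.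
  have w1 y : l (s (k i)) y -> w (x (s (k i))) <= w y.
    by move=> /lab; rewrite /= in_itv /= => /h4.
  have ml' := interval_measurable li.
  apply: le_trans (int_subset mu ml' (measurable_itv _) cw w0 sub).
  apply: le_trans (int_lower mu ml' cw (w0 _) w0 w1).
  by rewrite EFinM muleC; apply: lee_wpmul2l; rewrite ?lee_fin.
Qed.
End Nodes.

(** * Upper and lower sampling inequalities *)

Section Sufficiency.
Variable R : realType.
Local Notation RT := (measurableTypeR R).
Local Notation leb := (@lebesgue_measure R).
Implicit Types (mu : {measure set RT -> \bar R}) (f : R[i] -> R[i]) (u v : nat -> R -> R) (a b c L : R).
Local Notation "x %:C" := (real_complex R x).

Lemma exp_type_growth a f : exp_type_le a f -> exists2 A : R, 0 <= A & growth (a + 1) A f.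
Proof.
move=> /(_ 1 ltr01) [A HA]; exists A => //.
have := HA 0; rewrite cabs0 mulr0 expR0 mulr1; apply: le_trans; exact: cabs_ge0.
Qed.

Lemma L2bound_of_int (w g : R -> R) (S : R) : continuous w -> continuous g ->
  (forall x, g x ^+ 2 <= w x) ->
  (forall a b, a <= b -> RI a b w <= S) -> L2bound g S.
Proof.
move=> cw cg gw H a b ab; apply: le_trans (H a b ab); apply: RI_le => //.
exact: continuous_sqr.
Qed.

Lemma PW_chains a f : 0 < a -> PW a f -> exists u v (A S : R),
  [/\ 0 <= A, expchain (chainB (a + 1)) A u, expchain (chainB (a + 1)) A v &
    [/\ forall x, f x%:C = (u 0%N x +i* v 0%N x)%C,
      (\int[leb]_x (u 0%N x ^+ 2 + v 0%N x ^+ 2)%:E = S%:E)%E,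
      L2bound (u 0%N) S & L2bound (v 0%N) S]].
Proof.
move=> a0 [ef [tf l2f]]; have [A A0 gf] := exp_type_growth tf.
have a1 : 0 < a + 1 by lra.
have [u [v [fE eu ev]]] := entire_chains a1 A0 ef gf.
have cu := chain_cont (k := 0) eu.1; have cv := chain_cont (k := 0) ev.1.
have cw : continuous (fun x => u 0%N x ^+ 2 + v 0%N x ^+ 2) by cont.
have w0 x : 0 <= u 0%N x ^+ 2 + v 0%N x ^+ 2 by rewrite addr_ge0 ?sqr_ge0.
have fw x : cabs (f x%:C) ^+ 2 = u 0%N x ^+ 2 + v 0%N x ^+ 2 by rewrite fE cabs_sqr.
move: l2f; rewrite L2norm_lty; under eq_integral do rewrite fw.
move=> lty; have ge := int_ge0 leb setT w0.
exists u, v, (2 * A * expR (a + 1)), (fine (\int[leb]_x (u 0%N x ^+ 2 + v 0%N x ^+ 2)%:E)%E).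
have SE : (\int[leb]_x (u 0%N x ^+ 2 + v 0%N x ^+ 2)%:E)%E =
    (fine (\int[leb]_x (u 0%N x ^+ 2 + v 0%N x ^+ 2)%:E)%E)%:E.
  by rewrite fineK// ge0_fin_numE.
have RS b c : b <= c -> RI b c (fun x => u 0%N x ^+ 2 + v 0%N x ^+ 2) <=
    fine (\int[leb]_x (u 0%N x ^+ 2 + v 0%N x ^+ 2)%:E)%E.
  by move=> _; apply: RI_le_int => //; rewrite -SE.
split=> //; first by rewrite !mulr_ge0 ?expR_ge0.
split=> //.
- by apply: L2bound_of_int cw cu _ RS => x; rewrite lerDl sqr_ge0.
- by apply: L2bound_of_int cw cv _ RS => x; rewrite lerDr sqr_ge0.
Qed.

Lemma chainB_gt0 (b : R) : 0 < b -> 0 < chainB b.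
Proof. by move=> b0; rewrite mulr_gt0// expR_gt0. Qed.

Lemma bernC_ge1 (B : R) : 1 <= bernC B.
Proof. by rewrite /bernC; have := sqr_ge0 (4 * expR B * (B + 2)); lra. Qed.

(** Condition (i) concerns open intervals; a second one, shifted by 1/2, covers the left end
    point. *)
Lemma unit_mass mu (M : R) : (forall x : R, (mu [set` `]x, (x + 1)%R[%classic] <= M%:E)%E) ->
  forall a, (mu `[a, (a + 1)%R[%classic <= (2 * M)%:E)%E.
Proof.
move=> HM a; set A1 : set RT := `]a, (a + 1)%R[%classic.
set A2 : set RT := `](a - 1/2)%R, (a - 1/2 + 1)%R[%classic.
have m1 : (mu A1 <= M%:E)%E.
  by have := HM a; rewrite (_ : [set` _] = A1)//; apply/seteqP; split=> y; rewrite /= inE.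
have m2 : (mu A2 <= M%:E)%E.
  by have := HM (a - 1/2); rewrite (_ : [set` _] = A2)//; apply/seteqP; split=> y; rewrite /= inE.
have sub : `[a, (a + 1)%R[ `<=` A1 `|` A2.
  move=> y; rewrite /A1 /A2 /= !in_itv /= => /andP[h1 h2].
  have [->|ya] := eqVneq y a; first by right; lra.
  by left; rewrite h2 andbT lt_neqAle eq_sym ya.
have mA1 : measurable A1 by exact: measurable_itv.
have mA2 : measurable A2 by exact: measurable_itv.
apply: (@le_trans _ _ (mu (A1 `|` A2))).
  by apply: le_measure => //; rewrite inE//; exact: measurableU.
apply: le_trans (measureU2 mu mA1 mA2) _.
by rewrite mulr_natl mulr2n EFinD; exact: leeD.
Qed.

(** On each unit cell [sobolev_pt] bounds the supremum of g^2 and D bounds the mass; the cell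
    integrals then add up to global ones. *)
Lemma upper_sampling mu (D : R) (g g' : R -> R) (S S' : R) : 0 <= D ->
  (forall a, (mu `[a, (a + 1)%R[%classic <= D%:E)%E) ->
  (forall x : R, is_derive x 1 g (g' x)) -> continuous g' -> L2bound g S -> L2bound g' S' ->
  (\int[mu]_x (g x ^+ 2)%:E <= (2 * D * (S + S'))%:E)%E.
Proof.
move=> D0 HD dg cg' gS gS'; have cg := is_derive_continuous dg.
have cg2 := continuous_sqr cg; have cg'2 := continuous_sqr cg'.
apply: (int_exhaust (L := 1)) => // [x|n]; first exact: sqr_ge0.
have e0 : - n%:R + (2 * n)%N%:R * 1 = n%:R :> R by rewrite mulr1 natrM; ring.
rewrite mulr1 -[X in `[_, X[]e0.
rewrite int_partition//; last by move=> x; exact: sqr_ge0.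
set a := - n%:R : R.
pose r (h : R -> R) (j : nat) := RI (a + j%:R * 1) (a + j.+1%:R * 1) h.
apply: (@le_trans _ _ (\sum_(j < (2 * n)%N) (2 * D * (r (fun x => g x ^+ 2)%R j + r (fun x => g' x ^+ 2)%R j))%:E)%E).
  apply: lee_sum => j _.
  have e1 : a + j.+1%:R * 1 = a + j%:R * 1 + 1 by rewrite -natr1; ring.
  set p := a + j%:R * 1 in e1 *; rewrite e1.
  have pp : p < p + 1 by lra.
  have H := @int_bound _ mu `[p, (p + 1)%R[ (fun x => g x ^+ 2)%R
    (2 * (r (fun x => g x ^+ 2)%R j + r (fun x => g' x ^+ 2)%R j)) (measurable_itv _) cg2.
  apply: le_trans (H _ _) _.
  - by move=> x; exact: sqr_ge0.
  - move=> x; rewrite /= in_itv /= => /andP[h1 /ltW h2].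
    have := sobolev_pt pp _ dg cg'; rewrite /r -/p e1 => /(_ x); rewrite h1 h2 => /(_ isT).
    by rewrite (_ : p + 1 - p = 1) ?divr1 ?mulr1 ?mulrDr//; ring.
  have DE (y : R) : 2 * D * y = 2 * y * D by ring.
  rewrite DE [leRHS]EFinM; apply: lee_wpmul2l; last exact: HD.
  by rewrite lee_fin mulr_ge0// addr_ge0// RI_ge0// => x _; exact: sqr_ge0.
rewrite sumEFin lee_fin -mulr_sumr ler_wpM2l ?mulr_ge0// big_split /=.
have aa : a <= a + (2 * n)%N%:R * 1 by rewrite mulr1 lerDl.
by rewrite /r -!RI_partition//; apply: lerD; [exact: gS|exact: gS'].
Qed.

(** The nodes are chosen for the weight u^2 + v^2, so the same ones serve real and imaginary part.
    Each node is compared with the integral over the whole interval, whence N / delta. *)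
Lemma lower_local mu delta c L (K : R) N u v : 0 < delta -> 0 < L -> delta <= L ->
  chain u -> chain v ->
  ((2 * N%:R + 3)%:E <= capacity mu delta `[c, (c + L)%R])%E ->
  ((RI c (c + L) (fun x => u 0%N x ^+ 2 + v 0%N x ^+ 2))%:E <=
   (2 * L * (L / delta) ^+ N ^+ 2 * N%:R * (N%:R / delta))%:E *
     \int[mu]_(x in `[c, (c + L)%R[) (u 0%N x ^+ 2 + v 0%N x ^+ 2)%:E +
   (4 * (L ^+ N / N`!%:R) ^+ 2 *
     (RI c (c + L) (fun x => u N x ^+ 2) + RI c (c + L) (fun x => v N x ^+ 2) +
      L ^+ 2 * (RI c (c + L) (fun x => u N.+1 x ^+ 2) + RI c (c + L) (fun x => v N.+1 x ^+ 2))))%:E)%E.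
Proof.
move=> d0 L0 dL cu cv cap.
have cu0 := chain_cont (k := 0) cu; have cv0 := chain_cont (k := 0) cv.
have cw : continuous (fun x => u 0%N x ^+ 2 + v 0%N x ^+ 2) by cont.
have w0 x : 0 <= u 0%N x ^+ 2 + v 0%N x ^+ 2 by rewrite addr_ge0 ?sqr_ge0.
have [z [zc zs zw]] := interval_nodes d0 L0 cw w0 cap.
have cL : c < c + L by rewrite ltrDl.
have cLc : c + L - c = L by ring.
have dL' : delta <= c + L - c by rewrite cLc.
have hu := local_estimate cu cL d0 dL' zc zs.
have hv := local_estimate cv cL d0 dL' zc zs.
rewrite cLc in hu hv.
set X := (\int[mu]_(x in _) _)%E in zw *.
have X0 : (0 <= X)%E by apply: int_ge0.
set e := 4 * _ ^+ 2 in hu hv *; set q := 2 * L * _ * _ in hu hv *.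
have q0 : 0 <= q := mulr_ge0 (mulr_ge0 (mulr_ge0 (ler0n R 2) (ltW L0)) (sqr_ge0 _)) (ler0n R N).
set s := \sum_(i < N) (u 0%N (z i) ^+ 2 + v 0%N (z i) ^+ 2).
have sX : (s%:E <= (N%:R / delta)%:E * X)%E.
  have : ((delta * s)%:E <= N%:R%:E * X)%E.
    rewrite /s mulr_sumr -sumEFin; apply: le_trans (lee_sum _ (fun i _ => zw i)) _.
    elim: (N) => [|k IH]; first by rewrite big_ord0 mul0e.
    rewrite big_ord_recr /= -natr1 EFinD ge0_muleDl ?lee_fin// mul1e; exact: leeD.
  have di : (0%:E <= (delta^-1)%:E)%E by rewrite lee_fin invr_ge0 ltW.
  move=> /(lee_wpmul2l di); rewrite -EFinM mulrA mulVf ?gt_eqF// mul1r => /le_trans; apply.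
  by rewrite muleA -EFinM (mulrC delta^-1).
rewrite RI_D; [|by cont|by cont].
apply: (@le_trans _ _ ((q * s)%:E + (e * (RI c (c + L) (fun x => u N x ^+ 2) + RI c (c + L) (fun x => v N x ^+ 2) +
      L ^+ 2 * (RI c (c + L) (fun x => u N.+1 x ^+ 2) + RI c (c + L) (fun x => v N.+1 x ^+ 2))))%:E)%E).
  rewrite -EFinD lee_fin; apply: le_trans (lerD hu hv) _.
  rewrite /s big_split /= le_eqVlt; apply/orP; left; apply/eqP; ring.
rewrite leeD2r// EFinM [(q * (_ / _))%:E]EFinM -muleA; exact: lee_wpmul2l.
Qed.

(** Origin of the density 8 e K + 9: N is the integer part of 4 e L K plus 3, so 2N + 3 <= 8 e L K +
    9 <= t L since L >= 1. *)
Lemma capacity_nodes (t K L : R) : 1 <= K -> 1 <= L -> 8 * expR 1 * K + 9 <= t ->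
  exists N, [/\ (2 <= N)%N, 4 * expR 1 * L * K <= N%:R & 2 * N%:R + 3 <= t * L].
Proof.
move=> K1 L1 tK; have E0 := expR_gt0 (1 : R).
have h0 : 0 <= 4 * expR 1 * L * K by rewrite !mulr_ge0//; lra.
exists ((Num.truncn (4 * expR 1 * L * K)).+3); split=> //.
  apply: ltW; apply: lt_le_trans (truncnS_gt _) _.
  by rewrite ler_nat; do 2! apply: leqW.
have := truncn_le (4 * expR 1 * L * K); rewrite h0 => h1.
have : (8 * expR 1 * K + 9) * L <= t * L by rewrite ler_wpM2r//; lra.
rewrite -[(_.+3)%N]addn3 natrD; nra.
Qed.

Lemma lower_sampling mu (B t L0 delta : R) : 0 < B -> 0 < L0 -> 0 < delta ->
  8 * expR 1 * bernC B + 9 <= t ->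
  (forall (I : set R) (a b : R), interval_ab I a b -> L0 <= b - a ->
        ((t * (b - a))%:E <= capacity mu delta I)%E) ->
  exists2 C : R, 0 < C & forall u v (A S X : R), 0 <= A -> expchain B A u -> expchain B A v ->
    (\int[leb]_x (u 0%N x ^+ 2 + v 0%N x ^+ 2)%:E = S%:E)%E ->
    L2bound (u 0%N) S -> L2bound (v 0%N) S ->
    (\int[mu]_x (u 0%N x ^+ 2 + v 0%N x ^+ 2)%:E = X%:E)%E -> S <= C * X.
Proof.
move=> B0 L00 d0 tK cap; set K := bernC B in tK.
have K1 : 1 <= K by exact: bernC_ge1.
(* At least L0 for the density hypothesis, at least 1 for [capacity_nodes], at least delta for
   [lower_local]. *)
pose L := L0 + 1 + delta.
have L1 : 1 <= L by rewrite /L; lra.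
have [N [N2 LN Nt]] := capacity_nodes K1 L1 tK.
have Lp : 0 < L by lra.
have dL : delta <= L by rewrite /L; lra.
set Q := 2 * L * (L / delta) ^+ N ^+ 2 * N%:R * (N%:R / delta).
have Q0 : 0 <= Q := mulr_ge0 (mulr_ge0 (mulr_ge0 (mulr_ge0 (ler0n R 2) (ltW Lp)) (sqr_ge0 _))
  (ler0n R N)) (divr_ge0 (ler0n R N) (ltW d0)).
exists (2 * Q + 1); first lra.
move=> u v A S X A0 eu ev uvS uS vS uvX; have [cu bu] := eu; have [cv bv] := ev.
have cu0 := chain_cont (k := 0) cu; have cv0 := chain_cont (k := 0) cv.
have cw : continuous (fun x => u 0%N x ^+ 2 + v 0%N x ^+ 2) by cont.
have w0 x : 0 <= u 0%N x ^+ 2 + v 0%N x ^+ 2 by rewrite addr_ge0 ?sqr_ge0.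
have X0 : 0 <= X by rewrite -lee_fin -uvX; exact: int_ge0.
have S0 := L2bound_ge0 uS.
have capc c : ((2 * N%:R + 3)%:E <= capacity mu delta `[c, (c + L)%R])%E.
  apply: le_trans (cap _ c (c + L) _ _).
  - by rewrite lee_fin (_ : c + L - c = L)//; ring.
  - split; first lra.
    by split=> // x /=; rewrite !in_itv /= => /andP[/ltW -> /ltW ->].
  - by rewrite /L; lra.
have B0' := ltW B0.
have uN k := bernstein_iter k A0 B0' eu uS; have vN k := bernstein_iter k A0 B0' ev vS.
have small := error_small K1 Lp N2 LN.
suff H : (\int[leb]_x (u 0%N x ^+ 2 + v 0%N x ^+ 2)%:E <= (Q * X + S / 2)%:E)%E.
  by move: H; rewrite uvS lee_fin; lra.
apply: (int_exhaust (L := L)) => // n.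
pose a := - (n%:R * L).
have e1 : n%:R * L = a + (2 * n)%N%:R * L by rewrite /a natrM; ring.
have aa : a <= a + (2 * n)%N%:R * L by rewrite lerDl mulr_ge0// ltW.
apply: (@le_trans _ _ (\int[leb]_(x in `[a, (a + (2 * n)%N%:R * L)%R]) (u 0%N x ^+ 2 + v 0%N x ^+ 2)%:E)%E).
  by apply: (@int_subset _ leb) => //; rewrite -e1; exact: subset_itv_co_cc.
rewrite leb_RI// RI_partition// -sumEFin.
pose r (h : R -> R) (j : nat) := RI (a + j%:R * L) (a + j.+1%:R * L) h.
pose y (j : nat) := (\int[mu]_(x in `[(a + j%:R * L)%R, (a + j.+1%:R * L)%R[) (u 0%N x ^+ 2 + v 0%N x ^+ 2)%:E)%E.
set e := 4 * (L ^+ N / N`!%:R) ^+ 2 in small.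
apply: (@le_trans _ _ (\sum_(j < (2 * n)%N) (Q%:E * y j + (e *
   (r (fun x => u N x ^+ 2) j + r (fun x => v N x ^+ 2) j +
      L ^+ 2 * (r (fun x => u N.+1 x ^+ 2) j + r (fun x => v N.+1 x ^+ 2) j)))%:E))%E).
  apply: lee_sum => j _.
  have e2 : a + j.+1%:R * L = a + j%:R * L + L by rewrite -natr1; ring.
  rewrite /y /r e2; exact: lower_local.
rewrite big_split /= sumEFin EFinD; apply: leeD.
  rewrite -ge0_sume_distrr; last by move=> j _; exact: int_ge0.
  rewrite /y -int_partition// [leRHS]EFinM; apply: lee_wpmul2l => //.
  by rewrite -uvX; apply: int_subset.
rewrite lee_fin -mulr_sumr !big_split /= -mulr_sumr big_split /=.
have csq k : continuous (fun x => u k x ^+ 2) by apply: continuous_sqr; exact: chain_cont.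
have csq' k : continuous (fun x => v k x ^+ 2) by apply: continuous_sqr; exact: chain_cont.
rewrite /r -!RI_partition//.
have h1 := uN N _ _ aa; have h2 := vN N _ _ aa; have h3 := uN N.+1 _ _ aa; have h4 := vN N.+1 _ _ aa.
have e0 : 0 <= e by rewrite mulr_ge0// sqr_ge0.
rewrite -/K in h1 h2 h3 h4.
apply: (@le_trans _ _ (e * (2 * (K ^+ N + L ^+ 2 * K ^+ N.+1) * S))).
  apply: ler_wpM2l => //.
  have L20 : 0 <= L ^+ 2 by rewrite sqr_ge0.
  have := ler_wpM2l L20 (lerD h3 h4); move: h1 h2; lra.
rewrite (_ : e * _ = e * (K ^+ N + L ^+ 2 * K ^+ N.+1) * (2 * S)); last ring.
have := ler_wpM2r (_ : 0 <= 2 * S) small; rewrite mulr_ge0// => /(_ isT); lra.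
Qed.

Theorem sampling_of_massive mu :
  (exists M : R, forall x : R, (mu [set` `]x, (x + 1)%R[%classic] <= M%:E)%E) ->
  (forall t : R, 0 < t -> exists L delta : R, 0 < L /\ 0 < delta /\
      forall (I : set R) (a b : R), interval_ab I a b -> L <= b - a ->
        ((t * (b - a))%:E <= capacity mu delta I)%E) ->
  PW_sampling mu.
Proof.
move=> [M HM] cap a a0; have a1 : 0 < a + 1 by lra.
have HD := unit_mass HM.
have M0 : 0 <= 2 * M by rewrite -lee_fin; apply: le_trans (HD 0); exact: measure_ge0.
set B := chainB (a + 1); have B0 : 0 < B by exact: chainB_gt0.
set K := bernC B; have K1 : 1 <= K by exact: bernC_ge1.
have E0 := expR_gt0 (1 : R).
have t0 : 0 < 8 * expR 1 * K + 9 by rewrite ltr_wpDl// !mulr_ge0//; lra.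
have [L [delta [L0 [d0 Hcap]]]] := cap _ t0.
have [C C0 HC] := lower_sampling B0 L0 d0 (lexx _) Hcap.
have D0 : 0 <= 2 * (2 * M) * (1 + K) by rewrite !mulr_ge0//; lra.
(* The summand 1 gives C1 <= C1^2, since the norms are compared through their squares. *)
pose C1 := 1 + C + 2 * (2 * (2 * M) * (1 + K)).
have C11 : 1 <= C1 by rewrite /C1; lra.
have C1p : 0 < C1 by lra.
have C1s : C1 <= C1 ^+ 2 by rewrite expr2 ler_peMr// ltW.
exists C1; split=> // f fPW.
have [u [v [A [S [A0 eu ev [fE SE uS vS]]]]]] := PW_chains a0 fPW.
have [cu bu] := eu; have [cv bv] := ev.
have cu0 := chain_cont (k := 0) cu; have cv0 := chain_cont (k := 0) cv.
have cu1 := chain_cont (k := 1) cu; have cv1 := chain_cont (k := 1) cv.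
have cw : continuous (fun x => u 0%N x ^+ 2 + v 0%N x ^+ 2) by cont.
have w0 x : 0 <= u 0%N x ^+ 2 + v 0%N x ^+ 2 by rewrite addr_ge0 ?sqr_ge0.
have fw x : cabs (f x%:C) ^+ 2 = u 0%N x ^+ 2 + v 0%N x ^+ 2 by rewrite fE cabs_sqr.
have Ef (nu : {measure set RT -> \bar R}) : (\int[nu]_x (cabs (f x%:C) ^+ 2)%:E =
    \int[nu]_x (u 0%N x ^+ 2 + v 0%N x ^+ 2)%:E)%E.
  by apply: eq_integral => x _; rewrite fw.
have S0 := L2bound_ge0 uS.
have uS1 := bernstein A0 (ltW B0) eu uS; have vS1 := bernstein A0 (ltW B0) ev vS.
rewrite -/K in uS1 vS1.
have up : (\int[mu]_x (u 0%N x ^+ 2 + v 0%N x ^+ 2)%:E <= (2 * (2 * (2 * M) * (1 + K)) * S)%:E)%E.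
  under eq_integral do rewrite EFinD.
  rewrite ge0_integralD //=; last 4 first.
  - by move=> x _; rewrite lee_fin sqr_ge0.
  - by apply: continuous_mfun; exact: continuous_sqr.
  - by move=> x _; rewrite lee_fin sqr_ge0.
  - by apply: continuous_mfun; exact: continuous_sqr.
  have h1 := upper_sampling M0 HD (cu 0%N) cu1 uS uS1.
  have h2 := upper_sampling M0 HD (cv 0%N) cv1 vS vS1.
  apply: le_trans (leeD h1 h2) _; rewrite -EFinD lee_fin.
  by rewrite le_eqVlt; apply/orP; left; apply/eqP; ring.
have X0 : (0 <= \int[mu]_x (u 0%N x ^+ 2 + v 0%N x ^+ 2)%:E)%E by exact: int_ge0.
have XE : (\int[mu]_x (u 0%N x ^+ 2 + v 0%N x ^+ 2)%:E)%E =
    (fine (\int[mu]_x (u 0%N x ^+ 2 + v 0%N x ^+ 2)%:E)%E)%:E.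
  by rewrite fineK// ge0_fin_numE// (le_lt_trans up)// ltry.
split.
  rewrite le_L2norm ?invr_ge0 ?(ltW C1p)// !Ef SE XE -EFinM lee_fin.
  have := HC _ _ _ _ _ A0 eu ev SE uS vS XE; set X := fine _ => SX.
  have Xp : 0 <= X by rewrite -lee_fin -XE.
  rewrite exprVn mulrC ler_pdivrMr ?exprn_gt0//.
  apply: le_trans SX _; rewrite mulrC; apply: ler_wpM2l => //.
  by apply: le_trans C1s; rewrite /C1; lra.
rewrite le_L2normr ?(ltW C1p)// !Ef SE -EFinM; apply: le_trans up _.
rewrite lee_fin; apply: ler_wpM2r => //; apply: le_trans C1s; rewrite /C1; lra.
Qed.

End Sufficiency.

(** * The sinc kernel and necessity *)

Section Sinc.
Variable R : realType.
Local Notation RT := (measurableTypeR R).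
Local Notation leb := (@lebesgue_measure R).
Implicit Types (mu : {measure set RT -> \bar R}) (f : R[i] -> R[i]) (z w h : R[i]) (a b p x y : R) (g : R -> R).
Local Notation "x %:C" := (real_complex R x).

Definition csin z : R[i] := (cexp ('i%C * z) - cexp (- ('i%C * z))) / (2 * 'i%C).

Lemma i_neq0 : ('i%C : R[i]) != 0.
Proof. by rewrite -cabs_gt0 -[X in cabs X]mulr1 (cabs_i (1 : R)) normr1. Qed.

Lemma cabs_iM z : cabs ('i%C * z) = cabs z.
Proof. by rewrite cabsM -[X in cabs X * _]mulr1 (cabs_i (1 : R)) normr1 mul1r. Qed.

Lemma cabs_nat n : cabs (n%:R : R[i]) = n%:R.
Proof. by rewrite -(rmorph_nat (real_complex R)) cabs_real normr_nat. Qed.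

Lemma csin_cder z : exists l, cder csin z l.
Proof.
have d1 : cder (fun w => 'i%C * w) z ('i%C * 1) by apply: cderZ; exact: cder_id.
have d2 := cder_comp d1 (cder_cexp ('i%C * z)).
have d3 := cder_comp d1 (cder_cexpN ('i%C * z)).
have d4 := cderZ (2 * 'i%C)^-1 (cderD d2 (cderZ (-1) d3)).
have -> : @csin = fun w => (2 * 'i%C)^-1 * (cexp ('i%C * w) + -1 * cexp (- ('i%C * w))).
  by apply/funext => w; rewrite /csin mulN1r mulrC.
by eexists; exact: d4.
Qed.

Lemma csin_real x : csin x%:C = (sin x)%:C.
Proof.
have re : cRe ('i%C * x%:C) = 0 by rewrite /=; ring.
have im : cIm ('i%C * x%:C) = x by rewrite /=; ring.
have E : cexp ('i%C * x%:C) = (cos x +i* sin x)%C by rewrite /cexp re im expR0 !mul1r.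
have E' : cexp (- ('i%C * x%:C)) = (cos x +i* (- sin x))%C.
  by rewrite /cexp cReN cImN re im oppr0 expR0 !mul1r cosN sinN.
rewrite /csin E E'; apply: (mulIf (_ : 2 * 'i%C != 0 :> R[i])).
  by rewrite mulf_neq0 ?i_neq0// pnatr_eq0.
rewrite divfK ?mulf_neq0 ?i_neq0 ?pnatr_eq0//.
have -> : (2 : R[i]) = (2 +i* 0)%C by apply: complex_eqP => /=; rewrite ?addr0.
by apply: complex_eqP => /=; ring.
Qed.

Lemma csin_growth z : cabs (csin z) <= expR (cabs z).
Proof.
rewrite /csin cabsM cabsV cabsM cabs_nat -[X in 2 * cabs X]mulr1 (cabs_i (1 : R)) normr1 mulr1.
rewrite ler_pdivrMr//; apply: le_trans (cabsB _ _) _; rewrite !cabs_cexp mulr_natr mulr2n.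
apply: lerD; rewrite ler_expR; apply: le_trans (ler_norm _) _.
  by apply: le_trans (Re_le_cabs _) _; rewrite cabs_iM.
by apply: le_trans (Re_le_cabs _) _; rewrite cabsN cabs_iM.
Qed.

(** The constant and quadratic terms of exp(ih) and exp(-ih) cancel in the difference. *)
Lemma csin_taylor : exists2 K : R, 0 < K & forall h, cabs h <= 1 -> cabs (csin h - h) <= K * cabs h ^+ 3.
Proof.
have [K K0 HK] := cexp_taylor2 R; exists K => // h h1.
have H1 := HK ('i%C * h); have H2 := HK (- ('i%C * h)).
rewrite !cabsN !cabs_iM in H1 H2; have {}H1 := H1 h1; have {}H2 := H2 h1.
set r1 := _ - _ / 2 in H1; set r2 := _ - _ / 2 in H2.
have -> : csin h - h = (r1 - r2) / (2 * 'i%C).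
  by rewrite /csin /r1 /r2; field; rewrite i_neq0.
rewrite cabsM cabsV cabsM cabs_nat -[X in 2 * cabs X]mulr1 (cabs_i (1 : R)) normr1 mulr1.
by rewrite ler_pdivrMr//; apply: le_trans (cabsB _ _) _; lra.
Qed.

Definition sinc z : R[i] := if z == 0 then 1 else csin z / z.

Lemma sinc_cder z : exists l, cder sinc z l.
Proof.
have [->|z0] := eqVneq z 0; last first.
  have [l dl] := csin_cder z.
  eexists; apply: cder_near (cderM dl (cder_inv z0)).
  exists (cabs z); first by rewrite cabs_gt0.
  move=> h hz; rewrite /sinc ifN//; apply: contraTN hz => /eqP zh.
  by rewrite -leNgt -(cabsN h) -(addrK h z) zh sub0r lexx.
have [K K0 HK] := csin_taylor.
exists 0 => e e0; exists (Num.min 1 (e / K)); first by rewrite lt_min ltr01 divr_gt0.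
move=> h; rewrite lt_min ltr_pdivlMr// => /andP[h1 h2].
rewrite add0r mul0r subr0 /sinc eqxx.
have [->|h0] := eqVneq h 0; first by rewrite subrr cabs0 mulr0.
have hp : 0 < cabs h by rewrite cabs_gt0.
have -> : csin h / h - 1 = (csin h - h) / h by field.
rewrite cabsM cabsV ler_pdivrMr//; apply: le_trans (HK h (ltW h1)) _.
move: (cabs h) hp h2 => r r0 rK {h1}.
rewrite (_ : K * r ^+ 3 = (r * K) * (r * r)); last ring.
by rewrite -(mulrA e); apply: ler_wpM2r; [exact: mulr_ge0 (ltW r0) (ltW r0)|exact: ltW].
Qed.

Lemma sinc_growth : exists2 A : R, 0 <= A & growth 1 A sinc.
Proof.
have [K K0 HK] := csin_taylor; exists (1 + K); first lra.
move=> z; rewrite mul1r /sinc; have e1 : 1 <= expR (cabs z) by rewrite -expR0 ler_expR.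
have [_|z0] := eqVneq z 0; first by rewrite cabs1; nra.
have zp : 0 < cabs z by rewrite cabs_gt0.
rewrite cabsM cabsV ler_pdivrMr//; have [z1|z1] := leP (cabs z) 1.
  have h1 := HK z z1; have := cabsD (csin z - z) z; rewrite subrK.
  move: (cabs z) (cabs (csin z)) (expR _) zp z1 h1 e1 => r s e r0 r1 h1 e1.
  have h2 : r ^+ 3 <= r by rewrite exprS ler_piMr ?(ltW r0)// exprn_ile1 ?(ltW r0).
  have h3 : K * r ^+ 3 <= K * r by rewrite ler_pM2l.
  have h4 : (1 + K) * r <= (1 + K) * e * r by rewrite -mulrA ler_pM2l ?ler_peMl ?(ltW r0)//; lra.
  lra.
apply: le_trans (csin_growth z) _; move: (expR _) e1 => e e1.
have : e * 1 <= e * cabs z by rewrite ler_pM2l; [exact: ltW|lra].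
have : 0 <= K * (e * cabs z) by rewrite !mulr_ge0// ?(ltW K0)//; lra.
rewrite mulr1; lra.
Qed.

Definition sincR x : R := if x == 0 then 1 else sin x / x.

Lemma sinc_real x : sinc x%:C = (sincR x)%:C.
Proof.
rewrite /sinc /sincR -(rmorph0 (real_complex R)) (inj_eq (@complexI R)).
by case: eqP => // _; rewrite csin_real -fmorphV -rmorphM.
Qed.

Lemma sincR_le1 x : `|sincR x| <= 1.
Proof.
rewrite /sincR; case: eqVneq => [_|x0]; first by rewrite normr1.
by rewrite normrM normfV ler_pdivrMr ?normr_gt0// mul1r sin_le_norm.
Qed.

Lemma sincR_decay x : x != 0 -> `|sincR x| <= `|x|^-1.
Proof.
move=> x0; rewrite /sincR (negbTE x0) normrM normfV ler_piMl ?invr_ge0//; exact: sin_max.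
Qed.

(** A majorant with the explicit primitive 2 atan, so that the L2 norm of sinc is bounded without
    being computed. *)
Lemma sincR_sqr_le x : sincR x ^+ 2 <= 2 * (1 + x ^+ 2)^-1.
Proof.
have p : 0 < 1 + x ^+ 2 by rewrite ltr_pwDl// sqr_ge0.
rewrite ler_pdivlMr// mulrDr mulr1 (_ : 2 = 1 + 1 :> R)//; apply: lerD.
  by rewrite -(real_normK (num_real (sincR x))) exprn_ile1// sincR_le1.
rewrite /sincR; case: eqVneq => [->|x0]; first by rewrite expr0n mulr0.
rewrite -exprMn divfK// -(real_normK (num_real (sin x))) exprn_ile1//; exact: sin_max.
Qed.

Lemma sincR_lower x : 0 < x < 1 -> cos 1 <= sincR x.
Proof.
move=> /andP[x0 x1]; rewrite /sincR gt_eqF// ler_pdivlMr//.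
have [|c] := @MVT R sin cos 0 x x0 (fun y _ => is_derive_sin y).
  exact: continuous_subspaceT (@continuous_sin R).
rewrite in_itv /= sin0 !subr0 => /andP[c0 cx] ->; rewrite ler_pM2r//.
have pi2 := @pi_ge2 R.
by apply: ltW; rewrite ltr_cos ?in_itv /=; lra.
Qed.

Lemma sinc_pi n : sincR (pi *+ n.+1) = 0.
Proof.
have sn k : sin (pi *+ k) = 0 :> R.
  by elim: k => [|k IH]; [rewrite mulr0n sin0|rewrite mulrSr sinDpi IH oppr0].
by rewrite /sincR sn mul0r; case: eqVneq => // /eqP; rewrite mulrn_eq0 /= gt_eqF// pi_gt0.
Qed.

Lemma sincRN x : sincR (- x) = sincR x.
Proof. by rewrite /sincR oppr_eq0 sinN invrN mulrNN. Qed.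

Lemma real_trace_continuous f g : entire f -> (forall x, f x%:C = (g x)%:C) -> continuous g.
Proof.
move=> /entireP/cder_contC cf fg; have [c1 _] := contC_hor 0 cf.
rewrite (_ : g = fun x => cRe (f (x +i* 0)%C))//; apply/funext => x.
by rewrite -[(x +i* 0)%C]/(x%:C) fg.
Qed.

Lemma growth_exp_type a b A f : 0 <= A -> b <= a -> growth b A f -> exp_type_le a f.
Proof.
move=> A0 ba gf e e0; exists A => z; apply: le_trans (gf z) _.
by rewrite ler_wpM2l// ler_expR ler_wpM2r//; lra.
Qed.

Lemma PW_of_real a b A f g (S : R) : 0 <= A -> b <= a -> entire f -> growth b A f ->
  (forall x, f x%:C = (g x)%:C) -> L2bound g S -> PW a f.
Proof.
move=> A0 ba ef gf fg gS; split=> //; split; first exact: growth_exp_type gf.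
rewrite L2norm_lty; have cg := real_trace_continuous ef fg.
have fw x : cabs (f x%:C) ^+ 2 = g x ^+ 2 by rewrite fg cabs_real real_normK ?num_real.
under eq_integral do rewrite fw.
apply: le_lt_trans (int_le_RI (continuous_sqr cg) _ gS) _ => [x|]; first exact: sqr_ge0.
exact: ltry.
Qed.

Lemma entire_shift f (k p : R) : entire f -> entire (fun z => f (k%:C * (z - p%:C))).
Proof.
move=> /entireP df; apply/entireP => z; have [l dl] := df (k%:C * (z - p%:C)).
have d1 := cderZ k%:C (cderD (cder_id z) (@cder_cst _ (- p%:C) z)).
by eexists; exact: (cder_comp d1 dl).
Qed.

Lemma entireM f (g : R[i] -> R[i]) : entire f -> entire g -> entire (fun z => f z * g z).
Proof.
move=> /entireP df /entireP dg; apply/entireP => z.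
by have [l dl] := df z; have [m dm] := dg z; eexists; exact: cderM dl dm.
Qed.

Lemma growth_shift b A f (k p : R) : 0 <= A -> 0 <= b -> 0 <= k -> growth b A f ->
  growth (b * k) (A * expR (b * k * `|p|)) (fun z => f (k%:C * (z - p%:C))).
Proof.
move=> A0 b0 k0 gf z; apply: le_trans (gf _) _; rewrite -(mulrA A); apply: ler_wpM2l => //.
have h : cabs (k%:C * (z - p%:C)) <= k * (`|p| + cabs z).
  rewrite cabsM cabs_real (ger0_norm k0); apply: ler_wpM2l => //.
  by apply: le_trans (cabsB _ _) _; rewrite cabs_real addrC.
by rewrite -expRD ler_expR -mulrDr -(mulrA b); exact: ler_wpM2l.
Qed.

Lemma growthM b A f b' A' (g : R[i] -> R[i]) : 0 <= A -> growth b A f -> growth b' A' g ->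
  growth (b + b') (A * A') (fun z => f z * g z).
Proof.
move=> A0 gf gg z; rewrite cabsM mulrDl expRD mulrACA; exact: ler_pM.
Qed.

Lemma sinc_L2bound p : L2bound (fun x => sincR (x - p)) (2 * pi).
Proof.
move=> a b ab.
have es : entire (fun z => sinc ((1 : R)%:C * (z - p%:C))).
  by apply: entire_shift; apply/entireP; exact: sinc_cder.
have cs : continuous (fun x => sincR (x - p)).
  by apply: real_trace_continuous es _ => x; rewrite mul1r -rmorphB sinc_real.
have d x : is_derive x 1 (fun y => 2 * atan (y - p)) (2 * (1 + (x - p) ^+ 2)^-1).
  apply: isdZ; apply: isd_eq (isd_comp (isdB (isd_id x) (isd_cst p x)) (is_derive1_atan (x - p))) _.
  by rewrite subr0 mulr1.
have cd : continuous (fun x : R => 2 * (1 + (x - p) ^+ 2)^-1).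
  have c1 : continuous (fun x : R => x) by move=> y; exact: cvg_id.
  have c2 : continuous (fun x : R => 1 + (x - p) ^+ 2) by cont.
  apply: continuous_mul; first exact: continuous_cst.
  move=> x; apply: cvgV; last exact: c2.
  by rewrite gt_eqF// ltr_pwDl// sqr_ge0.
apply: (@le_trans _ _ (RI a b (fun x => 2 * (1 + (x - p) ^+ 2)^-1))).
  by apply: RI_le => //; [exact: continuous_sqr|move=> x _; exact: sincR_sqr_le].
rewrite (RI_ftc ab d cd); have := atan_ltpi2 (b - p); have := atan_gtNpi2 (a - p); lra.
Qed.

Lemma sinc_shift_PW p : PW 1 (fun z => sinc (1 * (z - p%:C))).
Proof.
have [A A0 gA] := sinc_growth.
apply: (PW_of_real (b := 1 * 1) (A := A * expR (1 * 1 * `|p|)) (g := fun x => sincR (x - p))).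
- by rewrite mulr_ge0// expR_ge0.
- by rewrite mulr1.
- by apply: (@entire_shift sinc 1 p); apply/entireP; exact: sinc_cder.
- exact: (@growth_shift 1 A sinc 1 p A0 ler01 ler01 gA).
- by move=> x; rewrite mul1r -rmorphB sinc_real.
- exact: sinc_L2bound.
Qed.

(** The bound is uniform in the center p; it serves for the mass of unit intervals and again in
    [outside_energy]. *)
Lemma sampling_sinc mu (C : R) p : 0 < C ->
  (forall f, PW 1 f -> (L2norm mu f <= C%:E * L2norm leb f)%E) ->
  (\int[mu]_x (sincR (x - p) ^+ 2)%:E <= (C ^+ 2 * (2 * pi))%:E)%E.
Proof.
move=> C0 /(_ _ (sinc_shift_PW p)); rewrite le_L2normr ?(ltW C0)//.
have fw x : cabs (sinc (1 * (x%:C - p%:C))) ^+ 2 = sincR (x - p) ^+ 2.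
  by rewrite mul1r -rmorphB sinc_real cabs_real real_normK ?num_real.
under eq_integral do rewrite fw; move=> /le_trans; apply.
under eq_integral do rewrite fw.
rewrite [leRHS]EFinM; apply: lee_wpmul2l; first by rewrite lee_fin sqr_ge0.
apply: int_le_RI; [|by move=> x; exact: sqr_ge0|exact: sinc_L2bound].
apply: continuous_sqr; have [es _] := sinc_shift_PW p.
by apply: real_trace_continuous es _ => x; rewrite mul1r -rmorphB sinc_real.
Qed.

Lemma sampling_unit_mass mu : PW_sampling mu ->
  exists M : R, forall x : R, (mu [set` `]x, (x + 1)%R[%classic] <= M%:E)%E.
Proof.
move=> /(_ 1 ltr01) [C [C0 HC]].
have c1 : 0 < (cos 1 : R) := cos1_gt0 R.
(* The test function is sinc centered at p, which is at least cos 1 on the interval ]p, p + 1[. *)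
exists (C ^+ 2 * (2 * pi) / cos 1 ^+ 2) => p; set A : set RT := `]p, (p + 1)%R[%classic.
rewrite (_ : [set` _] = A); last by apply/seteqP; split=> y; rewrite /= inE.
have mA : measurable A by exact: measurable_itv.
have cs : continuous (fun x => sincR (x - p)).
  have [es _] := sinc_shift_PW p.
  by apply: real_trace_continuous es _ => x; rewrite mul1r -rmorphB sinc_real.
have c2 : 0 < cos 1 ^+ 2 :> R by rewrite exprn_gt0.
have H1 : ((cos 1 ^+ 2)%:E * mu A <= (C ^+ 2 * (2 * pi))%:E)%E.
  apply: le_trans (sampling_sinc p C0 (fun f Hf => (HC f Hf).2)).
  apply: le_trans (int_subset mu mA measurableT (continuous_sqr cs) _ (@subsetT _ _)) => [|x]; last exact: sqr_ge0.
  apply: int_lower => //; [exact: continuous_sqr|exact: ltW|by move=> x; exact: sqr_ge0|].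
  move=> x; rewrite /A /= in_itv /= => hx.
  by rewrite lerXn2r ?nnegrE ?(ltW c1)//; [|]; have := @sincR_lower (x - p) ltac:(lra); lra.
have c2V : (0%:E <= (((cos 1 : R) ^+ 2)^-1)%:E)%E by rewrite lee_fin invr_ge0 ltW.
have := lee_wpmul2l c2V H1; rewrite muleA -!EFinM mulVf ?gt_eqF// mul1e.
by rewrite mulrC.
Qed.

End Sinc.

(** * Combinations of sinc products, and massive cells *)

Section Necessity.
Variable R : realType.
Local Notation RT := (measurableTypeR R).
Implicit Types (mu : {measure set RT -> \bar R}) (f : R[i] -> R[i]) (a b p x y : R) (g : R -> R).
Local Notation "x %:C" := (real_complex R x).

(** The coefficient [1%:C] gives both factors the shape required by [entire_shift] and
    [growth_shift]. *)
Definition phi (kap p : R) (z : R[i]) : R[i] := sinc (kap%:C * (z - p%:C)) * sinc (1%:C * (z - p%:C)).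

Definition phiR (kap p x : R) : R := sincR (kap * (x - p)) * sincR (x - p).

Lemma phi_real kap p x : phi kap p x%:C = (phiR kap p x)%:C.
Proof. by rewrite /phi /phiR mul1r -rmorphB /= -rmorphM !sinc_real -rmorphM. Qed.

Lemma phi_entire kap p : entire (phi kap p).
Proof. by apply: entireM; apply: entire_shift; apply/entireP; exact: sinc_cder. Qed.

Lemma phi_growth kap p : 0 <= kap -> exists2 A : R, 0 <= A & growth (kap + 1) A (phi kap p).
Proof.
move=> k0; have [A A0 gA] := sinc_growth R.
have g1 := @growth_shift R 1 A (@sinc R) kap p A0 ler01 k0 gA.
have g2 := @growth_shift R 1 A (@sinc R) 1 p A0 ler01 ler01 gA.
have A1 : 0 <= A * expR (1 * kap * `|p|) by rewrite mulr_ge0// expR_ge0.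
exists (A * expR (1 * kap * `|p|) * (A * expR (1 * 1 * `|p|))).
  by rewrite mulr_ge0// mulr_ge0// expR_ge0.
by have := growthM A1 g1 g2; rewrite !mul1r.
Qed.

Lemma phiR_sqr_le kap p x : phiR kap p x ^+ 2 <= sincR (x - p) ^+ 2.
Proof.
rewrite /phiR exprMn ler_piMl ?sqr_ge0//.
by rewrite -(real_normK (num_real (sincR _))) exprn_ile1// sincR_le1.
Qed.

Lemma phiR_continuous kap p : continuous (phiR kap p).
Proof. exact: real_trace_continuous (phi_entire kap p) (phi_real kap p). Qed.

Lemma sincR_shift_continuous p : continuous (fun x => sincR (x - p)).
Proof.
have [es _] := sinc_shift_PW p.
by apply: real_trace_continuous es _ => x; rewrite mul1r -rmorphB sinc_real.
Qed.

Lemma L2boundD g g' (S S' : R) : continuous g -> continuous g' -> L2bound g S -> L2bound g' S' ->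
  L2bound (fun x => g x + g' x) (2 * S + 2 * S').
Proof.
move=> cg cg' gS gS' a b ab.
apply: (@le_trans _ _ (RI a b (fun x => 2 * g x ^+ 2 + 2 * g' x ^+ 2))).
  by apply: RI_le; [by cont|by cont|move=> x _; have := sqr_ge0 (g x - g' x); nra].
rewrite RI_D; [|by cont|by cont].
rewrite !RI_Z; [|by cont|by cont].
by apply: lerD; rewrite ler_pM2l//; [exact: gS|exact: gS'].
Qed.

Section Combination.
Variables (kap : R) (al pt : nat -> R).
Hypothesis kap0 : 0 <= kap.

Definition comb n (z : R[i]) : R[i] := \sum_(k < n) (al k)%:C * phi kap (pt k) z.

Definition combR n x : R := \sum_(k < n) al k * phiR kap (pt k) x.

Lemma comb_real n x : comb n x%:C = (combR n x)%:C.
Proof. by rewrite rmorph_sum; apply: eq_bigr => k _; rewrite phi_real -rmorphM. Qed.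

Lemma comb_entire n : entire (comb n).
Proof.
apply/entireP => z.
have H (k : nat) : exists l, cder (fun z => (al k)%:C * phi kap (pt k) z) z l.
  have /entireP/(_ z)[l dl] := phi_entire kap (pt k).
  by exists ((al k)%:C * l); exact: cderZ.
have [l Hl] := choice H.
exists (\sum_(k < n) l k).
exact: (@cder_sum R n (fun k z => (al k)%:C * phi kap (pt k) z) z l (fun k _ => Hl k)).
Qed.

Lemma comb_growth n : exists2 A : R, 0 <= A & growth (kap + 1) A (comb n).
Proof.
elim: n => [|n [A A0 gA]].
  by exists 0 => // z; rewrite /comb big_ord0 cabs0 mul0r.
have [A' A'0 gA'] := phi_growth (pt n) kap0.
exists (A + `|al n| * A'); first by rewrite addr_ge0// mulr_ge0.
move=> z; rewrite /comb big_ord_recr /=; apply: le_trans (cabsD _ _) _.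
rewrite mulrDl; apply: lerD; first exact: gA.
by rewrite cabsM cabs_real -mulrA ler_wpM2l.
Qed.

Lemma combR_continuous n : continuous (combR n).
Proof. exact: real_trace_continuous (comb_entire n) (comb_real n). Qed.

(** Only finiteness is wanted here, to place the combination in [PW]; quantitative control comes
    from [samples_energy]. *)
Lemma combR_L2 n : exists S : R, L2bound (combR n) S.
Proof.
elim: n => [|n [S HS]].
  exists 0 => a b ab; rewrite (_ : (fun x => _) = fun=> 0) ?RI_cst ?mul0r//.
  by apply/funext => x; rewrite /combR big_ord0 expr0n.
exists (2 * S + 2 * (al n ^+ 2 * (2 * pi))).
have c1 := @phiR_continuous kap (pt n).
rewrite (_ : combR n.+1 = fun x => combR n x + al n * phiR kap (pt n) x); last first.
  by apply/funext => x; rewrite /combR big_ord_recr.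
apply: L2boundD => //; [exact: combR_continuous|by cont|].
move=> a b ab; have cs := @sincR_shift_continuous (pt n).
apply: (@le_trans _ _ (RI a b (fun x => al n ^+ 2 * sincR (x - pt n) ^+ 2))).
  apply: RI_le; [by cont|by cont|move=> x _].
  by rewrite exprMn ler_wpM2l ?sqr_ge0// phiR_sqr_le.
rewrite RI_Z; last by cont.
by rewrite ler_wpM2l ?sqr_ge0//; exact: sinc_L2bound.
Qed.

Lemma comb_PW n : PW (kap + 1) (comb n).
Proof.
have [A A0 gA] := comb_growth n; have [S HS] := combR_L2 n.
exact: PW_of_real A0 (lexx _) (comb_entire n) gA (comb_real n) HS.
Qed.

End Combination.

Lemma kernel_vector D N (M : 'M[R]_(D, N)) : (N < D)%N ->
  exists2 al : 'rV[R]_D, al != 0 & al *m M = 0.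
Proof.
move=> ND; have /rowV0Pn[v vk v0] : kermx M != 0.
  by rewrite -mxrank_eq0 mxrank_ker -lt0n subn_gt0 (leq_ltn_trans (rank_leq_col M)).
by exists v => //; apply/sub_kermxP.
Qed.

Definition cell (a h : R) (i : nat) : set RT := `[(a + i%:R * h)%R, (a + i.+1%:R * h)%R[%classic.

Definition massive_cells mu delta (a h : R) n : {set 'I_n} :=
  [set i : 'I_n | (delta%:E <= mu (cell a h i))%E].

(** Cells are half-open, hence disjoint, and delta <= h makes them long enough: the massive cells
    are an admissible family for the capacity. *)
Lemma massive_cells_capacity mu (delta : R) (I : set R) a b (h : R) n : 0 < h -> delta <= h ->
  interval_ab I a b -> n%:R * h <= b - a ->
  (#|massive_cells mu delta a h n|%:R%:E <= capacity mu delta I)%E.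
Proof.
move=> h0 dh [ab [I1 I2]] nh; set P := massive_cells _ _ _ _ _.
apply: ereal_sup_ubound; exists #|P| => //=.
pose j k : nat := nth 0%N [seq val i | i <- enum P] k.
have sz : size [seq val i | i <- enum P] = #|P| by rewrite size_map -cardE.
have jP k : (k < #|P|)%N -> exists2 i : 'I_n, i \in P & j k = i.
  move=> kP; have /(@mapP _ _ val)[i iP E] : nth 0%N [seq val i | i <- enum P] k \in [seq val i | i <- enum P].
    by rewrite mem_nth// sz.
  by exists i; [rewrite -mem_enum|exact: E].
exists (fun k => cell a h (j k)); split.
  move=> k kP; have [i iP ->] := jP k kP.
  have ih : a + i.+1%:R * h <= b.
    have : i.+1%:R * h <= n%:R * h by rewrite ler_pM2r// ler_nat.
    lra.
  have e1 : a + i.+1%:R * h = a + i%:R * h + h by rewrite -natr1; ring.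
  have ip : 0 <= i%:R * h by rewrite mulr_ge0// ltW.
  split.
    exists (a + i%:R * h), (a + i.+1%:R * h); split; last first.
      by split; [move: iP; rewrite inE|rewrite e1; lra].
    split; first by rewrite e1; lra.
    split=> x; rewrite /cell /= !in_itv /=; first by move=> /andP[/ltW -> ->].
    by move=> /andP[-> /ltW ->].
  exists (a + i%:R * h + h / 2); split.
    by rewrite /cell /= in_itv /= e1; lra.
  by apply: I1; rewrite /= in_itv /=; lra.
move=> k k' kk' k'P; have kP := ltn_trans kk' k'P.
have ne : j k != j k'.
  rewrite nth_uniq ?sz//; first by rewrite neq_ltn kk'.
  by rewrite map_inj_uniq ?enum_uniq//; exact: val_inj.
apply/seteqP; split=> // x [].
rewrite /cell /= !in_itv /= => /andP[h1 h2] /andP[h3 h4].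
have step m m' : (m < m')%N -> x < a + m.+1%:R * h -> a + m'%:R * h <= x -> False.
  move=> mm' h5 h6; have : m.+1%:R * h <= m'%:R * h by rewrite ler_pM2r// ler_nat.
  lra.
by move: ne; rewrite neq_ltn => /orP[/step|/step]; apply.
Qed.

(** On a massive cell u vanishes at the left end, so u^2 is at most h times the integral of u'^2,
    and the mass is at most D0 since h <= 1. On any other cell the mass is below delta and
    [sobolev_pt] applies. The bound is the sum of the two cases. *)
Lemma cell_energy mu (D0 delta h a : R) i (u : nat -> R -> R) : 0 <= D0 -> 0 < delta -> 0 < h -> h <= 1 ->
  (forall a, (mu `[a, (a + 1)%R[%classic <= D0%:E)%E) -> chain u ->
  ((delta%:E <= mu (cell a h i))%E -> u 0%N (a + i%:R * h) = 0) ->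
  (\int[mu]_(x in cell a h i) (u 0%N x ^+ 2)%:E <=
    ((D0 * h + 2 * h * delta) * RI (a + i%:R * h) (a + i.+1%:R * h) (fun x => u 1%N x ^+ 2) +
     2 * delta / h * RI (a + i%:R * h) (a + i.+1%:R * h) (fun x => u 0%N x ^+ 2))%:E)%E.
Proof.
move=> D00 d0 h0 h1 HD cu uz.
have e1 : a + i.+1%:R * h = a + i%:R * h + h by rewrite -natr1; ring.
have c0 := chain_cont (k := 0) cu; have c1 := chain_cont (k := 1) cu.
rewrite /cell e1; rewrite /cell e1 in uz; move: (a + i%:R * h) uz => p uz.
set U0 := RI _ _ (fun x => u 0%N x ^+ 2); set U1 := RI _ _ _.
have U00 : 0 <= U0 by apply: RI_ge0 => x _; exact: sqr_ge0.
have U10 : 0 <= U1 by apply: RI_ge0 => x _; exact: sqr_ge0.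
have mI : measurable (`[p, (p + h)%R[%classic : set RT) by exact: measurable_itv.
have bnd := fun c => @int_bound R mu _ (fun x => u 0%N x ^+ 2) c mI (continuous_sqr c0) (fun x => sqr_ge0 _).
have ph : p < p + h by lra.
have phh : p + h - p = h by ring.
have [md|] := leP delta%:E (mu (`[p, (p + h)%R[%classic : set RT)).
  apply: le_trans (bnd (h * U1) _) _.
    move=> x; rewrite /= in_itv /= => /andP[px /ltW xh].
    have := sqr_diff_le (lexx p) px xh (cu 0%N) c1.
    by rewrite (uz md) subr0 phh.
  apply: (@le_trans _ _ ((h * U1)%:E * D0%:E)%E).
    apply: lee_wpmul2l; first by rewrite lee_fin mulr_ge0// ltW.
    apply: le_trans (HD p); apply: le_measure; rewrite ?inE//.
    by apply: subset_itvl; rewrite bnd_simp; lra.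
  rewrite -EFinM lee_fin.
  have : 0 <= 2 * h * delta * U1 by rewrite !mulr_ge0// ltW.
  have : 0 <= 2 * delta / h * U0 by rewrite !mulr_ge0 ?invr_ge0// ltW.
  lra.
move=> /ltW md; apply: le_trans (bnd (2 / h * U0 + 2 * h * U1) _) _.
  move=> x; rewrite /= in_itv /= => /andP[px /ltW xh].
  have := sobolev_pt ph _ (cu 0%N) c1; rewrite phh; apply; by rewrite px xh.
have c20 : 0 <= 2 / h * U0 + 2 * h * U1.
  by rewrite addr_ge0// !mulr_ge0 ?invr_ge0// ltW.
apply: le_trans (lee_wpmul2l _ md) _; first by rewrite lee_fin.
rewrite -EFinM lee_fin.
have : 0 <= D0 * h * U1 by rewrite !mulr_ge0// ltW.
have -> : (2 / h * U0 + 2 * h * U1) * delta = 2 * h * delta * U1 + 2 * delta / h * U0 by ring.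
lra.
Qed.

End Necessity.

(** * From sampling to massive intervals *)

Section MassiveOfSampling.
Variable R : realType.
Local Notation RT := (measurableTypeR R).
Local Notation leb := (@lebesgue_measure R).
Implicit Types (mu : {measure set RT -> \bar R}) (f : R[i] -> R[i]) (a b p q x y : R) (g : R -> R).
Local Notation "x %:C" := (real_complex R x).

(** [sobolev_pt] on adjacent intervals of length 1 / T. Together with [combR_lattice] it bounds the
    coefficients of a combination by its norm. *)
Lemma samples_energy (u : nat -> R -> R) (q T S S' : R) D : 0 < T -> chain u ->
  L2bound (u 0%N) S -> L2bound (u 1%N) S' ->
  \sum_(k < D) u 0%N (q + k%:R / T) ^+ 2 <= 2 * T * S + 2 / T * S'.
Proof.
move=> T0 cu uS uS'; have V0 : 0 < T^-1 by rewrite invr_gt0.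
pose r (h : R -> R) (k : nat) := RI (q + k%:R * T^-1) (q + k.+1%:R * T^-1) h.
have c0 := continuous_sqr (chain_cont (k := 0) cu).
have c1 := continuous_sqr (chain_cont (k := 1) cu).
apply: (@le_trans _ _ (\sum_(k < D) (2 * T * r (fun x => u 0%N x ^+ 2) k + 2 / T * r (fun x => u 1%N x ^+ 2) k))).
  apply: ler_sum => k _; rewrite /r.
  have e : q + k.+1%:R * T^-1 = q + k%:R * T^-1 + T^-1 by rewrite -natr1; ring.
  rewrite e; set p := q + k%:R * T^-1.
  have pp : p < p + T^-1 by rewrite ltrDl.
  have := sobolev_pt pp _ (cu 0%N) (chain_cont (k := 1) cu).
  rewrite (_ : p + T^-1 - p = T^-1) ?invrK; last ring.
  by apply; rewrite lexx ltW.
rewrite big_split /= -!mulr_sumr /r -!RI_partition//.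
have qq : q <= q + D%:R * T^-1 by rewrite lerDl mulr_ge0// ltW.
apply: lerD; apply: ler_wpM2l; [|exact: uS| |exact: uS'].
  by rewrite mulr_ge0// ltW.
by rewrite divr_ge0// ltW.
Qed.

(** The frequency pi T puts zeros of the first sinc at all the other lattice points of step 1 /
    T. *)
Lemma phiR_lattice (T q : R) (k j : nat) : 0 < T ->
  phiR (pi * T) (q + k%:R / T) (q + j%:R / T) = (k == j)%:R.
Proof.
move=> T0; have Tn : T != 0 by rewrite gt_eqF.
rewrite /phiR; have [->|kj] := eqVneq k j.
  by rewrite subrr mulr0 /sincR eqxx mulr1.
suff -> : sincR (pi * T * (q + j%:R / T - (q + k%:R / T))) = 0 by rewrite mul0r.
have -> : pi * T * (q + j%:R / T - (q + k%:R / T)) = pi * (j%:R - k%:R).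
  by move: (pi : R) => pp; field.
move: kj; rewrite neq_ltn => /orP[kj|jk].
  have [m mE] : exists m, (j - k)%N = m.+1 by exists (j - k).-1; rewrite prednK// subn_gt0.
  by rewrite -natrB ?mE ?mulr_natr ?sinc_pi// ltnW.
have [m mE] : exists m, (k - j)%N = m.+1 by exists (k - j).-1; rewrite prednK// subn_gt0.
by rewrite -opprB mulrN sincRN -natrB ?mE ?mulr_natr ?sinc_pi// ltnW.
Qed.

Lemma combR_lattice (T q : R) (al : nat -> R) D j : 0 < T -> (j < D)%N ->
  combR (pi * T) al (fun k => q + k%:R / T) D (q + j%:R / T) = al j.
Proof.
move=> T0 jD; rewrite /combR (bigD1 (Ordinal jD)) //= phiR_lattice// eqxx mulr1.
rewrite big1 ?addr0// => k kj; rewrite phiR_lattice// (_ : (k == j :> nat) = false) ?mulr0//.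
by apply/negbTE; apply: contra kj => /eqP kj; apply/eqP/val_inj.
Qed.

(** Away from the centers the first sinc is at most 1 / (kap r), and the second is integrated
    against mu by [sampling_sinc]. Cauchy-Schwarz over the terms costs the factor D. *)
Lemma outside_energy mu (C1 kap r : R) (al pt : nat -> R) D (J : set RT) : measurable J ->
  0 < C1 -> (forall f, PW 1 f -> (L2norm mu f <= C1%:E * L2norm leb f)%E) ->
  0 < kap -> 0 < r -> (forall k x, (k < D)%N -> ~ J x -> r <= `|x - pt k|) ->
  (\int[mu]_(x in ~` J) (combR kap al pt D x ^+ 2)%:E <=
   (D%:R * (\sum_(k < D) al k ^+ 2) * (kap * r)^-1 ^+ 2 * (C1 ^+ 2 * (2 * pi)))%:E)%E.
Proof.
move=> mJ C10 HC1 k0 r0 far.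
pose c (k : nat) := D%:R * (kap * r)^-1 ^+ 2 * al k ^+ 2.
have c0 k : 0 <= c k by exact: mulr_ge0 (mulr_ge0 (ler0n _ _) (sqr_ge0 _)) (sqr_ge0 _).
pose s (k : nat) x := sincR (x - pt k) ^+ 2.
have s0 k x : 0 <= s k x by exact: sqr_ge0.
have cs k : continuous (s k) by apply: continuous_sqr; exact: sincR_shift_continuous.
have ccs k : continuous (fun x => c k * s k x) by have ck := cs k; cont.
have csum n : continuous (fun x => \sum_(k < n) c k * s k x).
  elim: n => [|n IH].
    have -> : (fun x => \sum_(k < 0) c k * s k x) = fun=> 0 by apply/funext => x; rewrite big_ord0.
    by move=> x; exact: cst_continuous.
  have -> : (fun x => \sum_(k < n.+1) c k * s k x) = fun x => \sum_(k < n) c k * s k x + c n * s n x.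
    by apply/funext => x; rewrite big_ord_recr.
  by have cn := ccs n; cont.
have sum0 n x : 0 <= \sum_(k < n) c k * s k x by apply: sumr_ge0 => k _; exact: mulr_ge0.
have cg := @combR_continuous R kap al pt D.
apply: (@le_trans _ _ (\int[mu]_(x in ~` J) (\sum_(k < D) c k * s k x)%:E)%E).
  apply: ge0_le_integral => //.
  - exact: measurableC.
  - by move=> x _; rewrite lee_fin sqr_ge0.
  - by apply: continuous_mfun; exact: continuous_sqr.
  - by apply: continuous_mfun; exact: csum.
  - move=> x Jx; rewrite lee_fin; apply: le_trans (sqr_sum_le _) _.
    rewrite mulr_sumr; apply: ler_sum => k _; rewrite /c /s exprMn.
    have rx := far k x (ltn_ord k) Jx; set y := x - pt k in rx *.
    have yp : 0 < `|y| by exact: lt_le_trans r0 rx.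
    have sy : sincR (kap * y) ^+ 2 <= (kap * r)^-1 ^+ 2.
      rewrite -(real_normK (num_real (sincR _))); apply: lerXn2r.
      + exact: normr_ge0.
      + by rewrite nnegrE invr_ge0 ltW// mulr_gt0.
      apply: le_trans (sincR_decay _) _; first by apply: mulf_neq0; [rewrite gt_eqF|rewrite -normr_gt0].
      rewrite lef_pV2 ?posrE ?mulr_gt0// normrM (gtr0_norm k0) ?ler_pM2l//.
      by rewrite mulr_gt0.
    rewrite /phiR -/y exprMn.
    have -> : D%:R * (kap * r)^-1 ^+ 2 * al k ^+ 2 * sincR y ^+ 2 =
      D%:R * (al k ^+ 2 * ((kap * r)^-1 ^+ 2 * sincR y ^+ 2)) by ring.
    do 2![apply: ler_wpM2l; first by rewrite ?sqr_ge0].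
    by apply: ler_wpM2r => //; exact: sqr_ge0.
apply: (@le_trans _ _ (\int[mu]_x (\sum_(k < D) c k * s k x)%:E)%E).
  by apply: int_subset => //; exact: measurableC.
under eq_integral do rewrite -sumEFin.
rewrite ge0_integral_sum//; last 2 first.
- by move=> k; apply: continuous_mfun.
- by move=> k x _; rewrite lee_fin mulr_ge0.
apply: (@le_trans _ _ (\sum_(k < D) (c k * (C1 ^+ 2 * (2 * pi)))%:E)%E).
  apply: lee_sum => k _; under eq_integral do rewrite EFinM.
  rewrite ge0_integralZl_EFin//; last 2 first.
  - by move=> x _; rewrite lee_fin.
  - exact: continuous_mfun.
  rewrite [leRHS]EFinM; apply: lee_wpmul2l; first by rewrite lee_fin.
  exact: sampling_sinc.
rewrite sumEFin lee_fin -mulr_suml /c -mulr_sumr le_eqVlt; apply/orP; left; apply/eqP.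
by move: (\sum_(k < D) _) (pi : R) => X pp; ring.
Qed.

Lemma inside_energy mu (D0 delta h a S S' : R) (u : nat -> R -> R) n :
  0 <= D0 -> 0 < delta -> 0 < h -> h <= 1 ->
  (forall a, (mu `[a, (a + 1)%R[%classic <= D0%:E)%E) -> chain u ->
  L2bound (u 0%N) S -> L2bound (u 1%N) S' ->
  (forall i, i \in massive_cells mu delta a h n -> u 0%N (a + i%:R * h) = 0) ->
  (\int[mu]_(x in `[a, (a + n%:R * h)%R[) (u 0%N x ^+ 2)%:E <=
    ((D0 * h + 2 * h * delta) * S' + 2 * delta / h * S)%:E)%E.
Proof.
move=> D00 d0 h0 h1 HD cu uS uS' uz.
have c0 := continuous_sqr (chain_cont (k := 0) cu).
have c1 := continuous_sqr (chain_cont (k := 1) cu).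
rewrite int_partition//; last by move=> x; exact: sqr_ge0.
pose r (g : R -> R) (j : nat) := RI (a + j%:R * h) (a + j.+1%:R * h) g.
apply: (@le_trans _ _ (\sum_(i < n) ((D0 * h + 2 * h * delta) * r (fun x => u 1%N x ^+ 2)%R i +
     2 * delta / h * r (fun x => u 0%N x ^+ 2)%R i)%:E)%E).
  apply: lee_sum => i _; apply: cell_energy => // md; apply: uz; by rewrite inE.
rewrite sumEFin lee_fin big_split /= -!mulr_sumr /r -!RI_partition//.
have aa : a <= a + n%:R * h by rewrite lerDl mulr_ge0// ltW.
apply: lerD; apply: ler_wpM2l; [|exact: uS'| |exact: uS].
  by rewrite addr_ge0// !mulr_ge0// ltW.
by rewrite !mulr_ge0 ?invr_ge0// ltW.
Qed.

Lemma vanishing_combination mu (delta h a kap : R) (pt : nat -> R) n D :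
  (#|massive_cells mu delta a h n| < D)%N ->
  exists al : nat -> R, (exists2 k, (k < D)%N & al k != 0) /\
    forall i, i \in massive_cells mu delta a h n -> combR kap al pt D (a + i%:R * h) = 0.
Proof.
set P := massive_cells _ _ _ _ _ => PD.
have [al0 alnz alM] := kernel_vector
  (\matrix_(k < D, j < #|P|) phiR kap (pt k) (a + (enum_val j)%:R * h)) PD.
(* Coefficients are extended by 0 past D, since [combR] takes a function on nat. *)
pose al (k : nat) := if insub k is Some i then al0 0 (i : 'I_D) else 0.
have alE (k : 'I_D) : al k = al0 0 k by rewrite /al valK.
exists al; split.
  have [k ak] : exists k, al0 0 k != 0.
    apply/existsP; apply: contraNT alnz => /existsPn H; apply/eqP/rowP => k.
    by have /negbNE/eqP -> := H k; rewrite mxE.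
  by exists k; rewrite ?alE.
move=> i iP; have := congr1 (fun M : 'rV_#|P| => M 0 (enum_rank_in iP i)) alM.
rewrite !mxE => H; rewrite -[RHS]H /combR; apply: eq_bigr => k _.
by rewrite alE mxE enum_rankK_in.
Qed.

Theorem massive_of_sampling mu : PW_sampling mu ->
  forall t : R, 0 < t -> exists L delta : R, 0 < L /\ 0 < delta /\
      forall (I : set R) (a b : R), interval_ab I a b -> L <= b - a ->
        ((t * (b - a))%:E <= capacity mu delta I)%E.
Proof.
move=> samp t t0; have [M HM] := sampling_unit_mass samp.
have HD := unit_mass HM; set D0 := 2 * M in HD.
have D00 : 0 <= D0 by rewrite -lee_fin; apply: le_trans (HD 0); exact: measure_ge0.
have [C1 [C10 HC1]] := samp 1 ltr01.
(* At spacing 1 / (4 t), the at most 2 t l centers fill a length of at most l / 2, the middle half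
   of I. *)
pose T := 4 * t; have T0 : 0 < T by rewrite mulr_gt0.
pose kap : R := pi * T; have kap0 : 0 < kap by rewrite mulr_gt0// pi_gt0.
have a10 : 0 < kap + 1 by lra.
(* Type 1 suffices for the upper inequality on single sinc factors; the lower inequality is applied
   to the combination, of type kap + 1. *)
have [C2 [C20 HC2]] := samp _ a10.
set B := chainB (kap + 1 + 1); have B0 : 0 < B by apply: chainB_gt0; lra.
set K := bernC B; have K1 : 1 <= K by exact: bernC_ge1.
set c2 := C2 ^+ 2; have c20 : 0 < c2 by exact: exprn_gt0.
pose E := 2 * T + 2 / T * K.
have E0 : 0 < E by rewrite addr_gt0// ?mulr_gt0// ?invr_gt0//; lra.
(* Made so that the energy outside the cells is at most (G / l) S, by [outside_energy] with distance
   l / 8 and D <= 2 t l. *)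
pose G := 256 * pi * t * C1 ^+ 2 * E / kap ^+ 2.
have G0 : 0 <= G.
  apply: divr_ge0; last exact: sqr_ge0.
  have p0 : 0 <= 256 * (pi : R) by exact: mulr_ge0 (ler0n _ _) (pi_ge0 _).
  exact: mulr_ge0 (mulr_ge0 (mulr_ge0 p0 (ltW t0)) (sqr_ge0 _)) (ltW E0).
have K0 : 0 <= K by lra.
(* The cell size h = 1 / hi makes the term from massive cells, multiplied by c2, at most S / 8. *)
pose hi := 1 + 8 * c2 * D0 * K.
have hi1 : 1 <= hi.
  by rewrite lerDl; exact: mulr_ge0 (mulr_ge0 (mulr_ge0 (ler0n _ 8) (ltW c20)) D00) K0.
pose h := hi^-1; have h0 : 0 < h by rewrite invr_gt0; lra.
have h1 : h <= 1 by rewrite invf_le1//; lra.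
(* With delta = h / ri the terms containing delta, multiplied by c2, are together at most S / 8. *)
pose ri := 1 + 16 * c2 * (K + 1).
have ri1 : 1 <= ri.
  by rewrite lerDl; apply: mulr_ge0 (mulr_ge0 (ler0n _ 16) (ltW c20)) _; lra.
pose delta := h / ri.
have d0 : 0 < delta by rewrite divr_gt0//; lra.
have dh : delta <= h by rewrite ler_pdivrMr; [rewrite ler_peMr// ltW|lra].
(* The summand 8 keeps the centers at distance l / 8 from the complement of the cells, 1 / t gives t
   l >= 1, and 8 c2 G makes the outside term, multiplied by c2, at most S / 8. *)
pose L := 8 + t^-1 + 8 * c2 * G.
have ti0 : 0 < t^-1 by rewrite invr_gt0.
have cG0 : 0 <= c2 * G by rewrite mulr_ge0// ltW.
have L0 : 0 < L by rewrite /L; lra.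
exists L, delta; split=> //; split=> // I a b Iab Lab.
set l := b - a in Lab *; rewrite leNgt; apply/negP => cap.
have l0 : 0 < l by lra.
have l8 : 8 <= l by apply: le_trans Lab; rewrite /L; lra.
have tl1 : 1 <= t * l.
  have til : t^-1 <= l by apply: le_trans Lab; rewrite /L; lra.
  by rewrite -[leLHS](mulfV (lt0r_neq0 t0)) ler_pM2l.
have lG : 8 * c2 * G <= l by apply: le_trans Lab; rewrite /L; lra.
pose n := Num.truncn (l / h).
have lh0 : 0 <= l / h by rewrite divr_ge0// ltW.
have nl : n%:R * h <= l.
  by have := truncn_le (l / h); rewrite lh0 -/n ler_pdivlMr.
have ln : l < n%:R * h + h.
  by have := truncnS_gt (l / h); rewrite -/n ltr_pdivrMr// -natr1 mulrDl mul1r.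
set P := massive_cells mu delta a h n.
have Ncap := massive_cells_capacity mu h0 dh Iab nl.
have Nt : (#|P|%:R : R) < t * l by rewrite -lte_fin; apply: le_lt_trans Ncap cap.
(* D > 2 t l - 1 >= t l, which exceeds the number of massive cells. *)
pose D := Num.truncn (2 * (t * l)).
have Dl : D%:R <= 2 * (t * l) by have := truncn_le (2 * (t * l)); rewrite mulr_ge0// ltW//; lra.
have lD : 2 * (t * l) < D%:R + 1 by rewrite natr1; exact: truncnS_gt.
have PD : (#|P| < D)%N by rewrite -(ltr_nat R); lra.
pose q := a + l / 4; pose pt (k : nat) := q + k%:R / T.
have [al [[k0 k0D alk0] alP]] := vanishing_combination kap pt PD.
have fPW := comb_PW al pt (ltW kap0) D.
have [u [v [A [S [A0 eu ev [fE SE uS vS]]]]]] := PW_chains a10 fPW.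
have [cu bu] := eu.
have uE x : u 0%N x = combR kap al pt D x.
  by have := fE x; rewrite comb_real => -[].
(* The combination is real on the real line, so [u] alone carries its norm. *)
have vE x : v 0%N x = 0 by have := fE x; rewrite comb_real => -[].
have uS1 := bernstein A0 (ltW B0) eu uS; rewrite -/K in uS1.
have S0 := L2bound_ge0 uS.
have al_S : \sum_(k < D) al k ^+ 2 <= E * S.
  have := samples_energy q D T0 cu uS uS1.
  rewrite (eq_bigr (fun k : 'I_D => al k ^+ 2)); last first.
    by move=> k _; rewrite uE combR_lattice.
  by move=> /le_trans; apply; rewrite /E le_eqVlt; apply/orP; left; apply/eqP; ring.
pose J : set RT := `[a, (a + n%:R * h)%R[%classic.
have mJ : measurable J by exact: measurable_itv.
have inJ := inside_energy (n := n) D00 d0 h0 h1 HD cu uS uS1.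
have {}inJ := inJ a ltac:(by move=> i iP; rewrite uE; exact: alP).
have l80 : 0 < l / 8 by rewrite divr_gt0.
have far k x : (k < D)%N -> ~ J x -> l / 8 <= `|x - pt k|.
  move=> kD Jx; have kT0 : 0 <= k%:R / T by rewrite divr_ge0// ltW.
  have kT : k%:R / T <= l / 2.
    rewrite ler_pdivrMr//; apply: (@le_trans _ _ (D%:R)); first by rewrite ler_nat ltnW.
    by apply: le_trans Dl _; rewrite /T; lra.
  have [xa|ax] := ltP x a.
    by rewrite distrC; apply: le_trans (ler_norm _); rewrite /pt /q; clear - l8 xa kT0; lra.
  have xn : a + n%:R * h <= x.
    by rewrite leNgt; apply/negP => xn; apply: Jx; rewrite /J /= in_itv /= ax xn.
  by apply: le_trans (ler_norm _); rewrite /pt /q; clear - l8 h1 ln xn kT; lra.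
have outJ := @outside_energy mu C1 kap (l / 8) al pt D J mJ C10 (fun f fP => (HC1 f fP).2) kap0 l80 far.
have cc := continuous_sqr (chain_cont (k := 0) cu).
have muE : (\int[mu]_x (u 0%N x ^+ 2)%:E <=
   ((D0 * h + 2 * h * delta) * (K * S) + 2 * delta / h * S + G / l * S)%:E)%E.
  rewrite -(setUv J) ge0_integral_setU //=; last 4 first.
  - exact: measurableC.
  - exact: continuous_mfun.
  - by move=> x _; rewrite lee_fin sqr_ge0.
  - by rewrite disj_set2E setICr.
  rewrite EFinD; apply: leeD inJ _.
  under eq_integral do rewrite uE.
  apply: le_trans outJ _; rewrite lee_fin.
  apply: (@le_trans _ _ (2 * (t * l) * (E * S) * (kap * (l / 8))^-1 ^+ 2 * (C1 ^+ 2 * (2 * pi)))).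
    apply: ler_wpM2r; first by exact: mulr_ge0 (sqr_ge0 _) (mulr_ge0 (ler0n _ _) (pi_ge0 _)).
    apply: ler_wpM2r; first exact: sqr_ge0.
    have s0 : 0 <= \sum_(k < D) al k ^+ 2 by apply: sumr_ge0 => k _; exact: sqr_ge0.
    exact: ler_pM (ler0n _ D) s0 Dl al_S.
  rewrite /G le_eqVlt; apply/orP; left; apply/eqP.
  have ln0 : l != 0 by rewrite gt_eqF.
  have kn0 : kap != 0 by rewrite gt_eqF.
  by move: (pi : R) (kap) kn0 => pp kk kn0; field; rewrite ln0 kn0.
have Sle : S <= c2 * ((D0 * h + 2 * h * delta) * (K * S) + 2 * delta / h * S + G / l * S).
  have [low _] := HC2 _ fPW; move: low; rewrite le_L2norm ?invr_ge0 ?(ltW C20)//.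
  have fw x : cabs (comb kap al pt D x%:C) ^+ 2 = u 0%N x ^+ 2 + v 0%N x ^+ 2 by rewrite fE cabs_sqr.
  under eq_integral do rewrite fw; rewrite SE.
  have fw' x : cabs (comb kap al pt D x%:C) ^+ 2 = u 0%N x ^+ 2 by rewrite fw vE expr0n addr0.
  under eq_integral do rewrite fw'.
  move=> /le_trans/(_ muE); rewrite -EFinM lee_fin exprVn mulrC ler_pdivrMr ?exprn_gt0//.
  by rewrite mulrC.
have e1 : c2 * (D0 * h * K) <= 1 / 8.
  rewrite /h (_ : c2 * _ = (c2 * D0 * K) / hi); last by ring.
  by rewrite ler_pdivrMr; [rewrite /hi; clear; lra|clear - hi1; lra].
have e2 : c2 * (2 * h * delta * K + 2 * delta / h) <= 1 / 8.
  have r0 : 0 < ri^-1 by rewrite invr_gt0; lra.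
  have -> : 2 * delta / h = 2 * ri^-1 by rewrite /delta; field; rewrite !gt_eqF//; lra.
  have hd : h * delta <= ri^-1.
    rewrite /delta mulrA ler_piMl ?(ltW r0)//.
    by rewrite -[leRHS](mulr1 1); apply: ler_pM => //; exact: ltW.
  apply: (@le_trans _ _ (c2 * (2 * ri^-1 * (K + 1)))).
    apply: ler_wpM2l; first exact: ltW.
    have : h * delta * K <= ri^-1 * K by apply: ler_wpM2r => //; lra.
    lra.
  rewrite (_ : c2 * _ = (2 * c2 * (K + 1)) / ri); last by ring.
  by rewrite ler_pdivrMr; [rewrite /ri; clear; lra|clear - ri1; lra].
have e3 : c2 * (G / l) <= 1 / 8 by rewrite mulrA ler_pdivrMr//; lra.
(* S <= 3 S / 8 forces S = 0; then all coefficients vanish, against the choice of [al]. *)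
have S_0 : S = 0.
  apply/eqP; rewrite eq_le S0 andbT.
  have : S <= (c2 * (D0 * h * K) + c2 * (2 * h * delta * K + 2 * delta / h) + c2 * (G / l)) * S.
    by apply: le_trans Sle _; rewrite le_eqVlt; apply/orP; left; apply/eqP; ring.
  move: e1 e2 e3; move: (c2 * _) (c2 * _) (c2 * _) => x y z; nra.
have : 0 < \sum_(k < D) al k ^+ 2.
  rewrite (bigD1 (Ordinal k0D)) //= ltr_pwDl ?exprn_even_gt0//.
  by apply: sumr_ge0 => k _; exact: sqr_ge0.
by rewrite ltNge; move: al_S; rewrite S_0 mulr0 => ->.
Qed.

End MassiveOfSampling.

Theorem mainTheorem1 (R : realType) (mu : {measure set (measurableTypeR R) -> \bar R}) :
  PW_sampling mu <->
  ((exists M : R, forall x : R, (mu [set` `]x, (x + 1)%R[%classic] <= M%:E)%E) /\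
   (forall t : R, 0 < t -> exists L delta : R, 0 < L /\ 0 < delta /\
      forall (I : set R) (a b : R), interval_ab I a b -> L <= b - a ->
        ((t * (b - a))%:E <= capacity mu delta I)%E)).
Proof.
split=> [samp|[unit massive]]; last exact: sampling_of_massive.
by split; [exact: sampling_unit_mass|exact: massive_of_sampling].
Qed.
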